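(* Let $\vec p=(p_1,\dots,p_n)$ with $1<p_i<\infty$ for all $i$, and let $1<u'\le\infty$. Let $t,r$ satisfy either $1<\frac{n}{\sum_{i=1}^n1/p_i}<t<r<\infty$ or $1<\frac{n}{\sum_{i=1}^n1/p_i}\le t<r=\infty$. Then there is a constant $C>0$ such that for all $\{f_j\}_{j\in\mathbb N_0}\in\mathcal H_{\vec p\,'}^{t',r'}(\ell^{u'})$, $$\Big\|\Big(\sum_{j=0}^\infty\mathcal M(f_j)^{u'}\Big)^{1/u'}\Big\|_{\mathcal H_{\vec p\,'}^{t',r'}}\le C\Big\|\Big(\sum_{j=0}^\infty|f_j|^{u'}\Big)^{1/u'}\Big\|_{\mathcal H_{\vec p\,'}^{t',r'}}$$ (with suprema over $j$ in place of the $\ell^{u'}$ sums if $u'=\infty$).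
   Context: The Hardy-Littlewood maximal operator is $\mathcal Mf(x)=\sup_{B\ni x}\frac1{|B|}\int_B|f(y)|\,dy$, over all balls $B\ni x$. For $j\in\mathbb Z$, $k\in\mathbb Z^n$, let $Q_{j,k}=\prod_{i=1}^n[2^{-j}k_i,2^{-j}(k_i+1))$. A prime on an exponent denotes the conjugate exponent, $\vec p\,'=(p_1',\dots,p_n')$, and $\mathbb N_0=\{0,1,2,\dots\}$. Mixed Lebesgue norm: for measurable $f$ on $\mathbb R^n$, $$\|f\|_{L^{\vec p}}=\Big(\int_{\mathbb R}\cdots\Big(\int_{\mathbb R}|f(x_1,\dots,x_n)|^{p_1}dx_1\Big)^{p_2/p_1}\cdots dx_n\Big)^{1/p_n}$$ (innermost integration in $x_1$). Scalar block space: a measurable function $b$ is a $(\vec p\,',t')$-block supported on a cube $Q$ if $b$ is supported on $Q$ and $\|b\|_{L^{\vec p\,'}}\le|Q|^{\frac1t-\frac1n\sum_{i=1}^n\frac1{p_i}}$. $\mathcal H_{\vec p\,'}^{t',r'}$ is the set of all measurable $g=\sum_{(j,k)\in\mathbb Z^{n+1}}\lambda_{j,k}b_{j,k}$ (a.e. convergence) with $\lambda\in\ell^{r'}(\mathbb Z^{n+1})$ and each $b_{j,k}$ a $(\vec p\,',t')$-block supported on $Q_{j,k}$; $\|g\|_{\mathcal H_{\vec p\,'}^{t',r'}}=\inf_\lambda\|\lambda\|_{\ell^{r'}}$ over all such representations. Vector-valued block space: a sequence $\vec b=\{b_m\}_{m\in\mathbb N_0}$ of measurable functions is an $\ell^{u'}$-valued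 $(\vec p\,',t')$-block supported on a cube $Q$ if $\vec b$ is supported on $Q$ and $\big\|(\sum_{m=0}^\infty|b_m|^{u'})^{1/u'}\big\|_{L^{\vec p\,'}}\le|Q|^{\frac1t-\frac1n\sum_{i=1}^n\frac1{p_i}}$. $\mathcal H_{\vec p\,'}^{t',r'}(\ell^{u'})$ is the set of all sequences $\vec f=\{f_m\}_{m\in\mathbb N_0}$ of measurable functions with $\vec f=\sum_{(j,k)\in\mathbb Z^{n+1}}\lambda_{j,k}\vec b_{j,k}$ (a.e. convergence) for some $\lambda\in\ell^{r'}(\mathbb Z^{n+1})$ and $\ell^{u'}$-valued $(\vec p\,',t')$-blocks $\vec b_{j,k}$ supported on $Q_{j,k}$; its norm is the infimum of $\|\lambda\|_{\ell^{r'}}$ over such representations. *)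

(* Defs.v *)
From HB Require Import structures.
From mathcomp Require Import all_boot all_order all_algebra.
From mathcomp Require Import finmap.
From mathcomp Require Import all_classical all_reals all_analysis.
From mathcomp Require summability.
From mathcomp Require Import complex.

Set Implicit Arguments.
Unset Strict Implicit.
Unset Printing Implicit Defensive.

Import Order.TTheory GRing.Theory Num.Theory.
Import numFieldNormedType.Exports.

Local Open Scope classical_set_scope.
Local Open Scope ring_scope.
Local Open Scope complex_scope.

Notation Rn R n := (n.-tuple (measurableTypeR R)).

Section cons_measure.
Local Open Scope ereal_scope.
Context {R : realType}.
Variables (n : nat) (mu : {sigma_finite_measure set (Rn R n) -> \bar R}).

Definition cons_point (z : measurableTypeR R * Rn R n) : Rn R n.+1 :=
  [tuple of z.1 :: z.2].

Lemma measurable_cons_point : measurable_fun setT cons_point.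
Proof. exact: measurable_cons. Qed.

Let measurable_preimage_cons A : measurable A -> measurable (cons_point @^-1` A).
Proof.
by move=> mA; rewrite -[X in measurable X]setTI; exact: measurable_cons_point.
Qed.

(* The image of lebesgue_measure \x mu under the identification of
   R * R^n with R^(n+1). *)
Definition cons_measure : set (Rn R n.+1) -> \bar R :=
  pushforward (@lebesgue_measure R \x mu) cons_point.

Let cons_measure0 : cons_measure set0 = 0.
Proof. by rewrite /cons_measure /pushforward preimage_set0 measure0. Qed.

Let cons_measure_ge0 A : 0 <= cons_measure A.
Proof. exact: integral_ge0. Qed.

Let cons_measure_sigma_additive : semi_sigma_additive cons_measure.
Proof.
move=> F mF tF mUF; rewrite /cons_measure /pushforward preimage_bigcup.
apply: measure_semi_sigma_additive.
- by move=> k; exact: measurable_preimage_cons.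
- apply/trivIsetP => /= i j _ _ ij; rewrite -preimage_setI.
  by move/trivIsetP : tF => /(_ _ _ _ _ ij) ->//; rewrite preimage_set0.
- by rewrite -preimage_bigcup; exact: measurable_preimage_cons.
Qed.

HB.instance Definition _ := isMeasure.Build _ _ _ cons_measure
  cons_measure0 cons_measure_ge0 cons_measure_sigma_additive.

Let beheadE (a : measurableTypeR R) (x : Rn R n) :
  [tuple of behead (cons_point (a, x))] = x.
Proof. exact: val_inj. Qed.

Let cons_measure_sigma_finite : sigma_finite setT cons_measure.
Proof.
have /sigma_finiteP[F [FT ndF Foo]] := sigma_finiteT (@lebesgue_measure R).
have /sigma_finiteP[G [GT ndG Goo]] := sigma_finiteT mu.
exists (fun k => [set x | F k (thead x) /\ G k [tuple of behead x]]).
  apply/seteqP; split=> // x _.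
  have [i _ Fi] : (\bigcup_i F i) (thead x) by rewrite -FT.
  have [j _ Gj] : (\bigcup_i G i) [tuple of behead x] by rewrite -GT.
  exists (maxn i j) => //; split.
    by move: (thead x) Fi; exact/subsetPset/ndF/leq_maxl.
  by move: [tuple of behead x] Gj; exact/subsetPset/ndG/leq_maxr.
move=> k; have [mF Fk] := Foo k; have [mG Gk] := Goo k; split.
  apply: measurableI; rewrite -[X in measurable X]setTI.
    exact: measurable_tnth.
  exact: measurable_behead.
rewrite /cons_measure /pushforward.
rewrite (_ : cons_point @^-1` _ = F k `*` G k); last first.
  by apply/seteqP; split=> -[a x] /=; rewrite theadE beheadE.
by rewrite product_measure1E// lte_mul_pinfty// ge0_fin_numE.
Qed.

HB.instance Definition _ := Measure_isSigmaFinite.Build _ _ _ cons_measure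
  cons_measure_sigma_finite.

End cons_measure.

Fixpoint lebesgue_Rn (R : realType) (n : nat) :
    {sigma_finite_measure set (Rn R n) -> \bar R} :=
  match n with
  | 0 => @dirac _ (Rn R 0) [tuple] R
  | m.+1 => cons_measure (lebesgue_Rn R m)
  end.

Definition modulus (R : realType) (z : R[i]) : \bar R := (Normc.normc z)%:E.

(* Measurability for the completion of [lebesgue_Rn], i.e. Lebesgue
   measurability. *)
Definition lebesgue_measurable (R : realType) (n : nat) (f : Rn R n -> R[i]) :=
  exists g : Rn R n -> R[i],
    [/\ measurable_fun setT (fun x => complex.Re (g x)),
        measurable_fun setT (fun x => complex.Im (g x)) &
        \forall x \ae lebesgue_Rn R n, f x = g x].

Local Open Scope ereal_scope.

(* The head of [p] is the exponent of the innermost integration, which is with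
   respect to the first coordinate. *)
Fixpoint mixed_norm (R : realType) (n : nat) :
    n.-tuple (\bar R) -> (Rn R n -> \bar R) -> \bar R :=
  match n with
  | 0 => fun _ f => `|f [tuple]|
  | m.+1 => fun p f => mixed_norm [tuple of behead p]
      (fun y => Lnorm (@lebesgue_measure R) (thead p)
                  (fun a => f (cons_point (a, y))))
  end.

(* The norm of the sequence space l^q(I) for 0 < q <= +oo; the value at -oo is
   a dummy. *)
Definition lnorm (R : realType) (I : choiceType) (q : \bar R)
    (a : I -> \bar R) : \bar R :=
  match q with
  | s%:E => (\esum_(i in setT) `|a i| `^ s) `^ s^-1
  | +oo => ereal_sup (range (fun i => `|a i|))
  | -oo => 0
  end.

Definition euclidean_ball (R : realType) (n : nat) (c : Rn R n) (r : R) :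
    set (Rn R n) :=
  [set x | (\sum_(i < n) ((tnth x i : R) - (tnth c i : R)) ^+ 2 < r ^+ 2)%R].

Definition hl_maximal (R : realType) (n : nat) (f : Rn R n -> R[i]) (x : Rn R n) :
    \bar R :=
  ereal_sup [set (lebesgue_Rn R n B)^-1 *
                 \int[lebesgue_Rn R n]_(y in B) modulus (f y) |
             B in [set B | B x /\
               exists c r, (0 < r)%R /\ B = euclidean_ball c r]].

Definition dyadic_index (n : nat) := (int * n.-tuple int)%type.

Definition dyadic_cube (R : realType) (n : nat) (jk : dyadic_index n) :
    set (Rn R n) :=
  [set x | forall i : 'I_n,
    ((2%:R : R) ^ (- jk.1) * (tnth jk.2 i)%:~R <= (tnth x i : R)
       < (2%:R : R) ^ (- jk.1) * ((tnth jk.2 i)%:~R + 1))%R].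

Definition conj_exponents (R : realType) (n : nat) (p : n.-tuple R) :
    n.-tuple (\bar R) :=
  [tuple of map (fun q => hoelder_conjugate q%:E) p].

Definition block_bound (R : realType) (n : nat) (p : n.-tuple R) (t : R)
    (Q : set (Rn R n)) : \bar R :=
  lebesgue_Rn R n Q `^ (t^-1 - n%:R^-1 * \sum_(i < n) (tnth p i)^-1)%R.

Definition is_block (R : realType) (n : nat) (p : n.-tuple R) (t : R)
    (Q : set (Rn R n)) (b : Rn R n -> R[i]) :=
  [/\ lebesgue_measurable b,
      forall x, ~ Q x -> b x = 0%R &
      mixed_norm (conj_exponents p) (fun x => modulus (b x))
        <= block_bound p t Q].

(* In [is_vblock] and [vblock_space], [u] is the exponent of the sequence space
   itself, written with a prime in the notation l^{u'}; [p], [t] and [r] are the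
   unprimed exponents. *)
Definition is_vblock (R : realType) (n : nat) (p : n.-tuple R) (t : R)
    (u : \bar R) (Q : set (Rn R n)) (b : nat -> Rn R n -> R[i]) :=
  [/\ forall m, lebesgue_measurable (b m),
      forall m x, ~ Q x -> b m x = 0%R &
      mixed_norm (conj_exponents p)
        (fun x => lnorm u (fun m => modulus (b m x))) <= block_bound p t Q].

(* Convergence along finite sets of indices: no order on the index set I is
   involved. *)
Definition sums_to (R : realType) (I : choiceType) (a : I -> R[i]) (s : R[i]) :=
  summability.partial_sum a A @[A --> @summability.totally I]
    --> (s : (R[i])^o).

Definition coeff_norm (R : realType) (n : nat) (r : \bar R)
    (lam : dyadic_index n -> R[i]) : \bar R :=
  lnorm (hoelder_conjugate r) (fun jk => modulus (lam jk)).

Definition block_coeffs (R : realType) (n : nat) (p : n.-tuple R) (t : R)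
    (r : \bar R) (g : Rn R n -> R[i]) : set (dyadic_index n -> R[i]) :=
  [set lam | [/\ lebesgue_measurable g,
     coeff_norm r lam < +oo &
     exists b : dyadic_index n -> Rn R n -> R[i],
       (forall jk, is_block p t (dyadic_cube jk) (b jk)) /\
       \forall x \ae lebesgue_Rn R n,
         sums_to (fun jk => lam jk * b jk x)%R (g x)]].

(* The norm is +oo exactly for the functions outside the block space, which
   have no representation. *)
Definition block_norm (R : realType) (n : nat) (p : n.-tuple R) (t : R)
    (r : \bar R) (g : Rn R n -> R[i]) : \bar R :=
  ereal_inf [set coeff_norm r lam | lam in block_coeffs p t r g].

(* The block norm of an extended real valued function: a member of the block
   space is finite almost everywhere. *)
Definition eblock_norm (R : realType) (n : nat) (p : n.-tuple R) (t : R)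
    (r : \bar R) (G : Rn R n -> \bar R) : \bar R :=
  if `[< \forall x \ae lebesgue_Rn R n, G x \is a fin_num >]
  then block_norm p t r (fun x => (fine (G x))%:C%C) else +oo.

Definition vblock_space (R : realType) (n : nat) (p : n.-tuple R) (t : R)
    (r u : \bar R) : set (nat -> Rn R n -> R[i]) :=
  [set f | (forall m, lebesgue_measurable (f m)) /\
     exists (lam : dyadic_index n -> R[i])
            (b : dyadic_index n -> nat -> Rn R n -> R[i]),
       [/\ coeff_norm r lam < +oo,
           forall jk, is_vblock p t u (dyadic_cube jk) (b jk) &
           \forall x \ae lebesgue_Rn R n, forall m,
             sums_to (fun jk => lam jk * b jk m x)%R (f m x)]].

(* Main.v *)
(** The maximal operator is bounded on L^p'(l^u): a ball average is dominated by
    one-dimensional averages over two shifted dyadic grids, applied coordinate by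
    coordinate, and in one dimension the inequality for functions with values in an
    iterated Lebesgue space goes by induction on the iteration (Calderon-Zygmund and
    interpolation).

    For an l^u-valued block on a dyadic cube Q, split the maximal function over the
    3^n neighbours of the k-th ancestor of Q, k = 0, 1, ...: next to Q it is controlled
    by the previous inequality, and farther away by the mean of the block over the
    ancestor, which in terms of the normalisation of blocks gains 2^(-kn/t). All the
    pieces that fall on one cube P are gathered into a single function W_P, a multiple
    of a block; since n/t > n/r, Hoelder's inequality bounds the coefficients in l^r'.

    Finally, blocks of G = (sum_j |f_j|^u)^(1/u) become l^u-valued blocks for (f_j) upon
    multiplication by f_j / G, and if F is the left-hand function and S = sum_P W_P, then
    F <= S < +oo almost everywhere and F is the sum of the (F / S) W_P. *)
From HB Require Import structures.
Require Import Defs.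
From mathcomp Require Import all_boot all_order all_algebra.
From mathcomp Require Import finmap.
From mathcomp Require Import all_classical all_reals all_analysis.
From mathcomp Require summability.
From mathcomp Require Import complex.
From mathcomp Require Import measurable_realfun.
From mathcomp Require Import ring lra zify.
Set Implicit Arguments.
Unset Strict Implicit.
Unset Printing Implicit Defensive.

Import Order.TTheory GRing.Theory Num.Theory.
Import numFieldNormedType.Exports.

Local Open Scope classical_set_scope.
Local Open Scope ring_scope.
Local Open Scope ereal_scope.

(** Why all exponents at once: for functions with values in L^q(rho), Tonelli transfers from rho
    only the inequality with the same outer exponent q, whereas the next integration has its own
    exponent. Each level therefore goes from strong (q,q) to weak (1,1) and back to all strong
    inequalities. Maximal functions are first restricted to finitely many scales: absorbing a power
    of an integral requires that integral to be finite. The constants do not depend on the number of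
    scales, so monotone convergence removes the restriction. For the coefficients, up to 2^(kn)
    cubes lying k generations below P send pieces to a given neighbour P. With kappa = 2^(-n), the
    gain theta = 2^(-n/t) is eta * kappa^(1/r) with eta = 2^(-n(1/t - 1/r)) < 1: the power of kappa
    pays for the number of cubes, eta leaves a geometric series. For r = +oo, r' = 1 and eta =
    theta. The maximal operator is only sublinear, so the pieces merely majorise F. The factor F / S
    makes the representation exact; finiteness of S is checked on unit cubes, where condition n /
    sum(1/p_i) < t (or r' = 1) controls the contribution of the large cubes. *)

Section nonneg_measurable.
Context {R : realType}.

(** Integrals of such functions obey monotone convergence and Tonelli with the value +oo allowed, so
    no integrability has to be carried along. *)
Definition nnm d (T : measurableType d) (f : T -> \bar R) :=
  measurable_fun setT f /\ forall x, 0 <= f x.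

Section one.
Context d (T : measurableType d).
Implicit Types f g : T -> \bar R.

Lemma nnm_m f : nnm f -> measurable_fun setT f. Proof. by case. Qed.
Lemma nnm_ge0 f : nnm f -> forall x, 0 <= f x. Proof. by case. Qed.

Lemma nnm_cst (c : \bar R) : 0 <= c -> nnm (fun _ : T => c).
Proof. by move=> c0; split => //; exact: measurable_cst. Qed.

Lemma nnmD f g : nnm f -> nnm g -> nnm (fun x => f x + g x).
Proof.
move=> [mf f0] [mg g0]; split; first exact: emeasurable_funD.
by move=> x; rewrite adde_ge0.
Qed.

Lemma nnmM f g : nnm f -> nnm g -> nnm (fun x => f x * g x).
Proof.
move=> [mf f0] [mg g0]; split; first exact: emeasurable_funM.
by move=> x; rewrite mule_ge0.
Qed.

Lemma nnmZ c f : 0 <= c -> nnm f -> nnm (fun x => c * f x).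
Proof. by move=> c0 nf; apply: nnmM => //; exact: nnm_cst. Qed.

Lemma nnm_pow f (r : R) : nnm f -> nnm (fun x => f x `^ r).
Proof.
move=> [mf f0]; split; last by move=> x; exact: poweR_ge0.
exact: (measurableT_comp (measurable_poweR _)).
Qed.

Lemma nnm_max f g : nnm f -> nnm g -> nnm (fun x => maxe (f x) (g x)).
Proof.
move=> [mf f0] [mg g0]; split; first exact: measurable_maxe.
by move=> x; rewrite le_max f0.
Qed.

Lemma nnm_min f g : nnm f -> nnm g -> nnm (fun x => mine (f x) (g x)).
Proof.
move=> [mf f0] [mg g0]; split; first exact: measurable_mine.
by move=> x; rewrite le_min f0 g0.
Qed.

Lemma nnm_indic (A : set T) : measurable A -> nnm (fun x => (\1_A x)%:E).
Proof.
move=> mA; split; last by move=> x; rewrite lee_fin.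
by apply/measurable_EFinP; exact: measurable_indic.
Qed.

Lemma nnm_sum (I : Type) (s : seq I) (P : pred I) (f : I -> T -> \bar R) :
  (forall i, nnm (f i)) -> nnm (fun x => \sum_(i <- s | P i) f i x).
Proof.
move=> nf; split; last by move=> x; apply: sume_ge0 => i _; exact: nnm_ge0.
under eq_fun do rewrite big_mkcond.
apply: emeasurable_sum => i; case: (P i); [exact: nnm_m|exact: measurable_cst].
Qed.

Lemma nnm_sup (f : nat -> T -> \bar R) :
  (forall i, nnm (f i)) -> nnm (fun x => ereal_sup (range (f ^~ x))).
Proof.
move=> nf; split; last first.
  by move=> x; apply: le_trans (nnm_ge0 (nf 0%N) x) _; apply: ereal_sup_ubound; exists 0%N.
rewrite (_ : (fun _ => _) = (fun x => esups (f ^~ x) 0%N)); last first.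
  apply/funext => x; rewrite /esups /sdrop /=; congr ereal_sup.
  by apply/seteqP; split => [_ [n _ <-]|_ [n _ <-]]; exists n.
by apply: measurable_fun_esups => i; exact: nnm_m.
Qed.

Lemma nnm_series (f : nat -> T -> \bar R) :
  (forall i, nnm (f i)) -> nnm (fun x => \sum_(i <oo) f i x).
Proof.
move=> nf; split; last by move=> x; apply: nneseries_ge0 => i _ _; exact: nnm_ge0.
apply: ge0_emeasurable_sum => // i *; [exact: nnm_ge0|exact: nnm_m].
Qed.

Lemma le_int (mu : {measure set T -> \bar R}) f g : nnm f -> nnm g ->
  (forall x, f x <= g x) -> \int[mu]_x f x <= \int[mu]_x g x.
Proof. by move=> [mf f0] [mg g0] fg; exact: ge0_le_integral. Qed.

Lemma int_ge0 (mu : {measure set T -> \bar R}) f : nnm f -> 0 <= \int[mu]_x f x.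
Proof. by move=> [mf f0]; exact: integral_ge0. Qed.

Lemma intZ (mu : {measure set T -> \bar R}) c f : 0 <= c -> nnm f ->
  \int[mu]_x (c * f x) = c * \int[mu]_x f x.
Proof. by move=> c0 [mf f0]; rewrite ge0_integralZl. Qed.

Lemma intD (mu : {measure set T -> \bar R}) f g : nnm f -> nnm g ->
  \int[mu]_x (f x + g x) = \int[mu]_x f x + \int[mu]_x g x.
Proof. by move=> [mf f0] [mg g0]; rewrite ge0_integralD. Qed.

Lemma int_indic (mu : {measure set T -> \bar R}) f A : measurable A ->
  \int[mu]_(x in A) f x = \int[mu]_x ((\1_A x)%:E * f x).
Proof.
move=> mA; rewrite integral_mkcond; apply: eq_integral => x _.
by rewrite patchE indicE; case: ifPn => _; rewrite ?mul1e ?mul0e.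
Qed.

Lemma int_sup (mu : {measure set T -> \bar R}) (f : nat -> T -> \bar R) :
  (forall n, nnm (f n)) -> (forall x, {homo f ^~ x : n m / (n <= m)%N >-> n <= m}) ->
  \int[mu]_x ereal_sup (range (f ^~ x)) = ereal_sup (range (fun n => \int[mu]_x f n x)).
Proof.
move=> nf hf.
have e x : ereal_sup (range (f ^~ x)) = limn (f ^~ x).
  by apply/esym/cvg_lim => //; apply: ereal_nondecreasing_cvgn => n m; exact: hf.
under eq_integral do rewrite e.
rewrite monotone_convergence//.
- apply: cvg_lim => //; apply: ereal_nondecreasing_cvgn => n m nm.
  by apply: le_int => // x; exact: hf.
- by move=> n; exact: nnm_m.
- by move=> n x _; exact: nnm_ge0.
Qed.

Lemma int_series (mu : {measure set T -> \bar R}) (f : nat -> T -> \bar R) :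
  (forall n, nnm (f n)) ->
  \int[mu]_x (\sum_(n <oo) f n x) = \sum_(n <oo) \int[mu]_x f n x.
Proof.
by move=> nf; rewrite integral_nneseries// => [n|n x _]; [exact: nnm_m|exact: nnm_ge0].
Qed.

Lemma msr_gt f (c : \bar R) : nnm f -> measurable [set x | c < f x].
Proof.
move=> [mf _]; rewrite -[X in measurable X]setTI.
exact: emeasurable_fun_o_infty.
Qed.

Lemma int0_ae (mu : {measure set T -> \bar R}) f : nnm f ->
  \int[mu]_x f x = 0 -> \forall x \ae mu, f x = 0.
Proof.
move=> [mf f0] h; have : ae_eq mu setT f (cst 0).
  apply/ae_eq_integral_abs => //; rewrite -h; apply: eq_integral => x _.
  by rewrite gee0_abs.
by apply: filterS => x /(_ I).
Qed.

Lemma int_ae (mu : {measure set T -> \bar R}) f g : nnm f -> nnm g ->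
  (\forall x \ae mu, f x = g x) -> \int[mu]_x f x = \int[mu]_x g x.
Proof.
move=> [mf f0] [mg g0] fg; apply: ge0_ae_eq_integral => //.
by apply: filterS fg.
Qed.

Lemma le_int_ae (mu : {measure set T -> \bar R}) f g : nnm f -> nnm g ->
  (\forall x \ae mu, f x <= g x) -> \int[mu]_x f x <= \int[mu]_x g x.
Proof.
move=> [mf f0] [mg g0] fg; apply: ae_ge0_le_integral => //.
by apply: filterS fg.
Qed.

Lemma int_fin_ae (mu : {measure set T -> \bar R}) f : nnm f ->
  \int[mu]_x f x < +oo -> \forall x \ae mu, f x < +oo.
Proof.
move=> [mf f0] h.
have /integrable_ae : mu.-integrable setT f.
  apply/integrableP; split => //; rewrite (le_lt_trans _ h)//.
  by apply: ge0_le_integral => //; [exact: measurableT_comp|move=> x _; rewrite gee0_abs].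
move=> /(_ measurableT); apply: filterS => x /(_ I).
by rewrite ge0_fin_numE.
Qed.

End one.

Lemma nnm_comp d (T : measurableType d) d' (T' : measurableType d')
    (f : T -> \bar R) (h : T' -> T) :
  nnm f -> measurable_fun setT h -> nnm (fun x => f (h x)).
Proof.
move=> [mf f0] mh; split => //; exact: (measurableT_comp mf mh).
Qed.

Lemma nnm_pair1 d (T : measurableType d) d' (T' : measurableType d')
    (f : T * T' -> \bar R) x : nnm f -> nnm (fun y => f (x, y)).
Proof. by move=> nf; apply: nnm_comp nf _; exact: pair1_measurable. Qed.

Lemma nnm_pair2 d (T : measurableType d) d' (T' : measurableType d')
    (f : T * T' -> \bar R) y : nnm f -> nnm (fun x => f (x, y)).
Proof. by move=> nf; apply: nnm_comp nf _; exact: pair2_measurable. Qed.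

Lemma nnm_swap d (T : measurableType d) d' (T' : measurableType d')
    (f : T * T' -> \bar R) : nnm f -> nnm (fun z : T' * T => f (z.2, z.1)).
Proof.
by move=> nf; apply: (nnm_comp nf); apply/measurable_fun_pairP; split;
  [exact: measurable_snd|exact: measurable_fst].
Qed.

Lemma nnm_int1 d (T : measurableType d) d' (T' : measurableType d')
    (mu : {sigma_finite_measure set T -> \bar R}) (f : T * T' -> \bar R) :
  nnm f -> nnm (fun y => \int[mu]_x f (x, y)).
Proof.
move=> nf; split; last by move=> y; apply: int_ge0; exact: nnm_pair2.
by apply: (measurable_fun_fubini_tonelli_G); [exact: nnm_m|exact: nnm_ge0].
Qed.

Lemma nnm_int2 d (T : measurableType d) d' (T' : measurableType d')
    (mu : {sigma_finite_measure set T' -> \bar R}) (f : T * T' -> \bar R) :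
  nnm f -> nnm (fun x => \int[mu]_y f (x, y)).
Proof.
move=> nf; split; last by move=> y; apply: int_ge0; exact: nnm_pair1.
by apply: (measurable_fun_fubini_tonelli_F); [exact: nnm_m|exact: nnm_ge0].
Qed.

Lemma tonelli d (T : measurableType d) d' (T' : measurableType d')
    (mu : {sigma_finite_measure set T -> \bar R})
    (nu : {sigma_finite_measure set T' -> \bar R}) (f : T * T' -> \bar R) :
  nnm f -> \int[mu]_x \int[nu]_y f (x, y) = \int[nu]_y \int[mu]_x f (x, y).
Proof. by move=> [mf f0]; exact: fubini_tonelli. Qed.

End nonneg_measurable.

(** * Real powers of nonnegative extended reals *)

Section powers.
Context {R : realType}.
Implicit Types (x y : \bar R) (p q : R).

Lemma le_pow x y p : (0 <= p)%R -> 0 <= x -> x <= y -> x `^ p <= y `^ p.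
Proof.
move=> p0 x0 xy; apply: gt0_ler_poweR => //; rewrite in_itv/= leey andbT//.
exact: le_trans xy.
Qed.

Lemma powK x p : (p != 0)%R -> 0 <= x -> (x `^ p) `^ p^-1 = x.
Proof. by move=> p0 x0; rewrite -poweRrM mulfV// poweRe1. Qed.

Lemma powVK x p : (p != 0)%R -> 0 <= x -> (x `^ p^-1) `^ p = x.
Proof. by move=> p0 x0; rewrite -poweRrM mulVf// poweRe1. Qed.

Lemma le_pow_inv x y p : (0 < p)%R -> 0 <= x -> 0 <= y ->
  x `^ p <= y `^ p -> x <= y.
Proof.
move=> p0 x0 y0 h; rewrite -(@powK x p) ?gt_eqF// -(@powK y p) ?gt_eqF//.
by apply: le_pow => //; [rewrite invr_ge0 ltW|exact: poweR_ge0].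
Qed.

Lemma powD x p q : (0 < p)%R -> (0 < q)%R -> x `^ (p + q) = x `^ p * x `^ q.
Proof. by move=> p0 q0; rewrite poweRD// add_neq0_poweRD_def// gt_eqF// addr_gt0. Qed.

Lemma pow_sup (f : nat -> \bar R) p : (0 < p)%R -> (forall n, 0 <= f n) ->
  (ereal_sup (range f)) `^ p = ereal_sup (range (fun n => f n `^ p)).
Proof.
move=> p0 f0; have s0 : 0 <= ereal_sup (range f).
  by apply: le_trans (f0 0%N) _; apply: ereal_sup_ubound; exists 0%N.
have p00 : (p != 0)%R by rewrite gt_eqF.
have pV0 : (0 <= p^-1)%R by rewrite invr_ge0 ltW.
apply/eqP; rewrite eq_le; apply/andP; split; last first.
  apply: ge_ereal_sup => _ [n _ <-]; apply: le_pow => //; first exact: ltW.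
  by apply: ereal_sup_ubound; exists n.
set S := ereal_sup (range (fun n => f n `^ p)).
have S0 : 0 <= S.
  by apply: le_trans (poweR_ge0 (f 0%N) p) _; apply: ereal_sup_ubound; exists 0%N.
rewrite -[S](@powVK _ p)//; apply: le_pow => //; first exact: ltW.
apply: ge_ereal_sup => _ [n _ <-]; rewrite -[f n](@powK _ p)//.
by apply: le_pow => //; [exact: poweR_ge0|apply: ereal_sup_ubound; exists n].
Qed.

(** Divide by the power of [x] on the right. This fails for [x = +oo], which is why the applications
    truncate first. *)
Lemma pow_absorb x (A : \bar R) p : (1 < p)%R -> 0 <= x -> 0 <= A -> x < +oo ->
  x <= A * x `^ (1 - p^-1) -> x `^ p^-1 <= A.
Proof.
move=> p1 x0 A0 xoo h.
have p0 : (0 < p)%R by apply: lt_trans p1.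
have [->|xn0] := eqVneq x 0; first by rewrite poweR0r// invr_neq0// gt_eqF.
have x0' : 0 < x by rewrite lt0e xn0.
case: x x0 xoo h xn0 x0' => [x| |]// _ _.
case: A A0 => [a| |]//; last by move=> *; rewrite leey.
rewrite lee_fin => a0 h _; rewrite lte_fin => x0; move: h; rewrite /= -EFinM !lee_fin => h.
have y0 : (0 < x `^ (1 - p^-1))%R by rewrite powR_gt0.
rewrite -(ler_pM2r y0) (le_trans _ h)// -powRD ?gt_eqF ?implybT//.
  by rewrite addrCA subrr addr0 powRr1// ltW.
by rewrite addrCA subrr addr0.
Qed.

End powers.

(** * Hoelder's and Minkowski's integral inequalities *)

Section hoelder_minkowski.
Context {R : realType}.

(** If one of the two integrals is 0 or +oo the bound is direct; otherwise both functions are finite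
    almost everywhere and the inequality for real functions applies to their [fine] parts. *)
Lemma hoelder_ge0 d (T : measurableType d) (mu : {measure set T -> \bar R})
    (f g : T -> \bar R) (p q : R) : nnm f -> nnm g -> (0 < p)%R -> (0 < q)%R ->
    (p^-1 + q^-1 = 1)%R ->
  \int[mu]_x (f x * g x) <=
    (\int[mu]_x f x `^ p) `^ p^-1 * (\int[mu]_x g x `^ q) `^ q^-1.
Proof.
(* The two factors play symmetric roles, so the second integral may be assumed finite whenever the
   first one is. *)
wlog : f g p q / \int[mu]_x f x `^ p < +oo -> \int[mu]_x g x `^ q < +oo.
  move=> H nf ng p0 q0 pq.
  have [gf|/negP] := pselect (\int[mu]_x g x `^ q < +oo); first exact: H.
  rewrite -leNgt leye_eq => /eqP gy.
  rewrite muleC; under eq_integral do rewrite muleC.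
  apply: H => //; first by rewrite gy ltxx.
  by rewrite addrC.
move=> fgfin nf ng p0 q0 pq.
have pn0 : (p != 0)%R by rewrite gt_eqF.
have qn0 : (q != 0)%R by rewrite gt_eqF.
have [gf|] := pselect (\int[mu]_x g x `^ q < +oo); last first.
  move=> gf; have fy : \int[mu]_x f x `^ p = +oo.
    by apply/eqP; rewrite -leye_eq leNgt; apply/negP => /fgfin.
  move/negP: gf; rewrite -leNgt leye_eq => /eqP ->.
  by rewrite fy !poweRyr ?invr_neq0// mulyy leey.
have [g0|gn0] := eqVneq (\int[mu]_x g x `^ q) 0.
  rewrite g0 poweR0r ?invr_neq0// mule0.
  have := int0_ae (nnm_pow q ng) g0 => h.
  suff -> : \int[mu]_x (f x * g x) = 0 by [].
  rewrite -[RHS](integral0 mu setT); apply: int_ae; [exact: nnmM|exact: nnm_cst|].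
  apply: filterS h => x /poweR_eq0_eq0 => -> //; first by rewrite mule0.
  exact: (nnm_ge0 ng).
have [ff|] := pselect (\int[mu]_x f x `^ p < +oo); last first.
  move/negP; rewrite -leNgt leye_eq => /eqP ->.
  rewrite poweRyr ?invr_neq0// gt0_mulye ?leey// poweR_gt0//.
  by rewrite lt0e gn0 int_ge0//; exact: nnm_pow.
have fin (h : T -> \bar R) r : (r != 0)%R -> nnm h -> \int[mu]_x h x `^ r < +oo ->
    \forall x \ae mu, h x = (fine (h x))%:E.
  move=> rn0 nh hf; have := int_fin_ae (nnm_pow r nh) hf.
  apply: filterS => x /(lty_poweRy rn0) hx; rewrite fineK// ge0_fin_numE//.
  exact: (nnm_ge0 nh).
have nfine (h : T -> \bar R) : nnm h -> nnm (fun x => (fine (h x))%:E).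
  move=> [mh h0]; split; last by move=> x; rewrite lee_fin fine_ge0.
  by apply/measurable_EFinP; exact: measurableT_comp.
have fe := fin f p pn0 nf ff; have ge := fin g q qn0 ng gf.
have mfine (h : T -> \bar R) : nnm h -> measurable_fun setT (fun x => fine (h x)).
  by move=> /nfine [/measurable_EFinP].
have := hoelder mu (mfine f nf) (mfine g ng) p0 q0 pq.
rewrite Lnorm1 unlock /=.
rewrite (_ : \int[mu]_x _ = \int[mu]_x (f x * g x)); last first.
  apply: int_ae.
  - split => //; apply/measurable_EFinP/measurableT_comp => //.
    by apply: measurable_funM; exact: mfine.
  - exact: nnmM.
  - apply: filterS2 fe ge => x {2}-> {2}->.
    by rewrite -EFinM ger0_norm// mulr_ge0// fine_ge0//; apply: nnm_ge0.
have e (h : T -> \bar R) r : (r != 0)%R -> nnm h ->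
    (\forall x \ae mu, h x = (fine (h x))%:E) ->
    \int[mu]_x (`|fine (h x)| `^ r)%:E = \int[mu]_x h x `^ r.
  move=> rn0 nh he; apply: int_ae.
  - apply: (eq_ind _ (@nnm R _ T) (nnm_pow r (nfine h nh))).
    by apply/funext => x /=; rewrite ger0_norm// fine_ge0//; apply: nnm_ge0.
  - exact: nnm_pow.
  - apply: filterS he => x {2}-> /=.
    by rewrite ger0_norm// fine_ge0//; apply: nnm_ge0.
by rewrite (e f)// (e g).
Qed.

(** Hoelder with the conjugate exponent p/(p-1), which turns h^(p-1) back into h^p. Combined with
    [pow_absorb] it bounds the L^p norm of [h]. *)
Lemma int_pow_conj d (T : measurableType d) (mu : {measure set T -> \bar R})
    (h v : T -> \bar R) (p : R) : nnm h -> nnm v -> (1 < p)%R ->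
  \int[mu]_x (h x `^ (p - 1) * v x) <=
  (\int[mu]_x v x `^ p) `^ p^-1 * (\int[mu]_x h x `^ p) `^ (1 - p^-1).
Proof.
move=> nh nv p1.
have p0 : (0 < p)%R by apply: lt_trans p1.
have p10 : (0 < p - 1)%R by rewrite subr_gt0.
have e1 : (1 - p^-1 = (p / (p - 1))^-1)%R.
  by rewrite invf_div mulrBl divff ?mul1r// gt_eqF.
under eq_integral do rewrite muleC.
apply: (le_trans (@hoelder_ge0 _ _ mu _ _ p (p / (p - 1)) nv (nnm_pow (p - 1) nh) p0 _ _)).
- by rewrite divr_gt0.
- by rewrite -e1 addrC subrK.
- rewrite -e1; under [X in _ * X `^ _]eq_integral do
    rewrite -poweRrM mulrC divfK ?gt_eqF//.
  exact: lexx.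
Qed.

(** Write H^p = H^(p-1) H, exchange the integrals, apply Hoelder in [t] for each [s], and absorb the
    power of the integral of H^p. *)
Lemma minkowski_int d (S : measurableType d) d' (T : measurableType d')
    (mu : {sigma_finite_measure set S -> \bar R})
    (nu : {sigma_finite_measure set T -> \bar R})
    (f : S * T -> \bar R) (p : R) : (1 < p)%R -> nnm f ->
  (\int[nu]_t (\int[mu]_s f (s, t)) `^ p) `^ p^-1 <=
   \int[mu]_s (\int[nu]_t f (s, t) `^ p) `^ p^-1.
Proof.
move=> p1 nf; have p0 : (0 < p)%R by apply: lt_trans p1.
have pn0 : (p != 0)%R by rewrite gt_eqF.
pose H t := \int[mu]_s f (s, t).
have nH : nnm H by exact: nnm_int1.
set A := \int[mu]_s _.
have nA : nnm (fun s => (\int[nu]_t f (s, t) `^ p) `^ p^-1).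
  apply: nnm_pow; exact: (nnm_int2 nu (nnm_pow p nf)).
have A0 : 0 <= A by exact: int_ge0.
have /sigma_finiteP[E [ET ndE Eoo]] := sigma_finiteT nu.
(* Cut in height and restricted to a set of finite measure, so that the integral of its p-th power
   is finite and may be absorbed. *)
pose h n t := mine (H t) n%:R%:E * (\1_(E n) t)%:E.
have mE n : measurable (E n) by have [] := Eoo n.
have nh n : nnm (h n).
  apply: nnmM; [apply: nnm_min => //; apply: nnm_cst; rewrite lee_fin//|exact: nnm_indic].
have hH n t : h n t <= H t.
  rewrite /h indicE; case: (_ \in _); rewrite ?mule1 ?mule0 ?ge_min ?lexx//.
  exact: (nnm_ge0 nH).
have hfin n : \int[nu]_t h n t `^ p < +oo.
  apply: (@le_lt_trans _ _ (\int[nu]_t ((n%:R `^ p)%:E * (\1_(E n) t)%:E))).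
    apply: le_int.
    - exact: nnm_pow.
    - by apply: nnmZ; [rewrite lee_fin powR_ge0|exact: nnm_indic].
    - move=> t; rewrite /h indicE; case: (_ \in _).
        rewrite !mule1 -poweR_EFin; apply: le_pow; [exact: ltW| |].
          by rewrite le_min (nnm_ge0 nH) lee_fin ler0n.
        by rewrite ge_min lexx orbT.
      by rewrite !mule0 poweR0r.
  rewrite intZ; [|by rewrite lee_fin powR_ge0|exact: nnm_indic].
  rewrite integral_indic// setIT lte_mul_pinfty ?lee_fin ?powR_ge0//.
  by have [] := Eoo n.
have key n : (\int[nu]_t h n t `^ p) `^ p^-1 <= A.
  apply: pow_absorb => //; first by apply: int_ge0; exact: nnm_pow.
  have e t : h n t `^ p = h n t `^ (p - 1) * h n t.
    rewrite -[X in _ * X](@poweRe1 _ (h n t)); last exact: (nnm_ge0 (nh n)).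
    by rewrite -powD ?subr_gt0// subrK.
  apply: (@le_trans _ _ (\int[nu]_t \int[mu]_s (h n t `^ (p - 1) * f (s, t)))).
    apply: le_int; first exact: nnm_pow.
      apply: (@nnm_int1 _ _ _ _ _ mu (fun z => h n z.2 `^ (p - 1) * f z)).
      by apply: nnmM => //; apply: nnm_pow; exact: (nnm_comp (nh n) measurable_snd).
    move=> t; rewrite intZ; [|exact: poweR_ge0|exact: nnm_pair2].
    rewrite e lee_pmul//; [exact: poweR_ge0|exact: (nnm_ge0 (nh n))].
  have nz : nnm (fun z : S * T => h n z.2 `^ (p - 1) * f z).
    by apply: nnmM => //; apply: nnm_pow; exact: (nnm_comp (nh n) measurable_snd).
  rewrite -(@tonelli _ _ _ _ _ mu nu (fun z => h n z.2 `^ (p - 1) * f z))//=.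
  apply: (@le_trans _ _ (\int[mu]_s ((\int[nu]_t f (s, t) `^ p) `^ p^-1 *
      (\int[nu]_t h n t `^ p) `^ (1 - p^-1)))).
    apply: le_int.
    - exact: (nnm_int2 nu nz).
    - by apply: nnmM => //; apply: nnm_cst; exact: poweR_ge0.
    - by move=> s; apply: int_pow_conj => //; exact: nnm_pair1.
  under eq_integral do rewrite muleC.
  by rewrite intZ ?poweR_ge0// muleC.
(* Both cuts are released together: the truncations increase to [H], and monotone convergence passes
   the bound to the limit. *)
have Hsup t : H t `^ p = ereal_sup (range (fun n => h n t `^ p)).
  rewrite -pow_sup//; last by move=> n; exact: (nnm_ge0 (nh n)).
  congr (_ `^ _); apply/eqP; rewrite eq_le; apply/andP; split; last first.
    by apply: ge_ereal_sup => _ [n _ <-].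
  have [k _ Ek] : (\bigcup_i E i) t by rewrite -ET.
  have hE n : (k <= n)%N -> h n t = mine (H t) n%:R%:E.
    move=> kn; rewrite /h indicE mem_set ?mule1//.
    by move/subsetPset: (ndE _ _ kn); apply.
  have H0 := nnm_ge0 nH t.
  case: (H t) H0 hE => [r| |]// r0 hE.
    have [m rm] : exists m, (r <= m%:R)%R.
      by exists (Num.bound r); rewrite ltW// archi_boundP.
    apply: ereal_sup_ubound; exists (maxn k m) => //.
    rewrite hE ?leq_maxl//; apply/min_idPl; rewrite lee_fin (le_trans rm)//.
    by rewrite ler_nat leq_maxr.
  rewrite leye_eq; apply/eqP/eqyP => b b0.
  apply: (@le_trans _ _ (h (maxn k (Num.bound b)) t)); last first.
    by apply: ereal_sup_ubound; exists (maxn k (Num.bound b)).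
  rewrite hE ?leq_maxl// le_min leey /= lee_fin.
  rewrite (le_trans (ltW (archi_boundP (ltW b0))))//.
  by rewrite ler_nat leq_maxr.
rewrite (_ : \int[nu]_t _ = \int[nu]_t ereal_sup (range (fun n => h n t `^ p))); last first.
  by apply: eq_integral => t _; exact: Hsup.
rewrite int_sup.
- rewrite pow_sup ?invr_gt0//; last by move=> n; apply: int_ge0; exact: nnm_pow.
  by apply: ge_ereal_sup => _ [n _ <-].
- by move=> n; exact: nnm_pow.
- move=> t n m nm; apply: le_pow; [exact: ltW|exact: (nnm_ge0 (nh n))|].
  rewrite /h lee_pmul//.
  + by rewrite le_min (nnm_ge0 nH) lee_fin ler0n.
  + by rewrite le_min ge_min lexx ge_min lee_fin ler_nat nm orbT.
  + rewrite lee_fin !indicE ler_nat; case: (boolP (t \in E n)) => // /set_mem.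
    by move/subsetPset: (ndE _ _ nm) => /[apply] /mem_set ->.
Qed.

End hoelder_minkowski.

(** Makes series a case of sigma-finite integrals, so that Tonelli and Minkowski apply to sequence
    norms. *)
HB.instance Definition _ (R : realType) :=
  Measure_isSigmaFinite.Build _ _ _ (@counting nat R) (sigma_finite_counting R).

(** * Iterated Lebesgue and sequence norms *)

Section nice_norm.
Context {R : realType}.

(* The properties of the L^q and l^q norms that are inherited by iterated norms. *)
Record nice d (T : measurableType d) (rho : (T -> \bar R) -> \bar R) : Prop := {
  nice_ge0 : forall f, 0 <= rho f ;
  nice_le : forall f g, nnm f -> nnm g -> (forall t, f t <= g t) -> rho f <= rho g ;
  niceZ : forall (c : R) f, (0 <= c)%R -> nnm f ->
    rho (fun t => c%:E * f t) = c%:E * rho f ;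
  nice_sup : forall f : nat -> T -> \bar R, (forall n, nnm (f n)) ->
    (forall t, {homo f ^~ t : n m / (n <= m)%N >-> n <= m}) ->
    rho (fun t => ereal_sup (range (f ^~ t))) = ereal_sup (range (rho \o f)) ;
  nice_nnm : forall d' (S : measurableType d') (f : S * T -> \bar R), nnm f ->
    nnm (fun s => rho (fun t => f (s, t))) ;
  nice_mink : forall d' (S : measurableType d')
    (mu : {sigma_finite_measure set S -> \bar R}) (f : S * T -> \bar R), nnm f ->
    rho (fun t => \int[mu]_s f (s, t)) <= \int[mu]_s rho (fun t => f (s, t)) }.

Lemma nnm_nat d (T : measurableType d) (f : nat -> T -> \bar R) :
  (forall n, nnm (f n)) -> nnm (fun z : nat * T => f z.1 z.2).
Proof.
move=> nf; split; last by move=> z; exact: (nnm_ge0 (nf _)).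
move=> _ B mB; rewrite setTI.
rewrite (_ : _ @^-1` _ = \bigcup_n ([set n] `*` (f n @^-1` B))); last first.
  apply/seteqP; split => [[n t] /= Bf|[n t] [m _] [/= -> //]].
  by exists n.
apply: bigcup_measurable => n _; apply: measurableX => //.
by rewrite -[X in measurable X]setTI; exact: (nnm_m (nf n)).
Qed.

Section theory.
Context d (T : measurableType d) (rho : (T -> \bar R) -> \bar R).
Hypothesis H : nice rho.

Lemma nice0 : rho (fun _ => 0) = 0.
Proof.
have := @niceZ _ _ _ H 0%R (fun _ => 0) (lexx _) (nnm_cst _ (lexx _)).
by under [in X in X -> _]eq_fun do rewrite mul0e; rewrite mul0e.
Qed.

(** Countable subadditivity is the Minkowski property for the counting measure. *)
Lemma nice_series (f : nat -> T -> \bar R) : (forall n, nnm (f n)) ->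
  rho (fun t => \sum_(n <oo) f n t) <= \sum_(n <oo) rho (f n).
Proof.
move=> nf.
have := @nice_mink _ _ _ H _ _
  (@counting nat R : {sigma_finite_measure set nat -> \bar R})
  (fun z => f z.1 z.2) (nnm_nat nf).
rewrite /= ge0_integral_count; last by move=> n; exact: nice_ge0.
apply: le_trans; rewrite le_eqVlt; apply/orP; left; apply/eqP; congr rho.
by apply/funext => t; rewrite ge0_integral_count// => n; exact: (nnm_ge0 (nf n)).
Qed.

Lemma niceD f g : nnm f -> nnm g -> rho (fun t => f t + g t) <= rho f + rho g.
Proof.
move=> nf ng.
pose h n := match n with 0%N => f | 1%N => g | _ => fun _ => 0 end.
have nh n : nnm (h n) by case: n => [|[|n]]//=; exact: nnm_cst.
have hE (F : (T -> \bar R) -> \bar R) : F (fun _ => 0) = 0 -> (forall n, 0 <= F (h n)) ->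
    \sum_(n <oo) F (h n) = F f + F g.
  move=> F0 Fge; rewrite (nneseries_split 0 2)// add0n.
  rewrite eseries_cond eseries0 ?adde0; last by move=> [|[|n]] _ //= /F0.
  by rewrite !big_nat_recr//= big_geq// add0e.
have := nice_series nh.
rewrite hE; [|exact: nice0|by move=> n; exact: nice_ge0].
apply: le_trans; rewrite le_eqVlt; apply/orP; left; apply/eqP; congr rho.
apply/funext => t; apply/esym; rewrite (hE (fun F => F t))// => n.
exact: (nnm_ge0 (nh n)).
Qed.

End theory.

Section pull.
Context d (T : measurableType d) d' (T' : measurableType d') (phi : T -> T').
Hypothesis mphi : measurable_fun setT phi.
Variable rho : (T -> \bar R) -> \bar R.
Hypothesis H : nice rho.

(** Needed because the iteration produces norms over products with dummy factors and a fixed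
    bracketing, while [lnorm] and [mixed_norm] live on simpler domains. *)
Lemma nice_pull : nice (fun f : T' -> \bar R => rho (fun t => f (phi t))).
Proof.
have nphi f : nnm f -> nnm (fun t => f (phi t)) by move=> nf; exact: nnm_comp nf mphi.
split.
- by move=> f; exact: (nice_ge0 H).
- by move=> f g nf ng fg; apply: (nice_le H) => //; exact: nphi.
- by move=> c f c0 nf; rewrite (niceZ H)//; exact: nphi.
- move=> f nf hf; rewrite (nice_sup H)// => n; exact: nphi.
- move=> d1 S f nf; apply: (@nice_nnm _ _ _ H _ _ (fun z => f (z.1, phi z.2))).
  apply: (nnm_comp nf); apply/measurable_fun_pairP; split; first exact: measurable_fst.
  exact: (measurableT_comp mphi measurable_snd).
- move=> d1 S mu f nf; apply: (@nice_mink _ _ _ H _ _ mu (fun z => f (z.1, phi z.2))).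
  apply: (nnm_comp nf); apply/measurable_fun_pairP; split; first exact: measurable_fst.
  exact: (measurableT_comp mphi measurable_snd).
Qed.

End pull.

Lemma eq_sup (f g : nat -> \bar R) : f =1 g -> ereal_sup (range f) = ereal_sup (range g).
Proof. by move/funext ->. Qed.

(** Start of the iteration: scalars are functions on a point. *)
Lemma nice_abs : nice (fun f : unit -> \bar R => `|f tt|).
Proof.
split => //.
- by move=> f g nf ng fg; rewrite !gee0_abs//; [exact: (nnm_ge0 ng)|exact: (nnm_ge0 nf)].
- by move=> c f c0 nf; rewrite abseM gee0_abs.
- move=> f nf hf; rewrite gee0_abs; last exact: (nnm_ge0 (nnm_sup nf)).
  apply: eq_sup => n /=.
  by rewrite gee0_abs//; exact: (nnm_ge0 (nf n)).
- move=> d' S f nf; split; last by move=> s.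
  by apply: measurableT_comp => //; exact: (nnm_m (nnm_pair2 tt nf)).
- move=> d' S mu f nf; rewrite gee0_abs; last by apply: int_ge0; exact: nnm_pair2.
  rewrite le_eqVlt; apply/orP; left; apply/eqP; apply: eq_integral => s _.
  by rewrite gee0_abs//; exact: (nnm_ge0 nf).
Qed.

(** The case [u = +oo] of [lnorm], a second start of the iteration since it is not of the form
    [Lq]. *)
Definition supnorm (f : nat -> \bar R) := ereal_sup (range (fun j => `|f j|)).

Lemma supnormE f : (forall n, 0 <= f n) -> supnorm f = ereal_sup (range f).
Proof.
by move=> f0; apply: eq_sup => n; rewrite gee0_abs.
Qed.

Lemma sup_le (f : nat -> \bar R) c : (forall n, f n <= c) -> ereal_sup (range f) <= c.
Proof. by move=> fc; apply: ge_ereal_sup => _ [n _ <-]. Qed.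

Lemma le_sup (f : nat -> \bar R) n : f n <= ereal_sup (range f).
Proof. by apply: ereal_sup_ubound; exists n. Qed.

Lemma nice_supnorm : nice supnorm.
Proof.
split.
- by move=> f; apply: le_trans (le_sup _ 0%N).
- move=> f g nf ng fg; rewrite !supnormE; [|exact: (nnm_ge0 ng)|exact: (nnm_ge0 nf)].
  by apply: sup_le => n; apply: le_trans (le_sup _ n).
- move=> c f c0 nf; rewrite !supnormE; [|exact: (nnm_ge0 nf)|]; last first.
    by move=> n; rewrite mule_ge0//; exact: (nnm_ge0 nf).
  apply/eqP; rewrite eq_le; apply/andP; split.
    by apply: sup_le => n; rewrite lee_wpmul2l ?lee_fin//; exact: le_sup.
  have [->|cn0] := eqVneq c 0%R.
    by rewrite mul0e; apply: le_trans (le_sup _ 0%N); rewrite mul0e.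
  have cgt0 : (0 < c)%R by rewrite lt0r cn0.
  rewrite -lee_pdivlMl//; apply: sup_le => n.
  by rewrite lee_pdivlMl//; exact: (le_sup (fun n => c%:E * f n) n).
- move=> f nf hf; have f0 n t := nnm_ge0 (nf n) t.
  rewrite supnormE; last by move=> t; exact: (nnm_ge0 (nnm_sup nf)).
  apply/eqP; rewrite eq_le; apply/andP; split.
    apply: sup_le => t; apply: sup_le => n.
    by apply: le_trans (le_sup _ n); rewrite /= supnormE//; exact: (le_sup (f n) t).
  apply: sup_le => n /=; rewrite supnormE//; apply: sup_le => t.
  by apply: le_trans (le_sup _ t); exact: (le_sup (f ^~ t) n).
- move=> d' S f nf.
  rewrite (_ : (fun _ => _) = (fun s => ereal_sup (range (fun j => f (s, j))))); last first.
    by apply/funext => s; rewrite supnormE// => j; exact: (nnm_ge0 nf).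
  by apply: (@nnm_sup _ _ _ (fun j s => f (s, j))) => j; exact: nnm_pair2.
- move=> d' S mu f nf; rewrite supnormE; last by move=> j; apply: int_ge0; exact: nnm_pair2.
  apply: sup_le => j; apply: le_int; first exact: nnm_pair2.
    rewrite (_ : (fun _ => _) = (fun s => ereal_sup (range (fun j => f (s, j))))); last first.
      by apply/funext => s; rewrite supnormE// => i; exact: (nnm_ge0 nf).
    by apply: (@nnm_sup _ _ _ (fun j s => f (s, j))) => i; exact: nnm_pair2.
  move=> s; rewrite supnormE; last by move=> i; exact: (nnm_ge0 nf).
  exact: (le_sup (fun j => f (s, j)) j).
Qed.

Section Lq.
Context d (S : measurableType d) (mu : {sigma_finite_measure set S -> \bar R}).
Context d' (T : measurableType d') (rho : (T -> \bar R) -> \bar R).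
Variable q : R.
Hypotheses (H : nice rho) (q1 : (1 < q)%R).

Definition Lq (f : S * T -> \bar R) : \bar R :=
  (\int[mu]_s rho (fun t => f (s, t)) `^ q) `^ q^-1.

Let q0 : (0 < q)%R. Proof. exact: lt_trans q1. Qed.
Let qn0 : (q != 0)%R. Proof. by rewrite gt_eqF. Qed.
Let qV0 : (0 < q^-1)%R. Proof. by rewrite invr_gt0. Qed.

Let nr (f : S * T -> \bar R) : nnm f -> nnm (fun s => rho (fun t => f (s, t)) `^ q).
Proof. by move=> nf; apply: nnm_pow; exact: (nice_nnm H). Qed.

Lemma Lq_pow f : nnm f -> Lq f `^ q = \int[mu]_s rho (fun t => f (s, t)) `^ q.
Proof. by move=> nf; rewrite powVK// int_ge0//; exact: nr. Qed.

Lemma nice_Lq : nice Lq.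
Proof.
split.
- by move=> f; exact: poweR_ge0.
- move=> f g nf ng fg; apply: le_pow; [exact: ltW|by apply: int_ge0; exact: nr|].
  apply: le_int => [||s]; [exact: nr|exact: nr|].
  apply: le_pow; [exact: ltW|exact: (nice_ge0 H)|].
  by apply: (nice_le H) => //; exact: nnm_pair1.
- move=> c f c0 nf; rewrite /Lq.
  under eq_integral => s _.
    rewrite (niceZ H)//; last exact: nnm_pair1.
    rewrite poweRM//; last exact: (nice_ge0 H).
    over.
  rewrite intZ ?poweR_ge0//; last exact: nr.
  rewrite poweRM ?poweR_ge0//; last by apply: int_ge0; exact: nr.
  by rewrite powK.
- move=> f nf hf; rewrite /Lq.
  under eq_integral => s _.
    rewrite (@nice_sup _ _ _ H (fun n t => f n (s, t))); last 2 first.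
      by move=> n; exact: nnm_pair1.
      by move=> t; exact: hf.
    rewrite pow_sup//; last by move=> n; exact: (nice_ge0 H).
    over.
  rewrite (@int_sup _ _ _ mu (fun n s => rho (fun t => f n (s, t)) `^ q)).
  + by rewrite pow_sup//; move=> n; apply: int_ge0; exact: nr.
  + by move=> n; exact: nr.
  + move=> s n m nm; apply: le_pow; [exact: ltW|exact: (nice_ge0 H)|].
    by apply: (nice_le H) => [||t]; [exact: nnm_pair1|exact: nnm_pair1|exact: hf].
- move=> d1 U f nf; apply: nnm_pow.
  apply: (@nnm_int2 _ _ _ _ _ mu (fun z => rho (fun t => f (z.1, (z.2, t))) `^ q)).
  apply: nnm_pow; apply: (@nice_nnm _ _ _ H _ _ (fun z => f (z.1.1, (z.1.2, z.2)))).
  apply: (nnm_comp nf); apply/measurable_fun_pairP; split.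
    exact: (measurableT_comp measurable_fst measurable_fst).
  apply/measurable_fun_pairP; split => /=; last exact: measurable_snd.
  exact: (measurableT_comp measurable_snd measurable_fst).
- move=> d1 U m f nf.
  have ng : nnm (fun z : U * S => rho (fun t => f (z.1, (z.2, t)))).
    apply: (@nice_nnm _ _ _ H _ _ (fun z => f (z.1.1, (z.1.2, z.2)))).
    apply: (nnm_comp nf); apply/measurable_fun_pairP; split.
      exact: (measurableT_comp measurable_fst measurable_fst).
    apply/measurable_fun_pairP; split => /=; last exact: measurable_snd.
    exact: (measurableT_comp measurable_snd measurable_fst).
  (* Minkowski's inequality for the outer exponent; what remains, for fixed [s], is the Minkowski
     property of [rho]. *)
  apply: le_trans (minkowski_int m mu q1 ng) => /=.
  apply: le_pow; [exact: ltW| |].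
    exact: (int_ge0 mu (@nr (fun z => \int[m]_u f (u, z)) (nnm_int1 m nf))).
  apply: le_int => [||s].
  + exact: (@nr (fun z => \int[m]_u f (u, z)) (nnm_int1 m nf)).
  + by apply: nnm_pow; exact: (nnm_int1 m ng).
  + apply: le_pow; [exact: ltW|exact: (nice_ge0 H)|].
    apply: (@nice_mink _ _ _ H _ _ m (fun z => f (z.1, (s, z.2)))).
    apply: (nnm_comp nf); apply/measurable_fun_pairP; split => /=; first exact: measurable_fst.
    apply/measurable_fun_pairP; split => /=; [exact: measurable_cst|exact: measurable_snd].
Qed.

End Lq.

End nice_norm.

Section indicator.
Context {R : realType} (T : Type).
Implicit Types A : set T.

Definition ind A (x : T) : \bar R := (\1_A x)%:E.

Lemma ind1 A x : A x -> ind A x = 1.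
Proof. by move=> Ax; rewrite /ind indicE mem_set. Qed.

Lemma ind0 A x : ~ A x -> ind A x = 0.
Proof. by move=> Ax; rewrite /ind indicE memNset. Qed.

Lemma ind_ge0 A x : 0 <= ind A x. Proof. by rewrite lee_fin. Qed.

Lemma ind_le1 A x : ind A x <= 1.
Proof. by rewrite lee_fin indicE; case: (_ \in _). Qed.

End indicator.
Arguments ind {R T} A x.

Lemma nnm_ind {R : realType} d (T : measurableType d) (A : set T) :
  measurable A -> @nnm R _ _ (ind A).
Proof. exact: nnm_indic. Qed.

Lemma int_ind {R : realType} d (T : measurableType d)
    (mu : {measure set T -> \bar R}) (A : set T) :
  measurable A -> \int[mu]_x ind A x = mu A.
Proof. by move=> mA; rewrite integral_indic// setIT. Qed.

(** * From distributional inequalities to integrals of powers *)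

Section layer_cake.
Context {R : realType}.

Let geometric_le (b : R) (n : nat) (a : R) : (1 < b)%R -> (0 <= a)%R ->
  (\sum_(i < n) a * b ^+ i <= (b - 1)^-1 * (a * b ^+ n))%R.
Proof.
move=> b1 a0; have b10 : (0 < b - 1)%R by rewrite subr_gt0.
elim: n => [|n IH].
  by rewrite big_ord0 expr0 mulr1 mulr_ge0// invr_ge0 ltW.
rewrite big_ord_recr/=; apply: (le_trans (lerD IH (lexx _))).
rewrite -[X in (_ + X)%R]mul1r -mulrDl exprSr mulrA [leRHS]mulrA [leRHS]mulrAC.
apply: ler_wpM2r; first by rewrite mulr_ge0// exprn_ge0// ltW// (lt_trans _ b1).
by rewrite -[X in (_ + X)%R](divff (lt0r_neq0 b10)) -[in X in (X + _)%R](mul1r (b-1)^-1)%R -mulrDl addrCA subrr addr0 mulrC.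
Qed.

(** Levels not below [y] contribute nothing. If the top level is below [y], the geometric sum is a
    fixed multiple of its last term, which is at most y^s. *)
Let level_sum (a s : R) (n : nat) (y : \bar R) : (0 < a)%R -> (0 < s)%R -> 0 <= y ->
  \sum_(i < n) ((a * 2 ^+ i) `^ s)%:E * ind [set z | (a * 2 ^+ i)%:E < z] y <=
  ((2 `^ s - 1)^-1 * 2 `^ s)%:E * y `^ s.
Proof.
move=> a0 s0 y0; have b1 : (1 < 2 `^ s :> R)%R.
  have := @gt0_ltr_powR _ s s0 1%R 2%R; rewrite powR1; apply; rewrite ?nnegrE ?ltr1n//.
have b10 : (0 < 2 `^ s - 1 :> R)%R by rewrite subr_gt0.
have C0 : (0 <= (2 `^ s - 1)^-1 * 2 `^ s :> R)%R.
  by rewrite mulr_ge0// ?invr_ge0 ?ltW ?powR_gt0.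
elim: n => [|n IH]; first by rewrite big_ord0 mule_ge0// poweR_ge0.
have [lt|ge] := boolP ((a * 2 ^+ n)%:E < y); last first.
  by rewrite big_ord_recr/= (@ind0 _ _ _ y) ?mule0 ?adde0//; apply/negP.
have e i : ((a * 2 ^+ i) `^ s = a `^ s * (2 `^ s) ^+ i :> R)%R.
  rewrite powRM ?exprn_ge0// ?ltW//; congr (_ * _)%R.
  by rewrite -powR_mulrn// -powRrM -[RHS]powR_mulrn ?powR_ge0// -powRrM mulrC.
apply: (@le_trans _ _ (\sum_(i < n.+1) (a `^ s * (2 `^ s) ^+ i))%R%:E).
  rewrite -sumEFin; apply: lee_sum => i _; rewrite -e -[leRHS]mule1.
  by rewrite lee_wpmul2l ?lee_fin ?powR_ge0// ind_le1.
apply: (@le_trans _ _ ((2 `^ s - 1)^-1 * (a `^ s * (2 `^ s) ^+ n.+1))%R%:E).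
  by rewrite lee_fin; apply: geometric_le => //; exact: powR_ge0.
rewrite (_ : _ * _ = ((2 `^ s - 1)^-1 * 2 `^ s) * (a `^ s * (2 `^ s) ^+ n))%R; last first.
  by rewrite exprS; ring.
rewrite EFinM.
rewrite -e lee_wpmul2l ?lee_fin// -poweR_EFin; apply: le_pow; [exact: ltW| |exact: ltW].
by rewrite lee_fin mulr_ge0// ?exprn_ge0// ltW.
Qed.

(** Take the last level whose double is below [y]; unless it is the top one, doubling it once more
    fails, which bounds [y]. *)
Let pick_level (a : R) (n : nat) (y : \bar R) : (0 < a)%R -> (2 * a)%:E < y ->
  exists2 i, (i <= n)%N & (2 * (a * 2 ^+ i))%:E < y /\
    (i = n \/ y <= (4 * (a * 2 ^+ i))%:E).
Proof.
move=> a0 ay; elim: n => [|n [i ni [iy [ni'|h]]]].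
- by exists 0%N => //; split; [rewrite expr0 mulr1|left].
- have [lt|ge] := ltP (2 * (a * 2 ^+ n.+1))%:E y.
    by exists n.+1 => //; split => //; left.
  rewrite {}ni' in iy *.
  exists n => //; split => //; right; apply: le_trans ge _.
  by rewrite exprS lee_fin le_eqVlt; apply/orP; left; apply/eqP; ring.
- by exists i; [exact: leqW|split => //; right].
Qed.

(** The formula for the integral of F^p through its distribution function, discretised to the levels
    2^(i-K): F^p is at most 4^p times the sum of a^p over levels with 2a < F, and on the other side
    the sum of a^(p-1) over levels below F is a geometric sum. *)
Lemma layer_cake d (T : measurableType d) (mu : {measure set T -> \bar R})
    (F v : T -> \bar R) (C p : R) : nnm F -> nnm v -> (0 <= C)%R -> (1 < p)%R ->
  (forall l : R, (0 < l)%R -> l%:E * mu [set x | (2 * l)%:E < F x] <=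
      C%:E * \int[mu]_x (ind [set x | l%:E < F x] x * v x)) ->
  \int[mu]_x F x `^ p <=
    (4 `^ p * ((2 `^ (p - 1) - 1)^-1 * 2 `^ (p - 1)) * C)%:E *
    \int[mu]_x (F x `^ (p - 1) * v x).
Proof.
move=> nF nv C0 p1 h; have p0 : (0 < p)%R by apply: lt_trans p1.
have pp0 : (0 < p - 1)%R by rewrite subr_gt0.
have F0 := nnm_ge0 nF; have v0 := nnm_ge0 nv.
pose a (K i : nat) : R := (2 ^- K * 2 ^+ i)%R.
have a0 K i : (0 < a K i)%R by apply: mulr_gt0; rewrite ?invr_gt0 exprn_gt0.
(* Only levels from 2^(-K) to 2^K are available, so F is capped at 2^(K+1) and discarded up to 2 *
   2^(-K); the supremum over [K] restores F^p. *)
pose t K x := (mine (F x) (2 ^+ K.+1)%:E) `^ p * ind [set x | (2 * 2 ^- K)%:E < F x] x.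
have mF (c : \bar R) : measurable [set x | c < F x] by exact: msr_gt.
have nt K : nnm (t K).
  apply: nnmM; last exact: nnm_ind.
  by apply/nnm_pow/nnm_min => //; apply: nnm_cst; rewrite lee_fin exprn_ge0.
pose g K x := \sum_(i < (2 * K).+1) (a K i `^ p)%:E * ind [set x | (2 * a K i)%:E < F x] x.
have ng K : nnm (g K).
  by apply: nnm_sum => i; apply: nnmZ; [rewrite lee_fin powR_ge0|exact: nnm_ind].
have tg K x : t K x <= (4 `^ p)%:E * g K x.
  rewrite /t; have [lt|ge] := pselect ((2 * 2 ^- K)%:E < F x); last first.
    by rewrite ind0// mule0 mule_ge0 ?lee_fin ?powR_ge0//; exact: (nnm_ge0 (ng K)).
  rewrite ind1// mule1.
  have [|i iK [iF iE]] := @pick_level (2 ^- K)%R (2 * K) (F x) _ lt.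
    by rewrite invr_gt0 exprn_gt0.
  apply: (@le_trans _ _ ((4 * a K i)%:E `^ p)).
    apply: le_pow; [exact: ltW|by rewrite le_min F0 lee_fin exprn_ge0|].
    rewrite ge_min; apply/orP; case: iE => [->|]; last by left.
    right; rewrite lee_fin /a mul2n -addnn exprD mulrA mulVf ?mul1r ?expf_neq0//.
    by rewrite exprS ler_wpM2r ?exprn_ge0// ler_nat.
  rewrite poweR_EFin powRM ?(ltW (a0 _ _))// EFinM lee_wpmul2l ?lee_fin ?powR_ge0//.
  have iK' : (i < (2 * K).+1)%N by [].
  rewrite /g (bigD1 (Ordinal iK'))//= ind1// mule1 leeDl//.
  by apply: sume_ge0 => j _; rewrite mule_ge0 ?ind_ge0// lee_fin powR_ge0.
have gint K : \int[mu]_x g K x <=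
    ((2 `^ (p - 1) - 1)^-1 * 2 `^ (p - 1) * C)%:E * \int[mu]_x (F x `^ (p - 1) * v x).
  rewrite /g ge0_integral_sum//; last 2 first.
    by move=> i; apply: nnm_m; apply: nnmZ; [rewrite lee_fin powR_ge0|exact: nnm_ind].
    by move=> i x _; rewrite mule_ge0 ?ind_ge0// lee_fin powR_ge0.
  apply: (@le_trans _ _ (\sum_(i < (2 * K).+1) (a K i `^ (p - 1))%:E *
      (C%:E * \int[mu]_x (ind [set x | (a K i)%:E < F x] x * v x)))).
    apply: lee_sum => i _; rewrite intZ ?lee_fin ?powR_ge0//; last exact: nnm_ind.
    rewrite int_ind//.
    rewrite (_ : a K i `^ p = a K i `^ (p - 1) * a K i)%R; last first.
      by rewrite -[X in (_ * X)%R]powRr1 ?(ltW (a0 _ _))// -powRD ?subrK// gt_eqF.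
    by rewrite EFinM -muleA lee_wpmul2l ?lee_fin ?powR_ge0//; exact: h.
  have nind i : nnm (fun x => (a K i `^ (p - 1))%:E * (ind [set x | (a K i)%:E < F x] x * v x)).
    apply: nnmZ; first by rewrite lee_fin powR_ge0.
    by apply: nnmM => //; exact: nnm_ind.
  rewrite (_ : \sum_(i < _) _ = C%:E * \int[mu]_x (\sum_(i < (2 * K).+1)
      (a K i `^ (p - 1))%:E * (ind [set x | (a K i)%:E < F x] x * v x))); last first.
    rewrite ge0_integral_sum//; last 2 first.
      by move=> i; exact: (nnm_m (nind i)).
      by move=> i x _; exact: (nnm_ge0 (nind i)).
    rewrite ge0_sume_distrr; last by move=> i _; exact: int_ge0.
    apply: eq_bigr => i _; rewrite intZ ?lee_fin ?powR_ge0//; first by rewrite muleCA.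
    by apply: nnmM => //; exact: nnm_ind.
  rewrite mulrC EFinM -muleA lee_wpmul2l ?lee_fin//.
  have C0' : (0 <= (2 `^ (p - 1) - 1)^-1 * 2 `^ (p - 1) :> R)%R.
    rewrite mulr_ge0 ?powR_ge0// invr_ge0 subr_ge0.
    by rewrite -[leLHS](powRr0 2) ler_powR ?ler1n ?ltW.
  rewrite -intZ ?lee_fin//; last by apply: nnmM => //; exact: nnm_pow.
  apply: le_int.
  - exact: nnm_sum.
  - by apply: nnmZ; rewrite ?lee_fin//; apply: nnmM => //; exact: nnm_pow.
  - move=> x; under eq_bigr do rewrite muleA.
    rewrite -ge0_sume_distrl; last by move=> i _; rewrite mule_ge0 ?ind_ge0// lee_fin powR_ge0.
    rewrite muleA lee_wpmul2r//.
    apply: le_trans (@level_sum (2 ^- K)%R (p - 1)%R (2 * K).+1 (F x) _ pp0 (F0 x)).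
      apply: lee_sum => i _; rewrite lee_wpmul2l ?lee_fin ?powR_ge0//.
    by rewrite invr_gt0 exprn_gt0.
have tsup x : F x `^ p = ereal_sup (range (t ^~ x)).
  apply/eqP; rewrite eq_le; apply/andP; split; last first.
    apply: sup_le => K; rewrite /t -[leRHS]mule1 lee_pmul ?ind_ge0 ?poweR_ge0 ?ind_le1//.
    by apply: le_pow; [exact: ltW|rewrite le_min F0 lee_fin exprn_ge0|rewrite ge_min lexx].
  have [->|Fn0] := eqVneq (F x) 0.
    by rewrite poweR0r ?gt_eqF//; apply: le_trans (le_sup _ 0%N); exact: (nnm_ge0 (nt _)).
  have Fgt0 : 0 < F x by rewrite lt0e Fn0 F0.
  have exK (c : R) : exists N, forall K, (N <= K)%N -> (c <= 2 ^+ K)%R.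
    exists (Num.bound `|c|) => K NK; rewrite (le_trans (ler_norm c))//.
    rewrite (le_trans (ltW (archi_boundP (normr_ge0 c))))// -natrX ler_nat.
    by rewrite (leq_trans NK)// ltnW// ltn_expl.
  have [c c0 cF] : exists2 c : R, (0 < c)%R & c%:E < F x.
    case: (F x) Fgt0 => [r| |]//; last by exists 1%R => //; exact: ltry.
    by rewrite lte_fin => r0; exists (r / 2)%R; rewrite ?divr_gt0// lte_fin; lra.
  have [N HN] := exK (2 / c)%R.
  have tE K : (N <= K)%N -> t K x = (mine (F x) (2 ^+ K.+1)%:E) `^ p.
    move=> NK; rewrite /t ind1 ?mule1//=; apply: le_lt_trans cF.
    by rewrite lee_fin ler_pdivrMr ?exprn_gt0// mulrC -ler_pdivrMr// HN.
  case E : (F x) (Fgt0) => [r| |]// r0.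
    have [M HM] := exK r.
    apply: le_trans (le_sup _ (maxn N M)); rewrite tE ?leq_maxl//.
    rewrite E (min_idPl _)// lee_fin HM// (leq_trans (leq_maxr N M))//.
  rewrite poweRyr ?gt_eqF// leye_eq; apply/eqP/eqyP => A A0.
  have [M HM] := exK (A `^ p^-1)%R.
  apply: le_trans (le_sup _ (maxn N M)); rewrite tE ?leq_maxl// E.
  have -> : A%:E = ((A%:E : \bar R) `^ p^-1) `^ p.
    by rewrite powVK ?gt_eqF// lee_fin ltW.
  apply: le_pow; [exact: ltW|exact: poweR_ge0|].
  by rewrite le_min leey/= lee_fin HM// (leq_trans (leq_maxr N M)).
under eq_integral do rewrite tsup.
rewrite int_sup//; last first.
  move=> x n m nm; rewrite /t lee_pmul ?poweR_ge0 ?ind_ge0//.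
    apply: le_pow; [exact: ltW|by rewrite le_min F0 lee_fin exprn_ge0|].
    by rewrite le_min ge_min lexx/= ge_min lee_fin ler_weXn2l ?ler1n ?orbT.
  have [lt|ge] := pselect ((2 * 2 ^- n)%:E < F x); last by rewrite ind0// ind_ge0.
  rewrite !ind1//=; apply: le_lt_trans lt; rewrite lee_fin ler_wpM2l// lef_pV2 ?posrE ?exprn_gt0//.
  by rewrite ler_weXn2l ?ler1n.
apply: sup_le => K; apply: (@le_trans _ _ (\int[mu]_x ((4 `^ p)%:E * g K x))).
  by apply: le_int => //; apply: nnmZ; rewrite ?lee_fin ?powR_ge0.
rewrite intZ ?lee_fin ?powR_ge0// -[(_ * _ * C)%R]mulrA EFinM -muleA.
by rewrite lee_wpmul2l ?lee_fin ?powR_ge0.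
Qed.

End layer_cake.

(** * Grids on the line and their scalar maximal functions *)

Section grid.
Context {R : realType}.
Local Notation T0 := (measurableTypeR R).
Local Notation leb := (@lebesgue_measure R).

(** What the two shifted dyadic grids have in common. There is a coarsest level, level 0, and
    [cell k x] is the label of the cell of level [k] that contains [x]. *)
Record grid := Grid {
  cell : nat -> T0 -> int ;
  len : nat -> R ;
  len_gt0 : forall k, (0 < len k)%R ;
  cell_meas : forall k m, measurable [set x : T0 | cell k x = m] ;
  cell_nest : forall k x y, cell k.+1 x = cell k.+1 y -> cell k x = cell k y ;
  cell_vol : forall k x, leb [set y | cell k x = cell k y] = (len k)%:E ;
  len_half : forall k, len k = (2 * len k.+1)%R }.

Section scalar.
Variable G : grid.

(** The kernel form makes the average a positive symmetric integral operator, so Tonelli and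
    Minkowski apply to it as they stand. *)
Definition ker k (x y : T0) : R := ((len G k)^-1 * (cell G k x == cell G k y)%:R)%R.

Definition avg k (v : T0 -> \bar R) (x : T0) : \bar R :=
  \int[leb]_y ((ker k x y)%:E * v y).

Fixpoint smax (N : nat) (v : T0 -> \bar R) (x : T0) : \bar R :=
  if N is k.+1 then maxe (smax k v x) (avg k v x) else 0.

(** When [D] is measurable, it belongs to the sigma-algebra of level [k], for which [avg k] is the
    conditional expectation. *)
Definition cellular k (D : set T0) := forall x y, cell G k x = cell G k y -> D x -> D y.

Lemma ker_ge0 k x y : (0 <= ker k x y)%R.
Proof. by rewrite mulr_ge0// invr_ge0 ltW// len_gt0. Qed.

Lemma kerC k x y : ker k x y = ker k y x.
Proof. by rewrite /ker eq_sym. Qed.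

Lemma ker_ind k x y :
  (ker k x y)%:E = ((len G k)^-1)%:E * ind [set z | cell G k x = cell G k z] y.
Proof.
rewrite /ker EFinM; congr (_ * _).
have [e|ne] := eqVneq (cell G k x) (cell G k y); first by rewrite ind1.
by rewrite ind0//; apply/eqP.
Qed.

Lemma msr_cellE k x : measurable [set y : T0 | cell G k x = cell G k y].
Proof.
rewrite (_ : [set _ | _] = [set y | cell G k y = cell G k x]); first exact: cell_meas.
by apply/seteqP; split => y /= ->.
Qed.

Lemma nnm_ker k : nnm (fun z : T0 * T0 => (ker k z.1 z.2)%:E).
Proof.
under eq_fun do rewrite /ker EFinM.
apply: nnmZ; first by rewrite lee_fin invr_ge0 ltW// len_gt0.
pose A := \bigcup_(m : int) ([set x | cell G k x = m] `*` [set x | cell G k x = m]).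
rewrite (_ : (fun _ => _) = ind A); last first.
  apply/funext => -[x y] /=; have [e|ne] := eqVneq (cell G k x) (cell G k y).
    by rewrite ind1//; exists (cell G k y).
  by rewrite ind0// => -[m _ [/= e1 e2]]; move: ne; rewrite e1 e2 eqxx.
apply: nnm_ind; apply: countable_bigcupT_measurable => // m.
by apply: measurableX; exact: cell_meas.
Qed.

Lemma int_cell k x : \int[leb]_y ind [set y | cell G k x = cell G k y] y = (len G k)%:E.
Proof. exact: etrans (int_ind _ (msr_cellE k x)) (cell_vol G k x). Qed.

Lemma int_ker k x : \int[leb]_y (ker k x y)%:E = 1.
Proof.
under eq_integral do rewrite ker_ind.
have l0 := len_gt0 G k.
rewrite intZ; [|by rewrite lee_fin invr_ge0 ltW|apply: nnm_ind; exact: msr_cellE].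
by rewrite int_cell -EFinM mulVf ?gt_eqF.
Qed.

Lemma cell_nestle j k x y : (j <= k)%N -> cell G k x = cell G k y -> cell G j x = cell G j y.
Proof.
move=> /subnK <-; elim: (k - j)%N => [//|i IH] h; apply: IH.
by move: h; rewrite addSn; exact: cell_nest.
Qed.

Lemma cellular_le j k D : (j <= k)%N -> cellular j D -> cellular k D.
Proof. by move=> jk hD x y h; apply: hD; exact: cell_nestle h. Qed.

Lemma cellular_cell k x : cellular k [set y | cell G k x = cell G k y].
Proof. by move=> y z e; rewrite /= e. Qed.

Lemma cellularC k D : cellular k D -> cellular k (~` D).
Proof. by move=> h x y e nx Dy; apply: nx; apply: h Dy. Qed.

Lemma cellularI k D E : cellular k D -> cellular k E -> cellular k (D `&` E).
Proof. by move=> h1 h2 x y e [Dx Ex]; split; [exact: h1 Dx|exact: h2 Ex]. Qed.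

Lemma nnm_kerM k x v : nnm v -> nnm (fun y => (ker k x y)%:E * v y).
Proof. by move=> nv; apply: nnmM => //; exact: (nnm_pair1 x (nnm_ker k)). Qed.

Lemma nnm_avg k v : nnm v -> nnm (avg k v).
Proof.
move=> nv; apply: (@nnm_int2 _ _ _ _ _ _ (fun z => (ker k z.1 z.2)%:E * v z.2)).
apply: nnmM; [exact: nnm_ker|exact: nnm_comp nv measurable_snd].
Qed.

Lemma avg_ge0 k v x : nnm v -> 0 <= avg k v x.
Proof. by move=> nv; exact: (nnm_ge0 (nnm_avg k nv)). Qed.

Lemma le_avg k v w x : nnm v -> nnm w -> (forall y, v y <= w y) -> avg k v x <= avg k w x.
Proof.
move=> nv nw vw; apply: le_int => [||y]; [exact: nnm_kerM|exact: nnm_kerM|].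
by rewrite lee_wpmul2l ?lee_fin ?ker_ge0.
Qed.

Lemma eq_avg k v w x : (forall y, cell G k x = cell G k y -> v y = w y) ->
  avg k v x = avg k w x.
Proof.
move=> h; apply: eq_integral => y _; rewrite /ker.
by have [/h ->//|] := eqVneq (cell G k x) (cell G k y); rewrite mulr0 !mul0e.
Qed.

Lemma avg_cell k v x y : cell G k x = cell G k y -> avg k v x = avg k v y.
Proof. by move=> e; rewrite /avg /ker e. Qed.

Lemma avgE k v x : nnm v -> avg k v x =
  ((len G k)^-1)%:E * \int[leb]_y (ind [set y | cell G k x = cell G k y] y * v y).
Proof.
move=> nv; rewrite -intZ ?lee_fin ?invr_ge0 ?ltW ?len_gt0//; last first.
  by apply: nnmM => //; apply: nnm_ind; exact: msr_cellE.
by apply: eq_integral => y _; rewrite ker_ind muleA.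
Qed.

(** The kernel is symmetric, has total mass 1, and vanishes between a point of [D] and a point
    outside. *)
Lemma int_avg k D v : measurable D -> cellular k D -> nnm v ->
  \int[leb]_x (ind D x * avg k v x) = \int[leb]_x (ind D x * v x).
Proof.
move=> mD cD nv; pose f (z : T0 * T0) := ind D z.1 * ((ker k z.1 z.2)%:E * v z.2).
have nf : nnm f.
  apply: nnmM; first exact: (nnm_comp (nnm_ind mD) measurable_fst).
  by apply: nnmM; [exact: nnm_ker|exact: nnm_comp nv measurable_snd].
transitivity (\int[leb]_x \int[leb]_y f (x, y)).
  apply: eq_integral => x _; rewrite /avg -intZ ?ind_ge0//.
  exact: nnm_kerM.
rewrite tonelli//; apply: eq_integral => y _; rewrite /f /=.
have e x : ind D x * ((ker k x y)%:E * v y) = (ind D y * v y) * (ker k y x)%:E.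
  rewrite kerC /ker; have [e|_] := eqVneq (cell G k y) (cell G k x); last first.
    by rewrite mulr0 mul0e !mule0.
  rewrite muleA muleAC; congr (_ * _ * _).
  have [Dy|nDy] := pselect (D y); first by rewrite !ind1//; apply: cD Dy.
  by rewrite !ind0// => Dx; apply: nDy; apply: cD Dx.
under eq_integral do rewrite e.
rewrite intZ ?int_ker ?mule1//; first by rewrite mule_ge0 ?ind_ge0//; exact: (nnm_ge0 nv).
exact: (nnm_pair1 y (nnm_ker k)).
Qed.

Lemma int_avgT k v : nnm v -> \int[leb]_x avg k v x = \int[leb]_x v x.
Proof.
move=> nv; have := @int_avg k setT v measurableT (fun _ _ _ => id) nv.
have e w : \int[leb]_x (ind setT x * w x) = \int[leb]_x w x :> \bar R.
  by apply: eq_integral => x _; rewrite ind1// mul1e.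
by rewrite !e.
Qed.

(** A cell has half the length of its parent. This is the source of the bound [2 * l] for the good
    part in the Calderon-Zygmund argument. *)
Lemma avg_half k v x : nnm v -> avg k.+1 v x <= 2%:E * avg k v x.
Proof.
move=> nv; rewrite -intZ ?lee_fin//; last exact: nnm_kerM.
apply: le_int => [||y]; [exact: nnm_kerM|apply: nnmZ; rewrite ?lee_fin//; exact: nnm_kerM|].
rewrite muleA lee_wpmul2r ?(nnm_ge0 nv)// -EFinM lee_fin /ker (len_half G k).
have l0 := len_gt0 G k.+1.
rewrite invfM mulrA mulrA divff// mul1r ler_wpM2l ?invr_ge0 ?(ltW l0)//.
have [/cell_nest ->|_] := eqVneq (cell G k.+1 x) (cell G k.+1 y); first by rewrite eqxx.
exact: ler0n.
Qed.

Lemma avg_jensen k v x (p : R) : nnm v -> (1 < p)%R ->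
  (avg k v x) `^ p <= avg k (fun y => v y `^ p) x.
Proof.
move=> nv p1; have p0 : (0 < p)%R by apply: lt_trans p1.
have pp0 : (0 < p - 1)%R by rewrite subr_gt0.
have l0 := len_gt0 G k.
rewrite avgE// avgE; last exact: nnm_pow.
set D := [set y | _].
have mD : measurable D by exact: msr_cellE.
have nD : @nnm R _ _ (ind D) by exact: nnm_ind.
have indp q (y : T0) : (q != 0)%R -> ind D y `^ q = ind D y :> \bar R.
  move=> q0; have [Dy|Dy] := pselect (D y); first by rewrite ind1// poweR1r.
  by rewrite ind0// poweR0r.
have nDv : nnm (fun y => ind D y * v y) by exact: nnmM.
have := @hoelder_ge0 _ _ _ leb (ind D) (fun y => ind D y * v y) (p / (p - 1)) p nD nDv _ p0.
rewrite divr_gt0// => /(_ isT); rewrite invf_div mulrBl divff ?gt_eqF// mul1r subrK => /(_ erefl).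
have -> : \int[leb]_y ((ind D y : \bar R) * (ind D y * v y)) = \int[leb]_y (ind D y * v y).
  apply: eq_integral => y _; have [Dy|Dy] := pselect (D y); first by rewrite !ind1// !mul1e.
  by rewrite !ind0// !mul0e.
have -> : \int[leb]_y (ind D y `^ (p / (p - 1))) = (len G k)%:E.
  rewrite -(int_cell k x) -/D; apply: eq_integral => y _.
  by rewrite indp// mulf_neq0// ?invr_neq0// gt_eqF.
have -> : \int[leb]_y ((ind D y * v y) `^ p) = \int[leb]_y (ind D y * v y `^ p).
  by apply: eq_integral => y _; rewrite poweRM ?ind_ge0 ?(nnm_ge0 nv)// indp ?gt_eqF.
set I := \int[leb]_y (ind D y * v y); set J := \int[leb]_y (_ * _ `^ p) => h.
have J0 : 0 <= J by apply: int_ge0; apply: nnmM => //; exact: nnm_pow.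
have I0 : 0 <= I by exact: int_ge0.
rewrite poweRM// ?lee_fin ?invr_ge0 ?(ltW l0)//.
have {h} := @le_pow R _ _ p (ltW p0) I0 h.
rewrite poweRM ?poweR_ge0// powVK ?gt_eqF// -poweRrM mulrBl mul1r mulVf ?gt_eqF// => h.
apply: (@le_trans _ _ ((len G k)^-1%:E `^ p * ((len G k)%:E `^ (p - 1) * J))).
  by rewrite lee_wpmul2l// poweR_ge0.
rewrite muleA lee_wpmul2r// !poweR_EFin -EFinM lee_fin.
rewrite -(powR_inv1 (ltW l0)) -powRrM mulN1r -powRD ?(gt_eqF l0) ?implybT//.
by rewrite addrA addNr add0r powR_inv1// ltW.
Qed.

Lemma nnm_smax N v : nnm v -> nnm (smax N v).
Proof.
move=> nv; elim: N => [|N IH]; first exact: nnm_cst.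
by apply: nnm_max => //; exact: nnm_avg.
Qed.

Lemma smax_ge0 N v x : 0 <= smax N v x.
Proof. by elim: N => [//|N IH] /=; rewrite le_max IH. Qed.

Lemma smax_nd N M v x : (N <= M)%N -> smax N v x <= smax M v x.
Proof.
move=> /subnK <-; elim: (M - N)%N => [//|i IH].
by rewrite addSn /= le_max IH.
Qed.

Lemma avg_smax k N v x : (k < N)%N -> avg k v x <= smax N v x.
Proof. by move=> kN; apply: le_trans (smax_nd v x kN) => /=; rewrite le_max lexx orbT. Qed.

Lemma smax_le N v x c : 0 <= c -> (forall k, (k < N)%N -> avg k v x <= c) -> smax N v x <= c.
Proof.
move=> c0; elim: N => [//|N IH] h /=; rewrite ge_max h// andbT; apply: IH => k kN.
by apply: h; exact: ltnW.
Qed.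

Lemma le_smax N v w x : nnm v -> nnm w -> (forall y, v y <= w y) -> smax N v x <= smax N w x.
Proof.
move=> nv nw h; apply: smax_le => [|k kN]; first exact: smax_ge0.
by apply: le_trans (le_avg k x nv nw h) _; exact: avg_smax.
Qed.

Lemma smax_cell N k v x y : (N <= k.+1)%N -> cell G k x = cell G k y ->
  smax N v x = smax N v y.
Proof.
move=> + e; elim: N => [//|N IH] Nk /=; rewrite IH; last exact: ltnW.
by congr maxe; apply: avg_cell; apply: cell_nestle e.
Qed.

Lemma eq_smax N v w x : (forall k, (k < N)%N -> avg k v x = avg k w x) -> smax N v x = smax N w x.
Proof.
elim: N => [//|N IH] h /=; rewrite h// IH// => k kN.
by apply: h; exact: ltnW.
Qed.

(** Induction on the number of scales: the points added by scale [N] form a union of cells of level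
    [N] on which the average exceeds [l], and there the average has the same integral as [v]. *)
Lemma smax_weak N v (l : R) : nnm v -> (0 <= l)%R ->
  l%:E * leb [set x | l%:E < smax N v x] <=
  \int[leb]_x (ind [set x | l%:E < smax N v x] x * v x).
Proof.
move=> nv l0; set B := fun N => [set x | l%:E < smax N v x].
have mB M : measurable (B M) by apply: msr_gt; exact: nnm_smax.
rewrite -(int_ind leb (mB N)) -intZ ?lee_fin//; last exact: nnm_ind.
have nB M : nnm (fun x => ind (B M) x * v x) by apply: nnmM => //; exact: nnm_ind.
elim: N => [|N IH].
  rewrite (_ : \int[leb]_x (l%:E * _) = 0); first exact: (int_ge0 leb (nB 0%N)).
  by apply: integral0_eq => x _; rewrite ind0 ?mule0// /B /= ltNge lee_fin l0.
pose E := B N.+1 `&` ~` B N.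
have mE : measurable E by apply: measurableI => //; exact: measurableC.
have cB M : cellular M (B M.+1).
  by move=> x y e; rewrite /B /mkset (@smax_cell M.+1 M v x y).
have cE : cellular N E.
  apply: cellularI => //; apply: cellularC; rewrite /B.
  by move=> x y e; rewrite /mkset (@smax_cell N N v x y).
have indS x : ind (B N.+1) x = ind (B N) x + ind E x :> \bar R.
  have [h|h] := pselect (B N x).
    have h' : B N.+1 x by rewrite /B /= -/(smax N.+1 v x) (lt_le_trans h)//; exact: (smax_nd v x (leqnSn N)).
    by rewrite (ind1 h) (ind1 h') ind0 ?adde0// => -[].
  rewrite (ind0 h) add0e; have [h'|h'] := pselect (B N.+1 x); first by rewrite !ind1.
  by rewrite !ind0// => -[].
have nE : @nnm R _ _ (ind E) by exact: nnm_ind.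
under eq_integral do rewrite indS ge0_muleDr ?ind_ge0//.
rewrite intD; [|by apply: nnmZ; rewrite ?lee_fin//; exact: nnm_ind|by apply: nnmZ; rewrite ?lee_fin].
under [leRHS]eq_integral do rewrite indS ge0_muleDl ?ind_ge0//.
rewrite intD; [|by []|exact: nnmM].
apply: leeD => //; rewrite -(int_avg mE cE nv).
apply: le_int; [by apply: nnmZ; rewrite ?lee_fin|by apply: nnmM => //; exact: nnm_avg|].
move=> x; have [[h1 h2]|h] := pselect (E x); last by rewrite ind0// mule0 mul0e.
rewrite ind1 ?mul1e ?mule1; last by split.
move: h1 h2; rewrite /B /= lt_max => /orP[h|h _]; [by []|exact: ltW].
Qed.

End scalar.
End grid.

(** * Vector-valued maximal functions: from weak (1,1) to strong inequalities *)

Section vector_valued.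
Context {R : realType}.
Local Notation T0 := (measurableTypeR R).
Local Notation leb := (@lebesgue_measure R).

Section param.
Context d (T : measurableType d).
Variable G : @grid R.
Implicit Types f : T0 * T -> \bar R.

(** A function whose values are functions on [T] is stored as a function on the product; averages
    are taken separately for each point of [T]. *)
Definition pavg k f (z : T0 * T) := avg G k (fun y => f (y, z.2)) z.1.
Definition psmax N f (z : T0 * T) := smax G N (fun y => f (y, z.2)) z.1.

Lemma nnm_kerP k f : nnm f ->
  nnm (fun z : (T0 * T) * T0 => (ker G k z.1.1 z.2)%:E * f (z.2, z.1.2)).
Proof.
move=> nf; apply: nnmM.
  apply: (@nnm_comp _ _ _ _ _ _ (fun z : (T0 * T) * T0 => (z.1.1, z.2)) (nnm_ker G k)).
  apply/measurable_fun_pairP; split => /=.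
    exact: (measurableT_comp measurable_fst measurable_fst).
  exact: measurable_snd.
apply: (nnm_comp nf); apply/measurable_fun_pairP; split => /=.
  exact: measurable_snd.
exact: (measurableT_comp measurable_snd measurable_fst).
Qed.

Lemma nnm_pavg k f : nnm f -> nnm (pavg k f).
Proof.
by move=> nf; apply: (@nnm_int2 _ _ _ _ _ _
  (fun z : (T0 * T) * T0 => (ker G k z.1.1 z.2)%:E * f (z.2, z.1.2))); exact: nnm_kerP.
Qed.

Lemma nnm_psmax N f : nnm f -> nnm (psmax N f).
Proof.
move=> nf; elim: N => [|N IH]; first exact: nnm_cst.
by apply: nnm_max => //; exact: nnm_pavg.
Qed.

Variable rho : (T -> \bar R) -> \bar R.
Hypothesis H : nice rho.

Definition vnorm f (x : T0) := rho (fun t => f (x, t)).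

Lemma nnm_vnorm f : nnm f -> nnm (vnorm f).
Proof. exact: (nice_nnm H). Qed.

Lemma vnorm_avg k f x : nnm f -> vnorm (pavg k f) x <= avg G k (vnorm f) x.
Proof.
move=> nf; rewrite /vnorm /pavg /avg /=.
apply: le_trans (@nice_mink _ _ _ _ H _ _ leb (fun z => (ker G k x z.1)%:E * f z) _) _.
  apply: nnmM => //; apply: (nnm_comp (nnm_pair1 x (nnm_ker G k))); exact: measurable_fst.
rewrite le_eqVlt; apply/orP; left; apply/eqP; apply: eq_integral => y _.
by rewrite /= (niceZ H) ?ker_ge0//; exact: nnm_pair1.
Qed.

Lemma vnorm_smaxS N f x : nnm f ->
  vnorm (psmax N.+1 f) x <= vnorm (psmax N f) x + vnorm (pavg N f) x.
Proof.
move=> nf; have n1 := nnm_pair1 x (nnm_psmax N nf); have n2 := nnm_pair1 x (nnm_pavg N nf).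
apply: le_trans (niceD H n1 n2); apply: (nice_le H).
- exact: (nnm_pair1 x (nnm_psmax N.+1 nf)).
- exact: nnmD.
- by move=> t; rewrite /psmax/= ge_max leeDl ?leeDr ?(nnm_ge0 n1) ?(nnm_ge0 n2).
Qed.

Lemma vnorm_psmax0 f x : vnorm (psmax 0 f) x = 0.
Proof. exact: (nice0 H). Qed.

Lemma vnorm_psmax_nd N M f x : nnm f -> (N <= M)%N ->
  vnorm (psmax N f) x <= vnorm (psmax M f) x.
Proof.
move=> nf NM; apply: (nice_le H) => [||t].
- exact: (nnm_pair1 x (nnm_psmax N nf)).
- exact: (nnm_pair1 x (nnm_psmax M nf)).
- exact: smax_nd.
Qed.

Lemma vnorm_psmax_cell N k f x y : (N <= k.+1)%N -> cell G k x = cell G k y ->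
  vnorm (psmax N f) x = vnorm (psmax N f) y.
Proof.
by move=> Nk e; congr rho; apply/funext => t; exact: smax_cell Nk e.
Qed.

(* At scales finer than the first one at which the maximal function exceeds [l],
   the cells lie inside the set where it exceeds [l]. *)
Lemma vnorm_psmax_trunc N f (l : R) x : nnm f -> (0 <= l)%R ->
  let B := [set y | l%:E < vnorm (psmax N f) y] in B x ->
  vnorm (psmax N f) x <= l%:E + vnorm (psmax N (fun z => ind B z.1 * f z)) x.
Proof.
move=> nf l0 B Bx.
have mB : measurable B by apply: msr_gt; exact/nnm_vnorm/nnm_psmax.
set f' := fun z => _.
have nf' : nnm f'.
  by apply: nnmM => //; exact: (nnm_comp (nnm_ind mB) measurable_fst).
have [k kN [hk hk1]] : exists2 k, (k < N)%N & vnorm (psmax k f) x <= l%:E /\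
    l%:E < vnorm (psmax k.+1 f) x.
  have : l%:E < vnorm (psmax N f) x by [].
  elim: (N) => [|M IH]; first by rewrite vnorm_psmax0 ltNge lee_fin l0.
  have [h _|h h'] := ltP l%:E (vnorm (psmax M f) x).
    by have [k kM hk] := IH h; exists k => //; exact: ltnW.
  by exists M.
have n1 := nnm_pair1 x (nnm_psmax k nf); have n2 := nnm_pair1 x (nnm_psmax N nf').
apply: le_trans (leeD hk (lexx _)).
apply: le_trans (niceD H n1 n2); apply: (nice_le H).
- exact: (nnm_pair1 x (nnm_psmax N nf)).
- exact: nnmD.
- move=> t; rewrite /psmax /=; apply: smax_le => [|j jN].
    by rewrite adde_ge0// smax_ge0.
  have [jk|kj] := ltnP j k.
    apply: (@le_trans _ _ (smax G k (fun y => f (y, t)) x)); first exact: avg_smax.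
    by rewrite leeDl// smax_ge0.
  rewrite (_ : avg _ _ _ _ = avg G j (fun y => f' (y, t)) x); last first.
    apply: eq_avg => y e; rewrite /f' /= ind1 ?mul1e// /B /mkset.
    apply: lt_le_trans (vnorm_psmax_nd y nf kN).
    by rewrite -(@vnorm_psmax_cell k.+1 k f x y (leqnn _) (cell_nestle kj e)).
  apply: (@le_trans _ _ (smax G N (fun y => f' (y, t)) x)); first exact: avg_smax.
  by rewrite leeDr// smax_ge0.
Qed.

(** A crude bound, adding up the scales one by one, that degenerates with [N]. It only supplies the
    finiteness asked for by [pow_absorb]. *)
Lemma int_vnorm_smax_fin N f (p : R) : nnm f -> (1 < p)%R ->
  \int[leb]_x vnorm f x `^ p < +oo -> \int[leb]_x vnorm (psmax N f) x `^ p < +oo.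
Proof.
move=> nf p1 h; have p0 : (0 < p)%R by apply: lt_trans p1.
have ha k : \int[leb]_x vnorm (pavg k f) x `^ p < +oo.
  apply: le_lt_trans h; rewrite -(int_avgT G k (nnm_pow p (nnm_vnorm nf))).
  apply: le_int; [exact/nnm_pow/nnm_vnorm/nnm_pavg|exact/nnm_avg/nnm_pow/nnm_vnorm|].
  move=> x; apply: le_trans (avg_jensen _ _ _ _ p1); last exact: nnm_vnorm.
  by apply: le_pow; [exact: ltW|exact: (nice_ge0 H)|exact: vnorm_avg].
elim: N => [|N IH].
  by rewrite integral0_eq// => x _; rewrite vnorm_psmax0 poweR0r// gt_eqF.
have nN := nnm_pow p (nnm_vnorm (nnm_psmax N nf)).
have na := nnm_pow p (nnm_vnorm (nnm_pavg N nf)).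
apply: (@le_lt_trans _ _ (\int[leb]_x ((2 `^ p)%:E *
    (vnorm (psmax N f) x `^ p + vnorm (pavg N f) x `^ p)))).
  apply: le_int => [||x].
  - exact/nnm_pow/nnm_vnorm/nnm_psmax.
  - by apply: nnmZ; [rewrite lee_fin powR_ge0|exact: nnmD].
  - set a := vnorm (psmax N f) x; set b := vnorm (pavg N f) x.
    have a0 : 0 <= a by exact: (nice_ge0 H).
    have b0 : 0 <= b by exact: (nice_ge0 H).
    apply: (@le_trans _ _ ((2%:E * maxe a b) `^ p)).
      apply: le_pow; [exact: ltW|exact: (nice_ge0 H)|].
      apply: le_trans (vnorm_smaxS N x nf) _; rewrite -/a -/b.
      have -> : (2%:E = 1 + 1 :> \bar R) by [].
      by rewrite ge0_muleDl// !mul1e leeD// le_max lexx ?orbT.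
    rewrite poweRM ?lee_fin//; last by rewrite le_max a0.
    rewrite poweR_EFin lee_wpmul2l ?lee_fin ?powR_ge0// /maxe.
    by case: ifP => _; rewrite ?leeDl ?leeDr// poweR_ge0.
rewrite intZ ?lee_fin ?powR_ge0//; last exact: nnmD.
rewrite intD// lte_mul_pinfty ?lee_fin ?powR_ge0// lte_add_pinfty//.
Qed.

End param.

(** The constant is uniform over grids and numbers of scales, so that suprema over both may be taken
    later. *)
Definition weak11 d (T : measurableType d) (rho : (T -> \bar R) -> \bar R) (C : R) :=
  forall G N (f : T0 * T -> \bar R) (l : R), nnm f -> (0 < l)%R ->
  l%:E * leb [set x | l%:E < vnorm rho (psmax G N f) x] <=
  C%:E * \int[leb]_x vnorm rho f x.

Definition strong d (T : measurableType d) (rho : (T -> \bar R) -> \bar R) (p C : R) :=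
  forall G N (f : T0 * T -> \bar R), nnm f ->
  \int[leb]_x vnorm rho (psmax G N f) x `^ p <= C%:E * \int[leb]_x vnorm rho f x `^ p.

(** The weak bound is applied to [f] restricted to the set where its maximal function exceeds [l];
    [vnorm_psmax_trunc] shows that this loses only [l], in place of an L^oo endpoint. [layer_cake],
    Hoelder and absorption conclude. *)
Lemma weak_strong d (T : measurableType d) (rho : (T -> \bar R) -> \bar R) (p C : R) :
  nice rho -> (1 < p)%R -> (0 < C)%R -> weak11 rho C -> exists2 K : R, (0 < K)%R & strong rho p K.
Proof.
move=> H p1 C0 W; have p0 : (0 < p)%R by apply: lt_trans p1.
pose A : R := (4 `^ p * ((2 `^ (p - 1) - 1)^-1 * 2 `^ (p - 1)) * C)%R.
have A0 : (0 < A)%R.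
  rewrite !mulr_gt0 ?powR_gt0// invr_gt0 subr_gt0.
  by have := @gt0_ltr_powR R (p - 1)%R _ 1%R 2%R; rewrite powR1; apply;
    rewrite ?nnegrE ?subr_gt0// ltr1n.
exists (A `^ p)%R; first by rewrite powR_gt0.
move=> G N f nf; set F := vnorm rho (psmax G N f); set v := vnorm rho f.
have nF : nnm F by exact/nnm_vnorm/nnm_psmax.
have nv : nnm v by exact: nnm_vnorm.
have [fin|inf] := pselect (\int[leb]_x v x `^ p < +oo); last first.
  move/negP: inf; rewrite -leNgt leye_eq => /eqP ->.
  by rewrite gt0_muley ?leey// lte_fin powR_gt0.
have Ffin : \int[leb]_x F x `^ p < +oo by exact: int_vnorm_smax_fin.
have good l : (0 < l)%R -> l%:E * leb [set x | (2 * l)%:E < F x] <=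
    C%:E * \int[leb]_x (ind [set x | l%:E < F x] x * v x).
  move=> l0; set B := [set x | l%:E < F x].
  have mB : measurable B by exact: msr_gt.
  pose f' z := ind B z.1 * f z.
  have nf' : nnm f'.
    by apply: nnmM => //; exact: (nnm_comp (nnm_ind mB) measurable_fst).
  have e x : vnorm rho f' x = ind B x * v x.
    rewrite /vnorm /f' /= (niceZ H)//; exact: nnm_pair1.
  under eq_integral do rewrite -e.
  apply: le_trans (W G N f' l nf' l0); rewrite lee_wpmul2l ?lee_fin ?(ltW l0)//.
  apply: le_measure; rewrite ?inE.
  - exact: msr_gt.
  - by apply: msr_gt; exact/nnm_vnorm/nnm_psmax.
  - move=> x /= h; have Bx : B x.
      by apply: le_lt_trans h; rewrite lee_fin ler_peMl ?ler1n// ltW.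
    have := vnorm_psmax_trunc H nf (ltW l0) Bx; rewrite -/F -/B -/f' => h'.
    have := lt_le_trans h h'; rewrite mulr2n mulrDl mul1r EFinD lteD2lE//.
have K := layer_cake nF nv (ltW C0) p1 good.
have a0 : 0 <= \int[leb]_x v x `^ p by apply: int_ge0; exact: nnm_pow.
have b0 : 0 <= \int[leb]_x F x `^ p by apply: int_ge0; exact: nnm_pow.
have h : \int[leb]_x F x `^ p <=
    (A%:E * (\int[leb]_x v x `^ p) `^ p^-1) * (\int[leb]_x F x `^ p) `^ (1 - p^-1).
  apply: le_trans K _; rewrite -/A -muleA lee_wpmul2l ?lee_fin ?(ltW A0)//.
  exact: int_pow_conj.
have := pow_absorb p1 b0 _ Ffin h.
rewrite mule_ge0 ?poweR_ge0 ?lee_fin ?(ltW A0)// => /(_ isT) h'.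
have := @le_pow _ _ _ p (ltW p0) (poweR_ge0 _ _) h'.
by rewrite powVK ?gt_eqF// poweRM ?lee_fin ?poweR_ge0 ?(ltW A0)// powVK ?gt_eqF.
Qed.

End vector_valued.

(** * Calderon-Zygmund decomposition: from one strong inequality to weak (1,1) *)

Section calderon_zygmund.
Context {R : realType}.
Local Notation T0 := (measurableTypeR R).
Local Notation leb := (@lebesgue_measure R).

Section good_part.
Variables (G : @grid R) (B : nat -> set T0).
Hypotheses (mB : forall k, measurable (B k)) (cB : forall k, cellular G k (B k.+1))
  (ndB : forall k, B k `<=` B k.+1).

(* The good part of the Calderon-Zygmund decomposition: averages at the last
   scale before the exceptional sets [B] are entered. *)
Fixpoint cz (N : nat) (w : T0 -> \bar R) (x : T0) : \bar R :=
  if N is k.+1 then ind (B N) x * cz k w x + ind (~` B N) x * avg G N w x else 0.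

Lemma czS_in k w x : B k.+1 x -> cz k.+1 w x = cz k w x.
Proof. by move=> h; rewrite /= ind1// mul1e ind0 ?mul0e ?adde0// => /(_ h). Qed.

Lemma czS_out k w x : ~ B k.+1 x -> cz k.+1 w x = avg G k.+1 w x.
Proof. by move=> h; rewrite /= ind0// mul0e ind1 ?mul1e ?add0e. Qed.

Lemma nnm_cz k w : nnm w -> nnm (cz k w).
Proof.
move=> nw; elim: k => [|k IH]; first exact: nnm_cst.
apply: nnmD; first by apply: nnmM => //; exact: nnm_ind.
by apply: nnmM; [apply: nnm_ind; exact: measurableC|exact: nnm_avg].
Qed.

(** The two functions differ only outside [B k.+2]. That set is a union of cells of level [k.+1],
    and on it both are averages of [w], at levels [k.+2] and [k.+1]. *)
Lemma int_czS k w (A : set T0) : nnm w -> measurable A -> cellular G k.+1 A ->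
  \int[leb]_x (ind A x * cz k.+2 w x) = \int[leb]_x (ind A x * cz k.+1 w x).
Proof.
move=> nw mA cA.
have := @czS_in k.+1 w; have := @czS_out k.+1 w; have := @czS_out k w.
move: (nnm_cz k.+2 nw) (nnm_cz k.+1 nw).
move: (cz k.+2 w) (cz k.+1 w) => u2 u1 n2 n1 out1 out2 in2.
have mD := measurableI _ _ mA (measurableC (mB k.+2)).
have mE := measurableI _ _ mA (mB k.+2).
set D := A `&` ~` B k.+2 in mD *; set E := A `&` B k.+2 in mE *.
have cD : cellular G k.+1 D.
  by apply: cellularI => //; apply: cellularC; exact: cB.
have int_split u : nnm u -> \int[leb]_x (ind A x * u x) =
    \int[leb]_x (ind E x * u x) + \int[leb]_x (ind D x * u x) :> \bar R.
  move=> nu; rewrite -intD; [|by apply: nnmM => //; exact: nnm_ind|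
    by apply: nnmM => //; exact: nnm_ind].
  apply: eq_integral => x _; have [Ax|nAx] := pselect (A x); last first.
    by rewrite !ind0 ?mul0e ?adde0//; case.
  have [h|h] := pselect (B k.+2 x).
    have Ex : E x by [].
    by rewrite (ind1 Ax) (ind1 Ex) ind0 ?mul0e ?adde0// => -[].
  have Dx : D x by [].
  by rewrite (ind1 Ax) (ind1 Dx) ind0 ?mul0e ?add0e// => -[].
rewrite (int_split _ n2) (int_split _ n1).
have -> : \int[leb]_x (ind E x * u2 x) = \int[leb]_x (ind E x * u1 x).
  apply: eq_integral => x _; have [[_ h]|h] := pselect (E x); first by rewrite in2.
  by rewrite ind0// !mul0e.
have -> : \int[leb]_x (ind D x * u2 x) = \int[leb]_x (ind D x * avg G k.+2 w x).
  apply: eq_integral => x _; have [[_ h]|h] := pselect (D x); first by rewrite out2.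
  by rewrite ind0// !mul0e.
have -> : \int[leb]_x (ind D x * u1 x) = \int[leb]_x (ind D x * avg G k.+1 w x).
  apply: eq_integral => x _; have [[_ h]|h] := pselect (D x).
    by rewrite out1// => /ndB.
  by rewrite ind0// !mul0e.
by rewrite !int_avg//; exact: cellular_le cD.
Qed.

(** The reason for this good part: outside the exceptional set it cannot be told from [w] by
    averages at the scales in use, so the bad part never has to be estimated. *)
Lemma avg_cz k w x j : nnm w -> ~ B k.+1 x -> (j <= k.+1)%N ->
  avg G j (cz k.+1 w) x = avg G j w x.
Proof.
move=> nw + jk; rewrite (avgE G j x (nnm_cz k.+1 nw)) (avgE G j x nw) => nBx.
suff -> : \int[leb]_y (ind [set y | cell G j x = cell G j y] y * cz k.+1 w y) =
    \int[leb]_y (ind [set y | cell G j x = cell G j y] y * w y) by [].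
elim: k jk nBx => [|k IH] jk nBx.
  rewrite -[RHS](@int_avg _ G 1%N _ _ (msr_cellE G j x) (cellular_le jk (@cellular_cell _ G j x)) nw).
  apply: eq_integral => y _; have [h|h] := pselect (cell G j x = cell G j y); last first.
    by rewrite ind0// !mul0e.
  rewrite czS_out// => By; apply: nBx; apply: cB By; apply/esym.
  case: j h {jk} => [//|j] h; apply: (cell_nestle (leq0n j.+1)) h.
have [jk'|jk'] := leqP j k.+1.
  rewrite (int_czS nw (msr_cellE G j x) (cellular_le jk' (@cellular_cell _ G j x))).
  exact: IH jk' (fun h => nBx (ndB h)).
have {jk jk'} -> : j = k.+2 by apply/eqP; rewrite eqn_leq jk.
rewrite -[RHS](@int_avg _ G k.+2 _ _ (msr_cellE G k.+2 x) (@cellular_cell _ G k.+2 x) nw).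
apply: eq_integral => y _; have [h|h] := pselect (cell G k.+2 x = cell G k.+2 y); last first.
  by rewrite ind0// !mul0e.
by rewrite czS_out// => By; apply: nBx; apply: cB By; apply/esym; exact: cell_nest.
Qed.

(** Mass is preserved from level 1 on; only the mass in [B 1], where [cz] is 0, is lost. *)
Lemma int_cz k w : nnm w -> \int[leb]_x cz k w x <= \int[leb]_x w x.
Proof.
move=> nw; case: k => [|k]; first by rewrite integral0; exact: int_ge0.
have e u : \int[leb]_x (ind setT x * u x) = \int[leb]_x u x :> \bar R.
  by apply: eq_integral => x _; rewrite ind1// mul1e.
elim: k => [|k IH].
  2: by rewrite -e (int_czS nw measurableT (fun _ _ _ => id)) e.
rewrite -(int_avgT G 1 nw); apply: le_int; [exact: nnm_cz|exact: nnm_avg|move=> x].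
have [h|h] := pselect (B 1 x); first by rewrite czS_in//=; exact: avg_ge0.
by rewrite czS_out.
Qed.

Section param.
Context d (T : measurableType d).
Implicit Types f : T0 * T -> \bar R.

Definition pcz N f (z : T0 * T) := cz N (fun y => f (y, z.2)) z.1.

Lemma nnm_pcz N f : nnm f -> nnm (pcz N f).
Proof.
move=> nf; elim: N => [|N IH]; first exact: nnm_cst.
apply: nnmD; apply: nnmM => //.
- exact: (nnm_comp (nnm_ind (mB _)) measurable_fst).
- exact: (nnm_comp (nnm_ind (measurableC (mB _))) measurable_fst).
- exact: nnm_pavg.
Qed.

Variable rho : (T -> \bar R) -> \bar R.
Hypothesis H : nice rho.

Lemma vnorm_cz N f x : nnm f -> vnorm rho (pcz N f) x <= cz N (vnorm rho f) x.
Proof.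
move=> nf; elim: N => [|N IH]; first by rewrite /vnorm /pcz /= (nice0 H).
have [h|h] := pselect (B N.+1 x).
  rewrite czS_in//; apply: le_trans IH; rewrite le_eqVlt; apply/orP; left; apply/eqP.
  by congr rho; apply/funext => t; rewrite /pcz czS_in.
rewrite czS_out//; apply: le_trans (vnorm_avg G H N.+1 x nf).
rewrite le_eqVlt; apply/orP; left; apply/eqP.
by congr rho; apply/funext => t; rewrite /pcz czS_out.
Qed.

End param.
End good_part.

(** The exceptional set has measure at most the integral of [v] over [l]. Off it the maximal
    function is that of the good part, whose norm is at most [2 * l]; Chebyshev with exponent [q]
    gives the term C * 2^(q-1). *)
Lemma strong_weak d (T : measurableType d) (rho : (T -> \bar R) -> \bar R) (q C : R) :
  nice rho -> (1 < q)%R -> (0 < C)%R -> strong rho q C ->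
  weak11 rho (1 + C * 2 `^ (q - 1)).
Proof.
move=> H q1 C0 S G N f l nf l0; have q0 : (0 < q)%R by apply: lt_trans q1.
have qq0 : (0 < q - 1)%R by rewrite subr_gt0.
set v := vnorm rho f; have nv : nnm v by exact: nnm_vnorm.
case: N => [|N].
  rewrite (_ : [set _ | _] = set0) ?measure0 ?mule0.
    by rewrite mule_ge0 ?int_ge0// lee_fin addr_ge0// mulr_ge0 ?powR_ge0// ltW.
  by apply/seteqP; split => // x /=; rewrite (vnorm_psmax0 G H) ltNge lee_fin ltW.
pose B k := [set x | l%:E < smax G k v x].
have mB k : measurable (B k) by apply: msr_gt; exact: nnm_smax.
have cB k : cellular G k (B k.+1).
  by move=> x y e; rewrite /B /mkset (@smax_cell _ G k.+1 k v x y).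
have ndB k : B k `<=` B k.+1.
  by move=> x; rewrite /B /mkset => /lt_le_trans; apply; exact: smax_nd.
pose g := pcz G B N.+1 f; have ng : nnm g by exact: nnm_pcz.
pose vg := vnorm rho g; have nvg : nnm vg by exact: nnm_vnorm.
set F := vnorm rho (psmax G N.+1 f).
have nF : nnm F by exact/nnm_vnorm/nnm_psmax.
pose Fg := vnorm rho (psmax G N.+1 g).
have nFg : nnm Fg by exact/nnm_vnorm/nnm_psmax.
have sub : [set x | l%:E < F x] `<=` B N.+1 `|` [set x | l%:E < Fg x].
  move=> x /= h; have [Bx|Bx] := pselect (B N.+1 x); [by left|right].
  rewrite (_ : Fg x = F x)//; congr rho; apply/funext => t.
  apply: eq_smax => k kN; rewrite /g /pcz /=.
  by rewrite -(avg_cz mB cB ndB (nnm_pair2 t nf) Bx (ltnW kN)).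
have mF : measurable [set x | l%:E < F x] by exact: msr_gt.
have mFg : measurable [set x | l%:E < Fg x] by exact: msr_gt.
have V0 : 0 <= \int[leb]_x v x by exact: int_ge0.
have part1 : l%:E * leb (B N.+1) <= \int[leb]_x v x.
  apply: le_trans (smax_weak G N.+1 nv (ltW l0)) _.
  apply: le_int => //; first by apply: nnmM => //; exact: (nnm_ind (mB N.+1)).
  by move=> x; rewrite -[leRHS]mul1e lee_wpmul2r ?ind_le1// (nnm_ge0 nv).
(* Outside [B k.+1] the average of level [k] is at most [l], hence that of level [k.+1] at most
   [2 * l]. *)
have vg2 x : vg x <= (2 * l)%:E.
  apply: le_trans (vnorm_cz G B H N.+1 x nf) _; rewrite -/v.
  elim: N.+1 => [|k IH]; first by rewrite lee_fin mulr_ge0// ltW.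
  have [h|h] := pselect (B k.+1 x); first by rewrite czS_in.
  rewrite czS_out//; apply: le_trans (avg_half G k x nv) _.
  rewrite EFinM lee_wpmul2l ?lee_fin//.
  apply: le_trans (avg_smax G v x (ltnSn k)) _.
  by rewrite leNgt; apply/negP.
have part2 : l%:E * leb [set x | l%:E < Fg x] <= (C * 2 `^ (q - 1))%:E * \int[leb]_x v x.
  have lq0 : (0 < l `^ (q - 1))%R by rewrite powR_gt0.
  have lq0' : 0 < (l `^ (q - 1))%:E by rewrite lte_fin.
  rewrite -(lee_pmul2l _ lq0')//.
  rewrite muleA -EFinM (_ : l `^ (q - 1) * l = l `^ q)%R; last first.
    by rewrite -[X in (_ * X)%R]powRr1 ?(ltW l0)// -powRD ?subrK// gt_eqF.
  apply: (@le_trans _ _ (\int[leb]_x Fg x `^ q)).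
    rewrite -(int_ind leb mFg) -intZ ?lee_fin ?powR_ge0//; last exact: nnm_ind.
    apply: le_int; [by apply: nnmZ; [rewrite lee_fin powR_ge0|exact: nnm_ind]|exact: nnm_pow|].
    move=> x; have [h|h] := pselect (l%:E < Fg x); last by rewrite ind0// mule0 poweR_ge0.
    rewrite ind1// mule1 -poweR_EFin; apply: le_pow; [exact: ltW|by rewrite lee_fin ltW|exact: ltW].
  apply: le_trans (S G N.+1 g ng) _; rewrite -/vg.
  rewrite [leRHS](_ : _ = C%:E * (((2 * l) `^ (q - 1))%:E * \int[leb]_x v x)); last first.
    by rewrite !muleA -!EFinM powRM ?(ltW l0)//; congr (_%:E * _); ring.
  rewrite lee_wpmul2l ?lee_fin ?(ltW C0)//.
  apply: (@le_trans _ _ (\int[leb]_x (((2 * l) `^ (q - 1))%:E * vg x))).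
    apply: le_int => [||x]; [exact: nnm_pow|by apply: nnmZ; rewrite ?lee_fin ?powR_ge0|].
    have vgx0 := nnm_ge0 nvg x.
    rewrite -[X in vg x `^ X](subrK 1%R q) powD// poweRe1// lee_wpmul2r// -poweR_EFin.
    by apply: le_pow; [exact: ltW|by []|exact: vg2].
  rewrite intZ ?lee_fin ?powR_ge0// lee_wpmul2l ?lee_fin ?powR_ge0//.
  apply: le_trans (int_cz mB cB ndB N.+1 nv); apply: le_int => //; first exact: nnm_cz.
  by move=> x; exact: vnorm_cz.
rewrite EFinD ge0_muleDl ?lee_fin//; last by rewrite mulr_ge0 ?powR_ge0// ltW.
rewrite mul1e; apply: le_trans (leeD part1 part2).
rewrite -ge0_muleDr ?measure_ge0// lee_wpmul2l ?lee_fin ?(ltW l0)//.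
apply: le_trans (measureU2 _ _ _) => //.
by apply: le_measure; rewrite ?inE//; exact: measurableU.
Qed.

End calderon_zygmund.

(** * The maximal inequality for iterated norms *)

Section hardy_littlewood_property.
Context {R : realType}.
Local Notation T0 := (measurableTypeR R).
Local Notation leb := (@lebesgue_measure R).

(** All outer exponents are included because the next iteration may use any of them. *)
Definition HL d (T : measurableType d) (rho : (T -> \bar R) -> \bar R) :=
  forall p : R, (1 < p)%R -> exists2 K : R, (0 < K)%R & strong rho p K.

Lemma weak_HL d (T : measurableType d) (rho : (T -> \bar R) -> \bar R) (C : R) :
  nice rho -> (0 < C)%R -> weak11 rho C -> HL rho.
Proof. by move=> H C0 W p p1; exact: weak_strong W. Qed.

Lemma HL_abs : HL (fun f : unit -> \bar R => `|f tt|).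
Proof.
apply: (@weak_HL _ _ _ 1%R nice_abs) => // G N f l nf l0; rewrite mul1e.
have ntt : nnm (fun x => f (x, tt)) by exact: nnm_pair2.
rewrite (_ : [set x | _] = [set x | l%:E < smax G N (fun y => f (y, tt)) x]); last first.
  by apply/seteqP; split => x /=; rewrite /vnorm /psmax /= gee0_abs// smax_ge0.
apply: le_trans (smax_weak G N ntt (ltW l0)) _.
apply: le_int => [||x].
- by apply: nnmM => //; apply: nnm_ind; apply: msr_gt; exact: nnm_smax.
- exact: (nnm_vnorm nice_abs nf).
- rewrite /vnorm gee0_abs ?(nnm_ge0 nf)// -[leRHS]mul1e.
  by rewrite lee_wpmul2r ?ind_le1// (nnm_ge0 nf).
Qed.

(** The supremum of the maximal functions is at most the maximal function of the supremum, which
    reduces to the scalar weak bound. *)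
Lemma HL_supnorm : HL (@supnorm R).
Proof.
apply: (@weak_HL _ _ _ 1%R nice_supnorm) => // G N f l nf l0; rewrite mul1e.
pose v := vnorm supnorm f; have nv : nnm v by exact: (nnm_vnorm nice_supnorm nf).
have fv j x : f (x, j) <= v x.
  rewrite /v /vnorm supnormE; last by move=> i; exact: (nnm_ge0 nf).
  exact: (le_sup (fun j => f (x, j))).
apply: le_trans (le_trans (smax_weak G N nv (ltW l0)) _); last first.
  apply: le_int => //; first by apply: nnmM => //; apply: nnm_ind; apply: msr_gt; exact: nnm_smax.
  by move=> x; rewrite -[leRHS]mul1e lee_wpmul2r ?ind_le1// (nnm_ge0 nv).
rewrite lee_wpmul2l ?lee_fin ?(ltW l0)//; apply: le_measure; rewrite ?inE.
- by apply: msr_gt; apply: (nnm_vnorm nice_supnorm); exact: nnm_psmax.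
- by apply: msr_gt; exact: nnm_smax.
- move=> x /= /lt_le_trans; apply; rewrite /vnorm supnormE; last by move=> j; exact: smax_ge0.
  by apply: sup_le => j; apply: le_smax => //; exact: nnm_pair2.
Qed.

Lemma HL_pull d (T : measurableType d) d' (T' : measurableType d') (phi : T -> T')
    (rho : (T -> \bar R) -> \bar R) : measurable_fun setT phi -> HL rho ->
  HL (fun f : T' -> \bar R => rho (fun t => f (phi t))).
Proof.
move=> mphi h p p1; have [K K0 S] := h p p1; exists K => // G N f nf.
apply: (S G N (fun z => f (z.1, phi z.2))).
apply: (nnm_comp nf); apply/measurable_fun_pairP; split; first exact: measurable_fst.
exact: (measurableT_comp mphi measurable_snd).
Qed.

(* The exponent [q] itself is Tonelli; the Calderon-Zygmund decomposition then gives
   the weak (1,1) bound, from which all exponents follow. *)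
Lemma HL_Lq d (S : measurableType d) (mu : {sigma_finite_measure set S -> \bar R})
    d' (T : measurableType d') (rho : (T -> \bar R) -> \bar R) (q : R) :
  nice rho -> (1 < q)%R -> HL rho -> HL (Lq mu rho q).
Proof.
move=> H q1 h; have [C C0 St] := h q q1.
have q0 : (0 < q)%R by apply: lt_trans q1.
have HL := nice_Lq mu H q1.
apply: (@weak_HL _ _ _ (1 + C * 2 `^ (q - 1))%R HL).
  by rewrite addr_gt0// mulr_gt0// powR_gt0.
apply: (strong_weak HL q1 C0) => G N f nf.
have ng u : nnm u -> nnm (fun z : T0 * S => rho (fun t => u (z.1, (z.2, t))) `^ q).
  move=> nu; apply: nnm_pow; apply: (@nice_nnm _ _ _ _ H _ _ (fun z => u (z.1.1, (z.1.2, z.2)))).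
  apply: (nnm_comp nu); apply/measurable_fun_pairP; split.
    exact: (measurableT_comp measurable_fst measurable_fst).
  apply/measurable_fun_pairP; split => /=; last exact: measurable_snd.
  exact: (measurableT_comp measurable_snd measurable_fst).
have nm := nnm_psmax G N nf.
have e u : nnm u -> \int[leb]_x vnorm (Lq mu rho q) u x `^ q =
    \int[mu]_s \int[leb]_x (rho (fun t => u (x, (s, t))) `^ q).
  move=> nu; rewrite -(@tonelli _ _ _ _ _ leb mu (fun z => rho (fun t => u (z.1, (z.2, t))) `^ q)) /=; last exact: (ng u nu).
  apply: eq_integral => x _; rewrite /vnorm (Lq_pow mu H q1)//; exact: nnm_pair1.
rewrite !e// -intZ ?lee_fin ?(ltW C0)//; last exact: (nnm_int1 leb (ng f nf)).
apply: le_int.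
- exact: (nnm_int1 leb (ng _ nm)).
- by apply: nnmZ; [rewrite lee_fin ltW|exact: (nnm_int1 leb (ng f nf))].
- move=> s; apply: (St G N (fun z => f (z.1, (s, z.2)))).
  apply: (nnm_comp nf); apply/measurable_fun_pairP; split; first exact: measurable_fst.
  by apply/measurable_fun_pairP; split; [exact: measurable_cst|exact: measurable_snd].
Qed.

End hardy_littlewood_property.

(** * The two shifted dyadic grids *)

Section dyadic_grid.
Context {R : realType}.
Local Notation T0 := (measurableTypeR R).
Local Notation leb := (@lebesgue_measure R).
Local Open Scope ring_scope.

(* The one-third trick: the shift by 1/3 alternates in sign with the generation, so
   that the shifted cells nest, and every interval lies in a cell of comparable
   length of one of the two grids. *)
Definition shift (a : bool) (g : int) : R := a%:R * (-1) ^ g / 3.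

Definition dcell (a : bool) (g : int) (x : T0) : int :=
  Num.floor (2 ^ g * (x : R) + shift a g).

Lemma pow2_gt0 (g : int) : 0 < 2 ^ g :> R. Proof. by rewrite exprz_gt0. Qed.

Lemma pow2S (g : int) : 2 ^ (g + 1) = 2 * 2 ^ g :> R.
Proof. by rewrite exprzDr ?expr1z ?unitfE// mulrC. Qed.

Lemma pow2N (g : int) : 2 ^ (- g) = (2 ^ g)^-1 :> R.
Proof. by rewrite invr_expz. Qed.

Lemma floor_eqP (x : R) (m : int) : Num.floor x = m <-> m%:~R <= x < m%:~R + 1.
Proof.
split=> [<-|h]; first by have := floor_itv x; rewrite intrD.
by apply: floor_def; rewrite intrD.
Qed.

Lemma dcellE (a : bool) (g : int) (m : int) :
  [set x : T0 | dcell a g x = m] =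
  [set` `[2 ^ (- g) * (m%:~R - shift a g), 2 ^ (- g) * (m%:~R + 1 - shift a g)[ ].
Proof.
have p0 := pow2_gt0 g.
apply/seteqP; split => x /=; rewrite /dcell floor_eqP in_itv/= pow2N => /andP[h1 h2];
  apply/andP; split.
- by rewrite ler_pdivrMl// lerBlDr.
- by rewrite ltr_pdivlMl// ltrBrDr.
- by move: h1; rewrite ler_pdivrMl// lerBlDr.
- by move: h2; rewrite ltr_pdivlMl// ltrBrDr.
Qed.

Lemma dcell_meas a g m : measurable [set x : T0 | dcell a g x = m].
Proof. by rewrite dcellE; exact: measurable_itv. Qed.

Lemma dcell_vol a g m : leb [set x : T0 | dcell a g x = m] = (2 ^ (- g))%:E.
Proof.
rewrite dcellE lebesgue_measure_itv /= lte_fin ltr_pM2l ?pow2_gt0//.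
rewrite ltrD2r ltrDl ltr01 -EFinB; congr (_%:E).
by rewrite -mulrBr addrAC [X in _ * X]addrC opprB addrA [X in _ * X](_ : _ = 1) ?mulr1//; ring.
Qed.

(** The integer part of y is half that of 2y, rounded down. *)
Lemma floor_double (y z : R) : Num.floor (2 * y) = Num.floor (2 * z) -> Num.floor y = Num.floor z.
Proof.
move=> e; have /floor_eqP := e; have /andP[h1 h2] := (floor_eqP (2 * z) _).1 erefl.
set m := Num.floor (2 * z) in h1 h2 *; move=> /andP[h3 h4].
have /andP[a1 a2] := (floor_eqP y _).1 erefl; set p := Num.floor y in a1 a2 *.
apply/esym/floor_eqP.
have b1 : (2 * p <= m)%R.
  by rewrite /m -e floor_ge_int intrM ler_pM2l.
have b2 : (m < 2 * (p + 1))%R.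
  by rewrite /m -e floor_lt_int intrM intrD ltr_pM2l.
have c1 : (2 * p%:~R <= m%:~R :> R) by rewrite -(intrM _ 2 p) ler_int.
have c2 : (m%:~R + 1 <= 2 * (p%:~R + 1) :> R).
  by rewrite -(intrD _ p 1) -(intrM _ 2 _) -(intrD _ m 1) ler_int lezD1.
by apply/andP; split; lra.
Qed.

Lemma dcell_nest a g x y : dcell a (g + 1) x = dcell a (g + 1) y -> dcell a g x = dcell a g y.
Proof.
rewrite /dcell => h; apply: floor_double.
have m1 : ((-1) ^ g : R) \is a Num.int_num.
  by case: (g) => k; rewrite /exprz ?invr_sign rpredX// rpredN1.
(* Twice the shift of one generation differs from the shift of the next by the integer a (-1)^g,
   which only relabels the cells. *)
have e (z : R) : 2 * (2 ^ g * z + shift a g) =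
    (2 ^ (g + 1) * z + shift a (g + 1)) + a%:R * (-1) ^ g.
  rewrite pow2S /shift.
  have -> : ((-1) ^ (g + 1) = - (-1) ^ g :> R).
    by rewrite exprzDr ?unitfE ?oppr_eq0 ?oner_neq0// expr1z mulrN1.
  by field.
have m2 : (a%:R * (-1) ^ g : R) \is a Num.int_num by rewrite rpredM// rpred_nat.
by rewrite !e !(floorDrz _ m2) h.
Qed.

(** A grid has a coarsest level, so level [k] stands for generation [k - K]; [K] goes to infinity in
    [dmax]. *)
Definition dgrid_cell (a : bool) (K k : nat) := dcell a (k%:Z - K%:Z).
Definition dgrid_len (K k : nat) : R := 2 ^ (- (k%:Z - K%:Z)).

Definition dgrid (a : bool) (K : nat) : @grid R.
Proof.
refine (@Grid _ (dgrid_cell a K) (dgrid_len K) _ _ _ _ _).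
- by move=> k; exact: pow2_gt0.
- by move=> k m; exact: dcell_meas.
- move=> k x y; rewrite /dgrid_cell (_ : k.+1%:Z - K%:Z = k%:Z - K%:Z + 1); last first.
    by lia.
  exact: dcell_nest.
- move=> k x; rewrite -(dcell_vol a (k%:Z - K%:Z) (dgrid_cell a K k x)).
  by congr (leb _); apply/seteqP; split => y /= e; exact/esym.
- move=> k; rewrite /dgrid_len -pow2S; congr (2 ^ _).
  by lia.
Defined.

Definition davg (a : bool) (g : int) (v : T0 -> \bar R) (x : T0) : \bar R :=
  ((2 ^ g)%:E * \int[leb]_y (ind [set y | dcell a g x = dcell a g y] y * v y))%E.

Lemma davgE a K k v x : nnm v -> avg (dgrid a K) k v x = davg a (k%:Z - K%:Z) v x.
Proof.
move=> nv; rewrite avgE// /davg; congr (_%:E * _)%E.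
have -> : len (dgrid a K) k = (2 ^ (- (k%:Z - K%:Z)))%R by [].
by rewrite pow2N invrK.
Qed.

End dyadic_grid.

(** * The one-dimensional maximal operator over all generations *)

Section maximal_operator.
Context {R : realType}.
Local Notation T0 := (measurableTypeR R).
Local Notation leb := (@lebesgue_measure R).

(** The [(K + K).+1] levels are the generations from -K to K. *)
Definition dmax (a : bool) (v : T0 -> \bar R) (x : T0) : \bar R :=
  ereal_sup (range (fun K => smax (dgrid a K) (K + K).+1 v x)).

Definition MM (v : T0 -> \bar R) (x : T0) : \bar R := dmax false v x + dmax true v x.

(** Level [k] of the grid started at -K is level [k.+1] of the one started at -(K+1). Monotonicity
    is what allows [nice_sup] to take the supremum out of the norm. *)
Lemma smax_dgrid_nd a (v : T0 -> \bar R) x : nnm v ->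
  {homo (fun K => smax (dgrid a K) (K + K).+1 v x) : K L / (K <= L)%N >-> K <= L}.
Proof.
move=> nv; apply: homo_leq => [//|? ? ?|K]; first exact: le_trans.
apply: smax_le => [|k kK]; first exact: smax_ge0.
rewrite davgE// (_ : k%:Z - K%:Z = k.+1%:Z - K.+1%:Z)%R; last by lia.
rewrite -davgE//; apply: avg_smax.
by lia.
Qed.

Lemma nnm_dmax a v : nnm v -> nnm (dmax a v).
Proof. by move=> nv; apply: nnm_sup => K; exact: nnm_smax. Qed.

Lemma davg_MM a g v x : nnm v -> davg a g v x <= MM v x.
Proof.
move=> nv; have h : davg a g v x <= dmax a v x.
  pose K := `|g|%N.
  have [k kE] : exists k : nat, (k%:Z = g + K%:Z)%R.
    by exists `|(g + K%:Z)%R|%N; rewrite gez0_abs// /K; lia.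
  have e : g = (k%:Z - K%:Z)%R by rewrite kE addrK.
  rewrite e -davgE//; apply: le_trans (le_sup _ K); apply: avg_smax.
  by rewrite /K in kE *; lia.
apply: le_trans h _; rewrite /MM.
by case: a; [rewrite leeDr|rewrite leeDl]; rewrite ?(nnm_ge0 (nnm_dmax _ nv)).
Qed.

Definition pMM T (f : T0 * T -> \bar R) (z : T0 * T) := MM (fun y => f (y, z.2)) z.1.

Section bound.
Context d (T : measurableType d) (rho : (T -> \bar R) -> \bar R).
Hypotheses (H : nice rho) (hl : HL rho).

Let pdmax a (f : T0 * T -> \bar R) (z : T0 * T) := dmax a (fun y => f (y, z.2)) z.1.

Let nnm_pdmax a f : nnm f -> nnm (pdmax a f).
Proof.
by move=> nf; apply: (nnm_sup (fun K => nnm_psmax (dgrid a K) (K + K).+1 nf)).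
Qed.

Lemma nnm_pMM (f : T0 * T -> \bar R) : nnm f -> nnm (pMM f).
Proof. by move=> nf; exact: nnmD (nnm_pdmax false nf) (nnm_pdmax true nf). Qed.

Lemma Lq_pMM (p : R) : (1 < p)%R -> exists2 C : R, (0 < C)%R &
  forall f, nnm f -> Lq leb rho p (pMM f) <= C%:E * Lq leb rho p f.
Proof.
move=> p1; have [K K0 S] := hl p1; have p0 : (0 < p)%R by apply: lt_trans p1.
have HL := nice_Lq leb H p1.
exists (2 * K `^ p^-1)%R; first by rewrite mulr_gt0// powR_gt0.
move=> f nf.
have one a : Lq leb rho p (pdmax a f) <= (K `^ p^-1)%:E * Lq leb rho p f.
  rewrite /pdmax /dmax.
  rewrite (@nice_sup _ _ _ _ HL (fun N => psmax (dgrid a N) (N + N).+1 f)).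
  - apply: sup_le => N /=; rewrite /Lq -poweR_EFin -poweRM ?lee_fin ?(ltW K0)//; last first.
      by apply: int_ge0; exact/nnm_pow/(nice_nnm H).
    apply: le_pow; [by rewrite invr_ge0 ltW| |exact: S].
    by apply: int_ge0; apply: nnm_pow; apply: (nnm_vnorm H); exact: nnm_psmax.
  - by move=> N; exact: nnm_psmax.
  - by move=> z N M; apply: smax_dgrid_nd; exact: nnm_pair2.
apply: le_trans (niceD HL (nnm_pdmax false nf) (nnm_pdmax true nf)) _.
apply: (le_trans (leeD (one _) (one _))).
by rewrite -ge0_muleDl ?lee_fin ?powR_ge0// -EFinD (_ : _ + _ = 2 * K `^ p^-1)%R//; ring.
Qed.

End bound.
End maximal_operator.

(** * Iteration over the coordinates *)

Section euclidean.
Context {R : realType}.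
Local Notation T0 := (measurableTypeR R).
Local Notation leb := (@lebesgue_measure R).

Definition uncons n (x : Rn R n.+1) : T0 * Rn R n := (thead x, [tuple of behead x]).

Lemma consK n (z : T0 * Rn R n) : uncons (cons_point z) = z.
Proof. by case: z => a y; rewrite /uncons theadE; congr pair; exact: val_inj. Qed.

Lemma unconsK n (x : Rn R n.+1) : cons_point (uncons x) = x.
Proof. by apply: val_inj; rewrite /= [in RHS](tuple_eta x). Qed.

Lemma measurable_uncons n : measurable_fun setT (@uncons n).
Proof.
apply/measurable_fun_pairP; split; first exact: measurable_tnth.
exact: measurable_behead.
Qed.

(* The norm in the first coordinate is taken together with the one in [T]: this is
   the step of the inductions on the dimension. *)
Definition shuffle n T (z : Rn R n * (T0 * T)) : Rn R n.+1 * T :=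
  (cons_point (z.2.1, z.1), z.2.2).

Definition unshuffle n T (z : Rn R n.+1 * T) : T0 * (Rn R n * T) :=
  ((uncons z.1).1, ((uncons z.1).2, z.2)).

Lemma measurable_shuffle n d (T : measurableType d) :
  measurable_fun setT (@shuffle n T).
Proof.
apply/measurable_fun_pairP; split => /=; last first.
  exact: (measurableT_comp measurable_snd measurable_snd).
apply: (measurableT_comp (@measurable_cons_point R n)).
apply/measurable_fun_pairP; split => /=; last exact: measurable_fst.
exact: (measurableT_comp measurable_fst measurable_snd).
Qed.

Lemma measurable_unshuffle n d (T : measurableType d) :
  measurable_fun setT (@unshuffle n T).
Proof.
have mu := measurableT_comp (@measurable_uncons n) (@measurable_fst _ _ (Rn R n.+1) T).
apply/measurable_fun_pairP; split; first exact: (measurableT_comp measurable_fst mu).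
apply/measurable_fun_pairP; split; first exact: (measurableT_comp measurable_snd mu).
exact: measurable_snd.
Qed.

(** The mixed norm with values measured by [rho]. The recursion moves the innermost variable into
    the value space, so [T] and [rho] must vary. *)
Fixpoint mnorm n : forall d (T : measurableType d), n.-tuple R ->
    ((T -> \bar R) -> \bar R) -> (Rn R n * T -> \bar R) -> \bar R :=
  match n with
  | 0 => fun d T p rho f => rho (fun t => f ([tuple], t))
  | m.+1 => fun d T p rho f =>
      mnorm [tuple of behead p] (Lq leb rho (thead p)) (fun z => f (shuffle z))
  end.

(** A strong maximal function: [MM] acts in each coordinate with the others as parameters, on the
    first coordinate last. *)
Fixpoint sMM n : forall T : Type, (Rn R n * T -> \bar R) -> Rn R n * T -> \bar R :=
  match n with
  | 0 => fun T f z => f z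
  | m.+1 => fun T f z =>
      pMM (fun w : T0 * (Rn R m * T) =>
        sMM (fun u : Rn R m * (T0 * T) => f (shuffle u)) (w.2.1, (w.1, w.2.2)))
      (unshuffle z)
  end.

Lemma shuffleK n T (z : Rn R n * (T0 * T)) : unshuffle (shuffle z) = (z.2.1, (z.1, z.2.2)).
Proof. by rewrite /unshuffle (_ : (shuffle z).1 = cons_point (z.2.1, z.1))// consK. Qed.

Lemma tnth_beheadP n (p : n.+1.-tuple R) (P : R -> Prop) :
  (forall i, P (tnth p i)) -> P (thead p) /\ forall i, P (tnth [tuple of behead p] i).
Proof.
by move=> h; split=> [|i]; [exact: h|rewrite tnth_behead; exact: h].
Qed.

Lemma nice_mnorm n d (T : measurableType d) (p : n.-tuple R) rho :
  nice rho -> (forall i, 1 < tnth p i)%R -> @nice R _ _ (@mnorm n d T p rho).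
Proof.
elim: n d T p rho => [|n IH] d T p rho H p1.
  apply: (nice_pull (phi := fun t : T => ([tuple] : Rn R 0, t))) H.
  by apply/measurable_fun_pairP; split; [exact: measurable_cst|exact: measurable_id].
have [h1 h2] := tnth_beheadP (P := fun x => 1 < x)%R p1.
apply: (nice_pull (phi := @shuffle n T)); first exact: measurable_shuffle.
by apply: IH => //; exact: nice_Lq.
Qed.

Lemma nnm_pushuffle n d (T : measurableType d) (f : Rn R n * (T0 * T) -> \bar R) :
  nnm f -> nnm (fun w : T0 * (Rn R n * T) => f (w.2.1, (w.1, w.2.2))).
Proof.
move=> nf; apply: (nnm_comp nf); apply/measurable_fun_pairP; split => /=.
  exact: (measurableT_comp measurable_fst measurable_snd).
apply/measurable_fun_pairP; split => /=; first exact: measurable_fst.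
exact: (measurableT_comp measurable_snd measurable_snd).
Qed.

Lemma nnm_shuffle n d (T : measurableType d) (f : Rn R n.+1 * T -> \bar R) :
  nnm f -> nnm (fun u : Rn R n * (T0 * T) => f (shuffle u)).
Proof. by move=> nf; exact: (nnm_comp nf (@measurable_shuffle n d T)). Qed.

Lemma nnm_sMM n d (T : measurableType d) (f : Rn R n * T -> \bar R) : nnm f -> nnm (sMM f).
Proof.
elim: n d T f => [//|n IH] d T f nf.
apply: (@nnm_comp _ _ _ _ _ _ _ _ (@measurable_unshuffle n d T)).
by apply: nnm_pMM; apply: nnm_pushuffle; apply: IH; exact: nnm_shuffle.
Qed.

Lemma mnorm_le n d (T : measurableType d) (p : n.-tuple R) rho (C : R)
    (f g : Rn R n * T -> \bar R) :
  nice rho -> (forall i, 1 < tnth p i)%R -> (0 <= C)%R -> nnm f -> nnm g ->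
  (forall x, rho (fun t => f (x, t)) <= C%:E * rho (fun t => g (x, t))) ->
  mnorm p rho f <= C%:E * mnorm p rho g.
Proof.
elim: n d T p rho f g => [|n IH] d T p rho f g H p1 C0 nf ng h; first exact: h.
have [h1 h2] := tnth_beheadP (P := fun x => 1 < x)%R p1.
have h0 : (0 < thead p)%R by apply: lt_trans h1.
apply: IH => //; [exact: nice_Lq|exact: nnm_shuffle|exact: nnm_shuffle|].
move=> y; rewrite /Lq.
have nq u : nnm u -> nnm (fun a => rho (fun t => u (shuffle (y, (a, t)))) `^ thead p).
  move=> nu; apply: nnm_pow; apply: (nice_nnm H (f := fun z => u (shuffle (y, z)))).
  exact: nnm_pair1 (nnm_shuffle nu).
rewrite -[C%:E](@powK _ _ (thead p)) ?lee_fin ?gt_eqF// -poweRM ?poweR_ge0//; last first.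
  exact: int_ge0 (nq g ng).
apply: le_pow; [by rewrite invr_ge0 ltW|exact: int_ge0 (nq f nf)|].
rewrite -intZ ?poweR_ge0//; last exact: nq.
apply: le_int => [||a]; [exact: nq|by apply: nnmZ (nq g ng); exact: poweR_ge0|].
rewrite -poweRM ?lee_fin//; last exact: (nice_ge0 H).
by apply: le_pow; [exact: ltW|exact: (nice_ge0 H)|exact: (h (cons_point (a, y)))].
Qed.

(** The operator in the later coordinates acts on functions with values in [Lq leb rho], so [HL_Lq]
    is needed at every step. The operator in the first coordinate is then bounded for each fixed
    value of the others. *)
Lemma mnorm_sMM n d (T : measurableType d) (p : n.-tuple R) rho :
  nice rho -> HL rho -> (forall i, 1 < tnth p i)%R ->
  exists2 C : R, (0 < C)%R &
    forall f, nnm f -> mnorm p rho (@sMM n T f) <= C%:E * mnorm p rho f.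
Proof.
elim: n d T p rho => [|n IH] d T p rho H hl p1.
  by exists 1%R => // f nf; rewrite mul1e.
have [h1 h2] := tnth_beheadP (P := fun x => 1 < x)%R p1.
have HLq := nice_Lq leb H h1.
have [C C0 hC] := IH _ _ [tuple of behead p] _ HLq (HL_Lq leb H h1 hl) h2.
have [D D0 hD] := Lq_pMM H hl h1.
exists (D * C)%R; first exact: mulr_gt0.
move=> f nf; have nf' := nnm_shuffle nf.
apply: (@le_trans _ _ (D%:E * mnorm [tuple of behead p] (Lq leb rho (thead p))
    (sMM (fun u => f (shuffle u))))).
  apply: (@mnorm_le _ _ _ [tuple of behead p] (Lq leb rho (thead p)) D
    (fun z => sMM f (shuffle z))) => //; [exact: ltW|exact: nnm_shuffle (nnm_sMM nf)|exact: nnm_sMM|].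
  move=> y.
  rewrite (_ : (fun t => sMM f (shuffle (y, t))) =
     pMM (fun z : T0 * T => sMM (fun u => f (shuffle u)) (y, z))); last first.
    by apply/funext => -[a t] /=; rewrite shuffleK /= /pMM.
  by apply: hD; exact: nnm_pair1 (nnm_sMM nf').
by rewrite EFinM -muleA lee_wpmul2l ?lee_fin ?(ltW D0)//; exact: hC.
Qed.

End euclidean.

(** * Integrals of functions that are not Borel measurable *)

Section nonmeasurable.
Context {R : realType} d (T : measurableType d) (mu : {measure set T -> \bar R}).
Implicit Types f g : T -> \bar R.

Lemma le_int_nm f g : (forall x, 0 <= f x) -> (forall x, f x <= g x) ->
  \int[mu]_x f x <= \int[mu]_x g x.
Proof.
move=> f0 fg; have g0 x : 0 <= g x by exact: le_trans (fg x).
rewrite !ge0_integralTE//; apply: ereal_sup_le => _ [h hf <-].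
by exists h => // x; exact: le_trans (fg x).
Qed.

(** Lebesgue measurable functions need not be Borel. The integral of [f] is squeezed between those
    of [g] set to 0 and of [g] set to +oo on a null set. *)
Lemma int_ae_nm f g : (forall x, 0 <= f x) -> nnm g ->
  (\forall x \ae mu, f x = g x) -> \int[mu]_x f x = \int[mu]_x g x.
Proof.
move=> f0 ng [N [mN N0 sub]]; have g0 := nnm_ge0 ng.
have mC := measurableC mN.
have aeN (h k : T -> \bar R) : (forall x, ~ N x -> h x = k x) -> \forall x \ae mu, h x = k x.
  by move=> hk; exists N; split => // x /=; apply: contra_notP => /hk.
have fgE x : ~ N x -> f x = g x.
  by apply: contra_notP => h; apply: sub.
have n1 : nnm (fun x => g x * ind (~` N) x) by apply: nnmM => //; exact: nnm_ind.
have n2 : nnm (fun x => g x + +oo * ind N x).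
  by apply: nnmD => //; apply: nnmZ => //; exact: nnm_ind.
apply/eqP; rewrite eq_le; apply/andP; split.
  apply: (@le_trans _ _ (\int[mu]_x (g x + +oo * ind N x))).
    apply: le_int_nm => // x; have [Nx|Nx] := pselect (N x).
      by rewrite ind1// mule1 addey ?leey// gt_eqF// (lt_le_trans _ (g0 x))// ltNy0.
    by rewrite ind0// mule0 adde0 fgE.
  rewrite (@int_ae _ _ _ mu _ g)//; apply: aeN => x Nx.
  by rewrite ind0// mule0 adde0.
apply: (@le_trans _ _ (\int[mu]_x (g x * ind (~` N) x))).
  rewrite (@int_ae _ _ _ mu _ (fun x => g x * ind (~` N) x))//; apply: aeN => x Nx.
  by rewrite ind1// mule1.
apply: le_int_nm => x; first by rewrite mule_ge0// ind_ge0.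
have [Nx|Nx] := pselect (N x); first by rewrite ind0 ?mule0//; exact.
by rewrite ind1// mule1 fgE.
Qed.

End nonmeasurable.

(** * Tonelli on R^n, boxes, and the geometry of the one-third trick *)

Section lebesgue_Rn_theory.
Context {R : realType}.
Local Notation T0 := (measurableTypeR R).
Local Notation leb := (@lebesgue_measure R).

Lemma nnm_cons n (F : Rn R n.+1 -> \bar R) : nnm F -> nnm (fun z => F (cons_point z)).
Proof. by move=> nF; exact: nnm_comp nF (@measurable_cons_point R n). Qed.

Lemma int_cons n (F : Rn R n.+1 -> \bar R) : nnm F ->
  \int[lebesgue_Rn R n.+1]_x F x = \int[lebesgue_Rn R n]_y \int[leb]_a F (cons_point (a, y)).
Proof.
move=> nF; have nFc := nnm_cons nF.
transitivity (\int[leb \x lebesgue_Rn R n]_z F (cons_point z)).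
  rewrite -[RHS](@ge0_integral_pushforward _ _ _ _ _ (@cons_point R n)
    (@measurable_cons_point R n) (leb \x lebesgue_Rn R n) setT F)//; last 2 first.
    exact: nnm_m.
    by move=> x _; exact: (nnm_ge0 nF).
by rewrite (fubini_tonelli2 (fun z => F (cons_point z)) (nnm_m nFc) (nnm_ge0 nFc)).
Qed.

Lemma int_cons' n (F : Rn R n.+1 -> \bar R) : nnm F ->
  \int[lebesgue_Rn R n.+1]_x F x = \int[leb]_a \int[lebesgue_Rn R n]_y F (cons_point (a, y)).
Proof.
move=> nF; rewrite int_cons//.
exact: (esym (tonelli leb (lebesgue_Rn R n) (nnm_cons nF))).
Qed.

Lemma int_Rn0 (F : Rn R 0 -> \bar R) : nnm F -> \int[lebesgue_Rn R 0]_x F x = F [tuple].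
Proof. by move=> [mF F0]; rewrite integral_dirac// diracT mul1e. Qed.

Lemma ae_cons n (P : Rn R n.+1 -> Prop) : (\forall x \ae lebesgue_Rn R n.+1, P x) ->
  \forall y \ae lebesgue_Rn R n, \forall a \ae leb, P (cons_point (a, y)).
Proof.
move=> [N [mN N0 sub]]; have nN : @nnm R _ _ (ind N) by exact: nnm_ind.
have : \int[lebesgue_Rn R n]_y \int[leb]_a ind N (cons_point (a, y)) = 0.
  by rewrite -int_cons// int_ind.
move/(int0_ae (nnm_int1 leb (nnm_cons nN))); apply: filterS => y.
have mNy : measurable [set a | N (cons_point (a, y))].
  rewrite -[X in measurable X]setTI.
  exact: (measurableT_comp (@measurable_cons_point R n) (pair2_measurable y)).
move=> h; exists [set a | N (cons_point (a, y))]; split => //.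
- by rewrite -int_ind// -h; apply: eq_integral.
- by move=> a /= Pa; apply: sub.
Qed.

Lemma tnth_cons0 n (a : T0) (y : Rn R n) : tnth (cons_point (a, y)) ord0 = a.
Proof. exact: tnth0. Qed.

Lemma tnth_consS n (a : T0) (y : Rn R n) i :
  tnth (cons_point (a, y)) (lift ord0 i) = tnth y i.
Proof. exact: tnthS. Qed.

Definition box n (A : 'I_n -> set T0) : set (Rn R n) := [set x | forall i, A i (tnth x i)].

Lemma box_cons n (A : 'I_n.+1 -> set T0) a y :
  box A (cons_point (a, y)) <-> A ord0 a /\ box (fun i => A (lift ord0 i)) y.
Proof.
split=> [h|[h1 h2] i].
  split; first by have := h ord0; rewrite tnth_cons0.
  by move=> i; have := h (lift ord0 i); rewrite tnth_consS.
by case: (unliftP ord0 i) => [j ->|->]; rewrite ?tnth_consS ?tnth_cons0//; exact: h2.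
Qed.

Lemma ind_box_cons n (A : 'I_n.+1 -> set T0) a y :
  ind (box A) (cons_point (a, y)) =
  ind (A ord0) a * ind (box (fun i => A (lift ord0 i))) y :> \bar R.
Proof.
have [h|h] := pselect (box A (cons_point (a, y))).
  by have [h1 h2] := (box_cons _ _ _).1 h; rewrite !ind1// mul1e.
rewrite (ind0 h); have [h1|h1] := pselect (A ord0 a); last by rewrite (ind0 h1) mul0e.
rewrite [X in _ * X]ind0 ?mule0// => h2; exact/h/box_cons.
Qed.

Lemma measurable_box n (A : 'I_n -> set T0) : (forall i, measurable (A i)) -> measurable (box A).
Proof.
move=> mA; rewrite (_ : box A = \bigcap_(i in [set: 'I_n]) ((fun x => tnth x i) @^-1` A i)).
  apply: fin_bigcap_measurable => // i _.
  by rewrite -[X in measurable X]setTI; exact: measurable_tnth.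
by apply/seteqP; split => x h i; [move=> _; exact: h|exact: (h i I)].
Qed.

Lemma vol_box n (A : 'I_n -> set T0) : (forall i, measurable (A i)) ->
  lebesgue_Rn R n (box A) = \prod_(i < n) leb (A i).
Proof.
elim: n A => [|n IH] A mA; rewrite -int_ind; do ?exact: measurable_box.
  rewrite int_Rn0; last by apply: nnm_ind; exact: measurable_box.
  by rewrite ind1 ?big_ord0// => -[].
rewrite int_cons'; last by apply: nnm_ind; exact: measurable_box.
under eq_integral => a _.
  under eq_integral do rewrite ind_box_cons.
  rewrite intZ ?ind_ge0//; last by apply: nnm_ind; apply: measurable_box => i; exact: mA.
  rewrite (etrans (int_ind _ (measurable_box (fun i => mA (lift ord0 i))))
    (IH _ (fun i => mA (lift ord0 i)))).
  rewrite muleC.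
  over.
rewrite intZ; [|by apply: prode_ge0 => i _; exact: measure_ge0|exact: nnm_ind].
by rewrite int_ind// big_ord_recl muleC.
Qed.

(** Peel off one coordinate at a time with [davg_MM]. The grid [al i] may differ between coordinates
    since [MM] dominates both. *)
Lemma sMM_box n d (T : measurableType d) (f : Rn R n * T -> \bar R) (al : 'I_n -> bool)
    (g : int) x t : nnm f ->
  ((2 ^ g) ^+ n)%:E * \int[lebesgue_Rn R n]_y
    (ind (box (fun i => [set b | dcell (al i) g (tnth x i) = dcell (al i) g b])) y * f (y, t))
  <= sMM f (x, t).
Proof.
elim: n d T f al x t => [|n IH] d T f al x t nf.
  rewrite expr0 mul1e int_Rn0; last first.
    by apply: nnmM (nnm_pair2 t nf); apply: nnm_ind; apply: measurable_box => -[].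
  rewrite (_ : x = [tuple])/=; last exact: tuple0.
  by rewrite ind1 ?mul1e// => -[].
have nf' := nnm_shuffle nf.
rewrite -(unconsK x); case: (uncons x) => b z {x}.
set A := (fun i => [set b0 | dcell (al i) g (tnth (cons_point (b, z)) i) = dcell (al i) g b0]).
have mA i : measurable (A i).
  rewrite /A (_ : [set _ | _] = [set a | dcell (al i) g a = dcell (al i) g (tnth (cons_point (b, z)) i)]).
    exact: dcell_meas.
  by apply/seteqP; split => a /= /esym.
have nB : nnm (fun y => ind (box A) y * f (y, t)).
  by apply: nnmM (nnm_pair2 t nf); by apply: nnm_ind; exact: measurable_box.
rewrite int_cons'//.
pose h := fun w : T0 * (Rn R n * T) => sMM (fun u => f (shuffle u)) (w.2.1, (w.1, w.2.2)).
have nh : nnm h by exact/nnm_pushuffle/nnm_sMM.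
rewrite [leRHS](_ : _ = MM (fun a => h (a, (z, t))) b); last first.
  rewrite -[(cons_point (b, z), t)]/(shuffle (z, (b, t))).
  by rewrite [LHS]/= shuffleK.
apply: le_trans (davg_MM (al ord0) g b (nnm_pair2 (z, t) nh)).
rewrite exprS EFinM -muleA /davg lee_wpmul2l ?lee_fin ?(ltW (pow2_gt0 g))//.
have p0 : 0 <= ((2 ^ g) ^+ n)%:E :> \bar R by rewrite lee_fin exprn_ge0// ltW// pow2_gt0.
have nB' : nnm (fun a => \int[lebesgue_Rn R n]_y (ind (box A) (cons_point (a, y)) * f (cons_point (a, y), t))).
  exact: (nnm_int2 (lebesgue_Rn R n) (nnm_cons nB)).
have m0 : measurable [set y : T0 | dcell (al ord0) g b = dcell (al ord0) g y].
  rewrite (_ : [set y : T0 | _] = A ord0); first exact: mA.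
  by rewrite /A tnth_cons0.
rewrite -intZ//; apply: le_int.
- exact: nnmZ.
- by apply: nnmM; [exact: nnm_ind|exact: nnm_pair2].
- move=> a; under eq_integral do rewrite ind_box_cons -muleA.
  rewrite intZ ?ind_ge0//; last first.
    apply: nnmM; first by apply: nnm_ind; apply: measurable_box => i; exact: mA.
    exact: (nnm_pair1 a (nnm_cons (nnm_pair2 t nf))).
  rewrite muleCA /A tnth_cons0 lee_wpmul2l ?ind_ge0//.
  have := IH _ _ (fun u => f (shuffle u)) (fun i => al (lift ord0 i)) z (a, t) nf'.
  apply: le_trans; rewrite le_eqVlt; apply/orP; left; apply/eqP; congr (_ * _).
  apply: eq_integral => y _; congr (ind _ _ * _).
  by congr box; apply/funext => i; rewrite tnth_consS.
Qed.

Lemma third_shift (lo hi : R) (g : int) : (2 ^ g * (hi - lo) < 3^-1)%R ->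
  exists a : bool, forall x y : T0, (lo <= x <= hi)%R -> (lo <= y <= hi)%R ->
    dcell a g x = dcell a g y.
Proof.
move=> h; have p0 := @pow2_gt0 R g.
suff [a [m H]] : exists (a : bool) (m : int), forall w, (2 ^ g * lo <= w <= 2 ^ g * hi)%R ->
    (m%:~R <= w + shift a g < m%:~R + 1)%R.
  exists a => x y /andP[x1 x2] /andP[y1 y2]; rewrite /dcell.
  by transitivity m; [|apply: esym]; apply/floor_eqP; apply: H; rewrite !ler_pM2l// ?x1 ?y1.
have {}h : (2 ^ g * hi - 2 ^ g * lo < 3^-1)%R by rewrite -mulrBr.
set L := (2 ^ g * lo)%R in h *; set U := (2 ^ g * hi)%R in h *.
set m := Num.floor U.
have /floor_eqP /andP[m1 m2] : Num.floor U = m by [].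
have s0 : shift false g = 0%R :> R by rewrite /shift !mul0r.
(* In units of the cell length, either no integer lies in (L, U] and the unshifted grid serves, or
   [m] does. In the latter case the interval is within 1/3 of [m], and a shift by 1/3 in either
   direction moves it off the integers. *)
have [Lm|Lm] := leP (m%:~R)%R L.
  by exists false, m => w /andP[w1 w2]; rewrite s0 addr0; apply/andP; split; lra.
have [s1|s1] : shift true g = 3^-1%R :> R \/ shift true g = (- 3^-1)%R :> R.
  rewrite /shift mul1r.
  have [->|->] : ((-1) ^ g = 1 :> R \/ (-1) ^ g = -1 :> R)%R.
    case: (g) => k; rewrite /exprz ?invr_sign -signr_odd; case: odd; rewrite ?expr0 ?expr1;
      by [left|right].
  - by left; rewrite mul1r.
  - by right; rewrite mulN1r.
- by exists true, m => w /andP[w1 w2]; rewrite s1; apply/andP; split; lra.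
- exists true, (m - 1)%R => w /andP[w1 w2]; rewrite s1 intrD; apply/andP; split; lra.
Qed.

(** The lower bound 6r makes an interval of length 2r shorter than a third of a cell; the upper
    bound 12r controls the loss in volume. *)
Lemma scale_choice (r : R) : (0 < r)%R -> exists g : int, (6 * r < 2 ^ (- g) <= 12 * r)%R.
Proof.
move=> r0; have [k hk] : exists k : nat, (6 * r < 2 ^+ k)%R.
  exists (Num.bound (6 * r)); apply: lt_trans (archi_boundP _) _; first by rewrite mulr_ge0// ltW.
  by rewrite -natrX ltr_nat ltn_expl.
have [l hl] : exists l : nat, ((6 * r)^-1 <= 2 ^+ l)%R.
  exists (Num.bound (6 * r)^-1); apply: le_trans (ltW (archi_boundP _)) _.
    by rewrite invr_ge0 mulr_ge0// ltW.
  by rewrite -natrX ler_nat ltnW// ltn_expl.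
have e (i : nat) : (2 ^ (- (i%:Z - k%:Z)) = 2 ^+ k / 2 ^+ i :> R)%R.
  by rewrite opprB exprzDr ?unitfE// -exprnN.
have ex : exists i : nat, ~~ (6 * r < 2 ^+ k / 2 ^+ i)%R.
  exists (k + l)%N; rewrite exprD invfM mulrA divff ?expf_neq0// mul1r -leNgt.
  by rewrite -[leRHS]invrK lef_pV2 ?posrE ?invr_gt0 ?mulr_gt0// exprn_gt0.
have := ex_minnP ex => -[[|i] hi mi].
  by rewrite expr0 divr1 hk in hi.
exists (i%:Z - k%:Z)%R; rewrite e.
have -> : (6 * r < 2 ^+ k / 2 ^+ i)%R by have := mi i; rewrite ltnn; case: (_ < _)%R => // /(_ isT).
move: hi; rewrite -leNgt exprS invfM mulrCA => hi /=.
lra.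
Qed.

Lemma ball_box n (c x : Rn R n) (r : R) (i : 'I_n) : (0 < r)%R -> euclidean_ball c r x ->
  (tnth c i - r <= (tnth x i : R) <= tnth c i + r)%R.
Proof.
move=> r0 h; have : (((tnth x i : R) - tnth c i) ^+ 2 < r ^+ 2)%R.
  apply: le_lt_trans h; rewrite (bigD1 i)//= lerDl.
  by apply: sumr_ge0 => j _; exact: sqr_ge0.
rewrite -real_normK ?num_real// ltr_sqr ?nnegrE ?(ltW r0)// ltr_distl => /andP[h1 h2].
by rewrite !ltW.
Qed.

(** Since n / (n+1)^2 < 1. The divisor n+1 in place of the square root of n also covers n = 0. *)
Lemma box_ball n (c x : Rn R n) (r : R) : (0 < r)%R ->
  (forall i, tnth c i - r / n.+1%:R <= (tnth x i : R) < tnth c i + r / n.+1%:R)%R ->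
  euclidean_ball c r x.
Proof.
move=> r0 h; rewrite /euclidean_ball /=.
apply: (@le_lt_trans _ _ (\sum_(i < n) (r / n.+1%:R) ^+ 2)%R).
  apply: ler_sum => i _; rewrite -real_normK ?num_real// ler_sqr ?nnegrE ?divr_ge0 ?(ltW r0)//.
  by have /andP[h1 h2] := h i; rewrite ler_distl h1 ltW.
rewrite sumr_const card_ord -[X in (X < _)%R]mulr_natl expr_div_n mulrCA -[ltRHS]mulr1.
rewrite ltr_pM2l ?exprn_gt0// ltr_pdivrMr ?exprn_gt0// mul1r -natrX ltr_nat.
by rewrite expnS expn1 mulSn addSn ltnS leq_addr.
Qed.

End lebesgue_Rn_theory.

(** * Dyadic cubes and measurability of open sets *)

Section dyadic_cubes.
Context {R : realType} (n : nat).
Local Notation T0 := (measurableTypeR R).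
Local Notation leb := (@lebesgue_measure R).
Local Notation mu := (lebesgue_Rn R n).
Implicit Types (x : Rn R n) (jk : dyadic_index n).

Definition cube_at (j : int) x : dyadic_index n :=
  (j, [tuple dcell false j (tnth x i) | i < n]).

Lemma shift_false (g : int) : shift false g = 0%R :> R.
Proof. by rewrite /shift !mul0r. Qed.

Lemma dyadic_cube_box jk : dyadic_cube jk =
  box (fun i => [set b : T0 | dcell false jk.1 b = tnth jk.2 i]).
Proof.
apply/seteqP; split => x h i; have := h i; rewrite ?dcellE /= in_itv/= shift_false !subr0//.
Qed.

Lemma dyadic_cubeP jk x : dyadic_cube jk x <-> jk = cube_at jk.1 x.
Proof.
rewrite dyadic_cube_box; case: jk => j k /=; split=> [h|[->] i].
  by congr pair; apply: eq_from_tnth => i; rewrite tnth_mktuple -h.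
by rewrite /= tnth_mktuple.
Qed.

Lemma cube_atP j x : dyadic_cube (cube_at j x) x.
Proof. exact/dyadic_cubeP. Qed.

Lemma measurable_dyadic_cube jk : measurable (dyadic_cube jk : set (Rn R n)).
Proof. by rewrite dyadic_cube_box; apply: measurable_box => i; exact: dcell_meas. Qed.

Lemma vol_dyadic_cube jk : mu (dyadic_cube jk) = ((2 ^ (- jk.1)) ^+ n)%R%:E.
Proof.
rewrite dyadic_cube_box vol_box; last by move=> i; exact: dcell_meas.
under eq_bigr do rewrite dcell_vol.
by rewrite prodEFin prodr_const card_ord.
Qed.

(** Openness in terms of the balls of the maximal operator, tied to the product sigma-algebra by
    covering with countably many dyadic cubes. *)
Definition Eopen (U : set (Rn R n)) := forall x, U x ->
  exists c r, [/\ (0 < r)%R, euclidean_ball c r x & euclidean_ball c r `<=` U].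

Lemma cube_in_ball c x (r : R) : (0 < r)%R -> euclidean_ball c r x ->
  exists j, dyadic_cube (cube_at j x) `<=` (euclidean_ball c r : set (Rn R n)).
Proof.
move=> r0 h.
pose S := (\sum_(i < n) `|(tnth x i : R) - tnth c i|)%R.
pose D := (r ^+ 2 - \sum_(i < n) ((tnth x i : R) - tnth c i) ^+ 2)%R.
have D0 : (0 < D)%R by rewrite subr_gt0.
have S0 : (0 <= S)%R by apply: sumr_ge0.
(* Moving [x] by at most 2^(-k) in each coordinate raises the squared distance to [c] by at most
   2^(-k) * (2 S + n), to be kept below the margin [D]; the 1 makes [A] positive. *)
pose A := (2 * S + n%:R + 1)%R.
have A0 : (0 < A)%R by rewrite ltr_wpDl// addr_ge0// mulr_ge0.
have [k hk] : exists k : nat, (A / D < 2 ^+ k)%R.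
  exists (Num.bound (A / D)); apply: lt_trans (archi_boundP _) _; first by rewrite divr_ge0// ltW.
  by rewrite -natrX ltr_nat ltn_expl.
exists k%:Z => y /dyadic_cubeP e.
have hh (i : 'I_n) : (`|(tnth y i : R) - tnth x i| <= 2 ^- k)%R.
  have := congr1 (fun t : dyadic_index n => tnth t.2 i) e; rewrite !tnth_mktuple => ei.
  have p0 : (0 < 2 ^+ k :> R)%R by rewrite exprn_gt0.
  have := floor_eqP (2 ^ k%:Z * (tnth y i : R) + shift false k%:Z) _.
  move=> /(_ _)/iffLR/(_ (esym ei)).
  have /floor_eqP := erefl (dcell false k%:Z (tnth x i)).
  rewrite !shift_false !addr0 -!exprnP => /andP[a1 a2] /andP[b1 b2].
  rewrite -(ler_pM2l p0) divff ?gt_eqF//.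
  rewrite -[X in (X * _)%R](gtr0_norm p0) -normrM mulrBr ler_norml; apply/andP; split; lra.
rewrite /euclidean_ball /=.
have k0 : (0 < 2 ^- k :> R)%R by rewrite invr_gt0 exprn_gt0.
have k1 : (2 ^- k <= 1 :> R)%R by rewrite invf_le1 ?exprn_gt0// exprn_ege1// ler1n.
apply: (@le_lt_trans _ _ (\sum_(i < n) (((tnth x i : R) - tnth c i) ^+ 2 +
    (2 * 2 ^- k * `|(tnth x i : R) - tnth c i| + 2 ^- k))))%R.
  apply: ler_sum => i _.
  have -> : ((tnth y i : R) - tnth c i = ((tnth y i : R) - tnth x i) + ((tnth x i : R) - tnth c i))%R.
    by rewrite addrA subrK.
  have := hh i; set u := (_ - _)%R; set w := (_ - _)%R => hu.
  rewrite sqrrD [leLHS]addrC addrA [leLHS]addrAC -addrA lerD2l.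
  apply: lerD; last first.
    rewrite -real_normK ?num_real// expr2; apply: le_trans (ler_pM _ _ hu hu) _ => //.
    by rewrite ler_piMr// ltW.
  rewrite -mulr_natl -mulrA; apply: le_trans (ler_norm _) _.
  rewrite normrM ger0_norm// ler_wpM2l// normrM ler_wpM2r//.
rewrite big_split/= -ltrBrDl -/D big_split/= -mulr_sumr -/S sumr_const card_ord.
apply: (@le_lt_trans _ _ (2 ^- k * A)%R).
  by rewrite /A -[(2 ^- k *+ n)%R]mulr_natr !mulrDr; have := mulr_ge0 (ltW k0) (ler0n R 1); lra.
by rewrite mulrC ltr_pdivrMr ?exprn_gt0// mulrC -ltr_pdivrMr.
Qed.

Lemma measurable_Eopen U : Eopen U -> measurable U.
Proof.
move=> oU; rewrite (_ : U = \bigcup_(jk in [set jk | dyadic_cube jk `<=` U]) dyadic_cube jk).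
  rewrite bigcup_mkcond; apply: countable_bigcupT_measurable => [|jk]; first exact: countableP.
  by case: ifP => // _; exact: measurable_dyadic_cube.
apply/seteqP; split => [x Ux|x [jk h] /h //].
have [c [r [r0 Bx BU]]] := oU x Ux; have [j hj] := cube_in_ball r0 Bx.
by exists (cube_at j x); [exact: subset_trans BU|exact: cube_atP].
Qed.

Lemma measurable_eball c (r : R) : (0 < r)%R -> measurable (euclidean_ball c r : set (Rn R n)).
Proof. by move=> r0; apply: measurable_Eopen => x Bx; exists c, r; split. Qed.

End dyadic_cubes.

(** * Ball averages against the strong maximal function *)

Section ball_domination.
Context {R : realType} (n : nat).
Local Notation T0 := (measurableTypeR R).
Local Notation leb := (@lebesgue_measure R).
Local Notation mu := (lebesgue_Rn R n).

Lemma vol_eball c (r : R) : (0 < r)%R ->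
  ((2 * (r / n.+1%:R)) ^+ n)%:E <= mu (euclidean_ball c r : set (Rn R n)).
Proof.
move=> r0; have d0 : (0 < r / n.+1%:R)%R by rewrite divr_gt0.
pose A (i : 'I_n) : set T0 := [set` `[(tnth c i - r / n.+1%:R)%R, (tnth c i + r / n.+1%:R)%R[ ].
have mA i : measurable (A i) by exact: measurable_itv.
have -> : ((2 * (r / n.+1%:R)) ^+ n)%:E = mu (box A).
  rewrite vol_box// -[LHS](_ : \prod_(i < n) (2 * (r / n.+1%:R))%:E = _); last first.
    by rewrite prodEFin prodr_const card_ord.
  apply: eq_bigr => i _; rewrite /A.
  rewrite lebesgue_measure_itv /= lte_fin ltrBlDr -addrA ltrDl addr_gt0//.
  by rewrite -EFinB; congr (_%:E); ring.
apply: le_measure; rewrite ?inE; [exact: measurable_box|exact: measurable_eball|].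
by move=> x h; apply: box_ball => // i; have := h i; rewrite /A /= in_itv.
Qed.

(** Ratio of volumes of a box of side 12r and the cube of side 2r/(n+1) inside the ball. *)
Definition hl_const : R := ((6 * n.+1%:R) ^+ n)%R.

Lemma hl_const_gt0 : (0 < hl_const)%R. Proof. by rewrite exprn_gt0// mulr_gt0. Qed.

Lemma ball_avg_sMM d (T : measurableType d) (f : Rn R n * T -> \bar R) (c x : Rn R n) (r : R) t :
  nnm f -> (0 < r)%R -> euclidean_ball c r x ->
  (mu (euclidean_ball c r))^-1 * \int[mu]_(y in euclidean_ball c r) f (y, t) <=
  hl_const%:E * sMM f (x, t).
Proof.
move=> nf r0 Bx; have [g /andP[g1 g2]] := scale_choice r0.
have p0 := @pow2_gt0 R g.
(* Each coordinate projection of the ball selects its own grid, at a generation common to all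
   coordinates. *)
have choose (i : 'I_n) : exists a : bool, forall u v : T0,
    (tnth c i - r <= (u : R) <= tnth c i + r)%R -> (tnth c i - r <= (v : R) <= tnth c i + r)%R ->
    dcell a g u = dcell a g v.
  apply: third_shift; rewrite -(@ltr_pM2l _ (2 ^ (- g))%R) ?pow2_gt0//.
  rewrite mulrA pow2N mulVf ?gt_eqF// mul1r -pow2N; lra.
have [al hal] := choice choose.
pose A (i : 'I_n) := [set b : T0 | dcell (al i) g (tnth x i) = dcell (al i) g b].
have sub : euclidean_ball c r `<=` box A.
  by move=> y By i; apply: hal; exact: ball_box.
have mA : measurable (box A).
  apply: measurable_box => i.
  rewrite (_ : A i = [set b : T0 | dcell (al i) g b = dcell (al i) g (tnth x i)]).
    exact: dcell_meas.
  by apply/seteqP; split => b /= /esym.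
have mB := measurable_eball c r0.
have nft := nnm_pair2 t nf.
apply: (@le_trans _ _ ((hl_const * (2 ^ g) ^+ n)%:E * \int[mu]_y (ind (box A) y * f (y, t)))).
  apply: lee_pmul.
  - by rewrite inve_ge0 measure_ge0.
  - by apply: integral_ge0 => y _; exact: (nnm_ge0 nft).
  - have vpos : (0 < (2 * (r / n.+1%:R)) ^+ n)%R by rewrite exprn_gt0// !mulr_gt0// invr_gt0.
    apply: (@le_trans _ _ (((2 * (r / n.+1%:R)) ^+ n)%:E)^-1).
      rewrite lee_pV2 ?vol_eball// ?inE ?lte_fin//.
      by rewrite lee_fin ltW.
    rewrite inver gt_eqF// lee_fin -exprVn /hl_const -exprMn.
    apply: lerXn2r => //; rewrite ?nnegrE ?invr_ge0 ?mulr_ge0// ?(ltW r0) ?(ltW p0)//.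
    have n0 : (0 < n.+1%:R :> R)%R by rewrite ltr0n.
    have h12 : (1 <= 12 * r * 2 ^ g)%R.
      by rewrite mulrC -ler_pdivrMl// mulr1 -pow2N.
    rewrite -[leLHS]mul1r ler_pdivrMr ?mulr_gt0 ?invr_gt0//.
    have e (N G : R) : (N != 0 -> 6 * N * G * (2 * (r / N)) = 12 * r * G)%R by move=> N0; field.
    by rewrite e// gt_eqF.
  - rewrite int_indic//; apply: le_int => [||y].
    + by apply: nnmM nft; exact: nnm_indic.
    + by apply: nnmM nft; exact: nnm_ind.
    + rewrite lee_wpmul2r ?(nnm_ge0 nft)//; have [By|By] := pselect (euclidean_ball c r y).
        by rewrite (ind1 (sub y By)); exact: ind_le1.
      by rewrite (_ : (\1_ _ y)%:E = 0) ?ind_ge0//; exact: ind0.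
rewrite EFinM -muleA lee_wpmul2l ?lee_fin ?(ltW hl_const_gt0)//.
exact: sMM_box.
Qed.

End ball_domination.

(** * The Hardy-Littlewood maximal function of nonnegative functions *)

Section maximal_function.
Context {R : realType} (n : nat).
Local Notation T0 := (measurableTypeR R).
Local Notation mu := (lebesgue_Rn R n).
Implicit Types (phi psi : Rn R n -> \bar R) (x : Rn R n).

Definition hlm phi x : \bar R :=
  ereal_sup [set (mu B)^-1 * \int[mu]_(y in B) phi y |
             B in [set B | B x /\ exists c r, (0 < r)%R /\ B = euclidean_ball c r]].

Lemma hl_maximalE (f : Rn R n -> R[i]) : hl_maximal f = hlm (fun y => modulus (f y)).
Proof. by []. Qed.

Lemma hlm_leP phi x (c : \bar R) :
  (forall a r, (0 < r)%R -> euclidean_ball a r x ->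
    (mu (euclidean_ball a r))^-1 * \int[mu]_(y in euclidean_ball a r) phi y <= c) ->
  hlm phi x <= c.
Proof. by move=> h; apply: ge_ereal_sup => _ [B [Bx [a [r [r0 e]]]] <-]; subst B; exact: h. Qed.

Lemma le_hlm phi x a (r : R) : (0 < r)%R -> euclidean_ball a r x ->
  (mu (euclidean_ball a r))^-1 * \int[mu]_(y in euclidean_ball a r) phi y <= hlm phi x.
Proof. by move=> r0 Bx; apply: ereal_sup_ubound; exists (euclidean_ball a r) => //; split => //; exists a, r. Qed.

Lemma int_eball_ae phi psi a (r : R) : (0 < r)%R -> (forall x, 0 <= phi x) -> nnm psi ->
  (\forall x \ae mu, phi x = psi x) ->
  \int[mu]_(y in euclidean_ball a r) phi y = \int[mu]_(y in euclidean_ball a r) psi y.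
Proof.
move=> r0 p0 np h; have mB := measurable_eball a r0.
rewrite (int_indic mu phi mB) (int_indic mu psi mB); apply: int_ae_nm.
- by move=> x; rewrite mule_ge0// lee_fin.
- by apply: nnmM np; exact: nnm_indic.
- by apply: filterS h => x ->.
Qed.

Lemma hlm_ae phi psi : (forall x, 0 <= phi x) -> nnm psi ->
  (\forall x \ae mu, phi x = psi x) -> hlm phi = hlm psi.
Proof.
move=> p0 np h; apply/funext => x; apply/eqP; rewrite eq_le; apply/andP; split;
  apply: hlm_leP => a r r0 Bx; [rewrite (int_eball_ae a r0 p0 np h)|
  rewrite -(int_eball_ae a r0 p0 np h)]; exact: le_hlm.
Qed.

Lemma le_hlm_ae phi psi x : nnm phi -> nnm psi ->
  (\forall x \ae mu, phi x <= psi x) -> hlm phi x <= hlm psi x.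
Proof.
move=> n1 n2 h; apply: hlm_leP => a r r0 Bx; apply: le_trans (le_hlm psi r0 Bx).
have mB := measurable_eball a r0.
rewrite lee_wpmul2l ?inve_ge0 ?measure_ge0// (int_indic mu phi mB) (int_indic mu psi mB); apply: le_int_ae.
- by apply: nnmM n1; exact: nnm_indic.
- by apply: nnmM n2; exact: nnm_indic.
- by apply: filterS h => y hy; rewrite lee_wpmul2l// lee_fin.
Qed.

Lemma eball_center x (r : R) : (0 < r)%R -> euclidean_ball x r x.
Proof.
move=> r0; rewrite /euclidean_ball /= big1 ?exprn_gt0// => i _.
by rewrite subrr expr0n.
Qed.

Lemma hlm_ge0 phi x : nnm phi -> 0 <= hlm phi x.
Proof.
move=> np; apply: le_trans (le_hlm phi (ltr01 : (0 < 1 :> R)%R) (eball_center x ltr01)).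
rewrite mule_ge0 ?inve_ge0 ?measure_ge0//; apply: integral_ge0 => y _; exact: (nnm_ge0 np).
Qed.

(** Lower semicontinuity: a ball whose average exceeds a level witnesses this for all its points, so
    superlevel sets are open. *)
Lemma nnm_hlm phi : nnm phi -> nnm (hlm phi).
Proof.
move=> np; split; last by move=> x; exact: hlm_ge0.
apply: (measurability _ (ErealGenOInfty.measurableE R)) => // _ [_ [a ->] <-].
rewrite setTI; apply: measurable_Eopen => x /=.
rewrite in_itv/= andbT => /ereal_sup_gt [_ [B [Bx [c [r [r0 e]]]] <-]] h.
subst B; exists c, r; split => // y By /=; rewrite in_itv/= andbT.
exact: lt_le_trans h (le_hlm phi r0 By).
Qed.

Lemma hlmZ (c : R) phi x : (0 <= c)%R -> nnm phi ->
  hlm (fun y => c%:E * phi y) x <= c%:E * hlm phi x.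
Proof.
move=> c0 np; apply: hlm_leP => a r r0 Bx.
have mB := measurable_eball a r0.
rewrite ge0_integralZl ?lee_fin//; last 2 first.
- exact: measurable_funTS (nnm_m np).
- by move=> y _; exact: (nnm_ge0 np).
by rewrite muleCA lee_wpmul2l ?lee_fin//; exact: le_hlm.
Qed.

Lemma hlm_series (phi : nat -> Rn R n -> \bar R) x : (forall k, nnm (phi k)) ->
  hlm (fun y => \sum_(k <oo) phi k y) x <= \sum_(k <oo) hlm (phi k) x.
Proof.
move=> np; apply: hlm_leP => a r r0 Bx; have mB := measurable_eball a r0.
have V0 : 0 <= (mu (euclidean_ball a r))^-1 by rewrite inve_ge0.
rewrite integral_nneseries//; last 2 first.
- by move=> k; exact: measurable_funTS (nnm_m (np k)).
- by move=> k y _; exact: (nnm_ge0 (np k)).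
have I0 k : 0 <= \int[mu]_(y in euclidean_ball a r) phi k y.
  by apply: integral_ge0 => y _; exact: (nnm_ge0 (np k)).
have [e|fin] := eqVneq ((mu (euclidean_ball a r))^-1) +oo.
  exfalso; move/eqP: e; rewrite inve_eqy => /eqP e.
  have := vol_eball a r0; rewrite e lee_fin leNgt => /negP; apply.
  by rewrite exprn_gt0// !mulr_gt0// invr_gt0.
rewrite -[(mu _)^-1]fineK; last by rewrite ge0_fin_numE// ltey.
rewrite -nneseriesZl; last by move=> k _; exact: I0.
apply: lee_nneseries => k _.
  by rewrite mule_ge0// lee_fin fine_ge0.
rewrite fineK; last by rewrite ge0_fin_numE// ltey.
exact: le_hlm.
Qed.

Lemma hlm_sMM d (T : measurableType d) (f : Rn R n * T -> \bar R) x t : nnm f ->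
  hlm (fun y => f (y, t)) x <= (hl_const n)%:E * sMM f (x, t).
Proof. by move=> nf; apply: hlm_leP => a r r0 Bx; exact: ball_avg_sMM. Qed.

(** A ball through [x] that meets the set where [phi] is nonzero has diameter at least [d], hence
    volume at least (d/(n+1))^n. *)
Lemma hlm_far phi x (d : R) : nnm phi -> (0 < d)%R ->
  (forall y, (forall i, `|(tnth x i : R) - tnth y i| < d)%R -> phi y = 0) ->
  hlm phi x <= (((d / n.+1%:R) ^+ n)^-1)%:E * \int[mu]_y phi y.
Proof.
move=> np d0 h; apply: hlm_leP => a r r0 Bx; have mB := measurable_eball a r0.
have I0 : 0 <= \int[mu]_y phi y by exact: int_ge0.
have D0 : (0 < (d / n.+1%:R) ^+ n)%R by rewrite exprn_gt0// divr_gt0.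
have [rd|rd] := leP d (2 * r)%R; last first.
  rewrite integral0_eq ?mule0; first by rewrite mule_ge0// lee_fin invr_ge0 ltW.
  move=> y By; apply: h => i.
  have /andP[h1 h2] := ball_box i r0 Bx; have /andP[h3 h4] := ball_box i r0 By.
  by rewrite ltr_norml; apply/andP; split; lra.
apply: lee_pmul.
- by rewrite inve_ge0.
- by apply: integral_ge0 => y _; exact: (nnm_ge0 np).
- have -> : (((d / n.+1%:R) ^+ n)^-1)%:E = ((d / n.+1%:R) ^+ n)%:E^-1 :> \bar R.
    by rewrite inver gt_eqF.
  have le : ((d / n.+1%:R) ^+ n)%:E <= mu (euclidean_ball a r).
    apply: le_trans (vol_eball a r0); rewrite lee_fin; apply: lerXn2r; rewrite ?nnegrE.
    + by rewrite divr_ge0// ltW.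
    + by rewrite mulr_ge0// divr_ge0// ltW.
    + by rewrite mulrA ler_wpM2r// invr_ge0.
  rewrite lee_pV2// ?inE ?lee_fin ?(ltW D0)//.
- by apply: ge0_subset_integral => //; [exact: nnm_m|move=> y _; exact: (nnm_ge0 np)].
Qed.

End maximal_function.

(** * Sequence norms as iterated norms *)

Section sequence_norm.
Context {R : realType}.

Lemma lnorm_Lq (s : R) (a : nat -> \bar R) : (0 < s)%R ->
  lnorm s%:E a = Lq (@counting nat R : {sigma_finite_measure set nat -> \bar R})
    (fun g : unit -> \bar R => `|g tt|) s (fun z => a z.1).
Proof.
move=> s0; rewrite /lnorm /Lq ge0_integral_count; last by move=> k; exact: poweR_ge0.
by congr (_ `^ _); apply/esym/nneseries_esumT => k; exact: poweR_ge0.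
Qed.

Lemma lnorm_nice_HL (u : \bar R) : 1 < u -> @nice R _ nat (@lnorm R nat u) /\ HL (@lnorm R nat u).
Proof.
case: u => [s| |]// s1; last by split; [exact: nice_supnorm|exact: HL_supnorm].
rewrite lte_fin in s1; have s0 : (0 < s)%R by apply: lt_trans s1.
rewrite (_ : @lnorm R nat s%:E = fun a => Lq (@counting nat R : {sigma_finite_measure set nat -> \bar R})
    (fun g : unit -> \bar R => `|g tt|) s (fun z => a z.1)); last first.
  by apply/funext => a; exact: lnorm_Lq.
split.
- apply: (nice_pull (phi := fst : nat * unit -> nat)); first exact: measurable_fst.
  by apply: nice_Lq => //; exact: nice_abs.
- apply: (HL_pull (phi := fst : nat * unit -> nat)); first exact: measurable_fst.
  by apply: HL_Lq => //; [exact: nice_abs|exact: HL_abs].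
Qed.

End sequence_norm.

(** * The maximal inequality in mixed norms *)

Section mixed.
Context {R : realType}.
Local Notation T0 := (measurableTypeR R).
Local Notation leb := (@lebesgue_measure R).

Definition ex n (q : n.-tuple R) : n.-tuple (\bar R) := [tuple of map EFin q].

Lemma behead_ex n (q : n.+1.-tuple R) : [tuple of behead (ex q)] = ex [tuple of behead q].
Proof. by apply: val_inj; case: q => -[]. Qed.

Lemma thead_ex n (q : n.+1.-tuple R) : thead (ex q) = (thead q)%:E.
Proof. by rewrite /thead tnth_map. Qed.

Lemma mixed_norm_abse n (p : n.-tuple (\bar R)) (g : Rn R n -> \bar R) :
  mixed_norm p g = mixed_norm p (fun x => `|g x|).
Proof.
case: n p g => [|n] p g /=; first by rewrite abse_id.
by congr mixed_norm; apply/funext => y; rewrite -Lnorm_abse.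
Qed.

Lemma mixed_norm_mnorm n d (T : measurableType d) (q : n.-tuple R) rho
    (f : Rn R n * T -> \bar R) : (forall g, 0 <= rho g) ->
  mixed_norm (ex q) (fun x => rho (fun t => f (x, t))) = mnorm q rho f.
Proof.
elim: n d T q rho f => [|n IH] d T q rho f r0; first by rewrite /= gee0_abs.
rewrite [LHS]/= [RHS]/= behead_ex -IH; last by move=> g; exact: poweR_ge0.
congr mixed_norm; apply/funext => y; rewrite thead_ex unlock /Lq; congr (_ `^ _).
by apply: eq_integral => a _; rewrite gee0_abs.
Qed.

Lemma mixed_norm_abs n (q : n.-tuple R) (g : Rn R n -> \bar R) :
  mixed_norm (ex q) g = mnorm q (fun h : unit -> \bar R => `|h tt|) (fun z => g z.1).
Proof. by rewrite mixed_norm_abse -mixed_norm_mnorm. Qed.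

Lemma nice_mixed_norm n (q : n.-tuple R) : (forall i, 1 < tnth q i)%R ->
  nice (@mixed_norm R n (ex q)).
Proof.
move=> q1; rewrite (_ : mixed_norm (ex q) =
  fun g => mnorm q (fun h : unit -> \bar R => `|h tt|) (fun z => g z.1)); last first.
  by apply/funext => g; exact: mixed_norm_abs.
apply: (nice_pull (phi := fst : Rn R n * unit -> Rn R n)); first exact: measurable_fst.
by apply: nice_mnorm => //; exact: nice_abs.
Qed.

(** By Tonelli almost every line meets the exceptional set in a null set, so the inner norms agree
    for almost every choice of the remaining variables; [F] need not be Borel. *)
Lemma mixed_norm_ae n (q : n.-tuple R) (F H : Rn R n -> \bar R) :
  (forall x, 0 <= F x) -> nnm H -> (forall i, 1 < tnth q i)%R ->
  (\forall x \ae lebesgue_Rn R n, F x = H x) ->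
  mixed_norm (ex q) F = mixed_norm (ex q) H.
Proof.
elim: n q F H => [|n IH] q F H F0 nH q1 h.
  have [N [mN N0 sub]] := h.
  have -> // : F = H.
  apply/funext => x; apply: contrapT => hx; have Nx : N x by exact: sub.
  move: N0; rewrite (_ : x = [tuple]) in Nx; last exact: tuple0.
  by rewrite /= diracE mem_set//= => /eqP; rewrite onee_eq0.
have [h1 h2] := tnth_beheadP (P := fun x => 1 < x)%R q1.
have q0 : (0 < thead q)%R by apply: lt_trans h1.
rewrite [LHS]/= [RHS]/= behead_ex thead_ex.
apply: IH; [by move=> y; exact: Lnorm_ge0| |exact: h2|].
- rewrite (_ : (fun y => Lnorm leb (thead q)%:E (fun a => H (cons_point (a, y)))) = fun y => (\int[leb]_a H (cons_point (a, y)) `^ thead q) `^ (thead q)^-1).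
    apply: nnm_pow; apply: (nnm_int1 leb (f := fun z => H (cons_point z) `^ thead q)).
    exact: nnm_pow (nnm_cons nH).
  apply/funext => y; rewrite unlock; congr (_ `^ _); apply: eq_integral => a _.
  by rewrite gee0_abs// (nnm_ge0 nH).
- have := ae_cons h; apply: filterS => y hy; rewrite unlock; congr (_ `^ _).
  apply: int_ae_nm.
  + by move=> a; exact: poweR_ge0.
  + apply: nnm_pow; rewrite (_ : (fun a => _) = (fun a => H (cons_point (a, y)))).
      exact: nnm_pair2 (nnm_cons nH).
    by apply/funext => a; rewrite gee0_abs// (nnm_ge0 nH).
  + by apply: filterS hy => a ->.
Qed.

Definition hconj (a : R) : R := (a / (a - 1))%R.

Lemma conj_gt1 a : (1 < a)%R -> (1 < hconj a)%R.
Proof. by move=> a1; rewrite /hconj ltr_pdivlMr ?subr_gt0// mul1r ltrBlDr ltrDl. Qed.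

Lemma conjV a : (1 < a)%R -> ((hconj a)^-1 = 1 - a^-1)%R.
Proof.
move=> a1; rewrite /hconj invf_div mulrBl divff ?mul1r// gt_eqF//.
by apply: lt_trans a1.
Qed.

Lemma hoelder_conjugateE (a : R) : (1 < a)%R -> hoelder_conjugate a%:E = (hconj a)%:E.
Proof.
move=> a1; have a0 : (0 < a)%R by apply: lt_trans a1.
by rewrite /hoelder_conjugate /= eqe gt_eqF// -EFinB inver subr_eq0 gt_eqF.
Qed.

Lemma conj_exponentsE n (p : n.-tuple R) : (forall i, 1 < tnth p i)%R ->
  conj_exponents p = ex [tuple of map hconj p].
Proof.
move=> p1; apply: eq_from_tnth => i.
by rewrite !tnth_map hoelder_conjugateE.
Qed.

(** The index [j] enters as the value space, with [rho] the sequence norm: [hlm_sMM] holds for each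
    [j], and [mnorm_sMM] treats all of them jointly. *)
Lemma mixed_norm_maximal n (q : n.-tuple R) (u : \bar R) : (forall i, 1 < tnth q i)%R -> 1 < u ->
  exists2 C : R, (0 < C)%R & forall psi : nat -> Rn R n -> \bar R, (forall j, nnm (psi j)) ->
  mixed_norm (ex q) (fun x => lnorm u (fun j => hlm (psi j) x)) <=
  C%:E * mixed_norm (ex q) (fun x => lnorm u (fun j => psi j x)).
Proof.
move=> q1 u1; have [H hl] := lnorm_nice_HL u1.
have [C C0 hC] := mnorm_sMM H hl q1.
have c0 := @hl_const_gt0 R n.
exists (hl_const n * C)%R; first exact: mulr_gt0.
move=> psi npsi; pose f (z : Rn R n * nat) := psi z.2 z.1.
have nf : nnm f by exact: nnm_swap (nnm_nat npsi).
have nS := nnm_sMM nf.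
have M := nice_mixed_norm q1.
rewrite (mixed_norm_mnorm q f (nice_ge0 H)) EFinM -muleA.
apply: (@le_trans _ _ ((hl_const n)%:E * mixed_norm (ex q) (fun x => lnorm u (fun j => sMM f (x, j))))).
  rewrite -(niceZ M)//; last 2 first.
  - exact: ltW.
  - exact: (nice_nnm H nS).
  have nm : nnm (fun x => lnorm u (fun j => hlm (psi j) x)).
    apply: (nice_nnm H (f := fun z : Rn R n * nat => hlm (psi z.2) z.1)).
    by apply: (nnm_swap (f := fun z : nat * Rn R n => hlm (psi z.1) z.2)); exact: (nnm_nat (f := fun j => hlm (psi j)) (fun j => nnm_hlm (npsi j))).
  apply: (nice_le M) => //.
    by apply: nnmZ; [rewrite lee_fin ltW|exact: (nice_nnm H nS)].
  move=> x; rewrite -(niceZ H) ?(ltW c0)//; last exact: nnm_pair1.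
  apply: (nice_le H).
  - by split => [//|j]; exact: hlm_ge0.
  - by apply: nnmZ; [rewrite lee_fin ltW|exact: nnm_pair1].
  - by move=> j; exact: hlm_sMM.
by rewrite lee_wpmul2l ?lee_fin ?(ltW c0)// mixed_norm_mnorm ?hC//; exact: (nice_ge0 H).
Qed.

End mixed.

(** * Unordered countable sums *)

Section countable_sums.
Context {R : realType}.

Section one_index.
Context {I : countType}.
Implicit Types a b : I -> \bar R.

(** Codes that encode no index contribute 0. All facts about series and integrals pass to unordered
    sums through this enumeration. *)
Lemma esum_nat a : (forall i, 0 <= a i) ->
  \esum_(i in [set: I]) a i = \sum_(k <oo) oapp a 0 (pickle_inv k).
Proof.
move=> a0; rewrite nneseries_esumT; last by move=> k; case: pickle_inv.
transitivity (\esum_(k in range (@choice.pickle I)) oapp a 0 (pickle_inv k)).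
  rewrite (reindex_esum [set: I] (range (@choice.pickle I)) (@choice.pickle I)).
    by apply: eq_esum => i _; rewrite pickleK_inv.
  split => [i _|i j _ _ /(pcan_inj (@choice.pickleK I))//|k [i _ <-]]; by [exists i|exists i].
rewrite esum_mkcond; apply: eq_esum => k _; case: ifPn => // /negP h.
case e : (pickle_inv k) => [i|//]; exfalso; apply: h; rewrite inE; exists i => //.
by have := @pickle_invK I k; rewrite e.
Qed.

Lemma esum_eq0 (a : I -> \bar R) : (forall i, a i = 0) -> \esum_(i in [set: I]) a i = 0.
Proof. by move=> a0; rewrite esum1. Qed.

Lemma ge_esum a i : (forall j, 0 <= a j) -> a i <= \esum_(j in [set: I]) a j.
Proof.
move=> a0; apply: esum_ge; exists [set i]; last by rewrite fsbig_set1.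
by split => //; exact: finite_set1.
Qed.

Lemma esum_single a i : (forall j, 0 <= a j) -> (forall j, j != i -> a j = 0) ->
  \esum_(j in [set: I]) a j = a i.
Proof.
move=> a0 h; rewrite -(@esum_set1 _ _ i a)// [RHS]esum_mkcond; apply: eq_esum => j _.
case: ifPn => //; rewrite notin_setE /= => /eqP; exact: h.
Qed.

Lemma esumZ (c : R) a : (0 <= c)%R -> (forall i, 0 <= a i) ->
  \esum_(i in [set: I]) (c%:E * a i) = c%:E * \esum_(i in [set: I]) a i.
Proof.
move=> c0 a0; rewrite !esum_nat//; last by move=> i; rewrite mule_ge0.
rewrite -nneseriesZl; last by move=> k _; case: pickle_inv.
by apply: eq_eseriesr => k _; case: pickle_inv => [i|]//=; rewrite mule0.
Qed.

Lemma esum_hoelder a b (p q : R) : (forall i, 0 <= a i) -> (forall i, 0 <= b i) ->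
  (0 < p)%R -> (0 < q)%R -> (p^-1 + q^-1 = 1)%R ->
  \esum_(i in [set: I]) (a i * b i) <=
  (\esum_(i in [set: I]) a i `^ p) `^ p^-1 * (\esum_(i in [set: I]) b i `^ q) `^ q^-1.
Proof.
move=> a0 b0 p0 q0 pq; rewrite !esum_nat; do ?by move=> i; rewrite ?mule_ge0 ?poweR_ge0.
have ge0 c : (forall i, 0 <= c i) -> forall k, 0 <= oapp c 0 (pickle_inv k : option I) :> \bar R.
  by move=> c0 k; case: pickle_inv.
have nn c : (forall i, 0 <= c i) -> nnm (fun k => oapp c 0 (pickle_inv k : option I) : \bar R).
  by move=> c0; split => //; exact: ge0.
have epow c r : (r != 0)%R -> \sum_(k <oo) oapp (fun i => c i `^ r) 0 (pickle_inv k : option I) =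
    \int[counting]_k (oapp c 0 (pickle_inv k : option I) `^ r) :> \bar R.
  move=> rn0; rewrite ge0_integral_count; last by move=> k; exact: poweR_ge0.
  by apply: eq_eseriesr => k _; case: pickle_inv => [i|]//=; rewrite powR0.
rewrite !epow ?gt_eqF//; apply: le_trans (hoelder_ge0 _ (nn a a0) (nn b b0) p0 q0 pq).
rewrite ge0_integral_count; last by move=> k; rewrite mule_ge0 ?ge0.
rewrite le_eqVlt; apply/orP; left; apply/eqP.
by apply: eq_eseriesr => k _; case: pickle_inv => [i|]//=; rewrite mule0.
Qed.

Lemma nnm_esum d (T : measurableType d) (f : I -> T -> \bar R) : (forall i, nnm (f i)) ->
  nnm (fun x => \esum_(i in [set: I]) f i x).
Proof.
move=> nf; rewrite (_ : (fun x => _) = fun x => \sum_(k <oo) oapp f (fun _ => 0) (pickle_inv k) x).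
  by apply: nnm_series => k; case: pickle_inv => [i|]//=; exact: nnm_cst.
apply/funext => x; rewrite esum_nat; last by move=> i; exact: (nnm_ge0 (nf i)).
by apply: eq_eseriesr => k _; case: pickle_inv.
Qed.

Lemma int_esum d (T : measurableType d) (mu : {measure set T -> \bar R}) (f : I -> T -> \bar R) :
  (forall i, nnm (f i)) ->
  \int[mu]_x (\esum_(i in [set: I]) f i x) = \esum_(i in [set: I]) \int[mu]_x f i x.
Proof.
move=> nf; rewrite esum_nat; last by move=> i; exact: int_ge0.
transitivity (\int[mu]_x (\sum_(k <oo) oapp f (fun _ => 0) (pickle_inv k) x)).
  apply: eq_integral => x _; rewrite esum_nat; last by move=> i; exact: (nnm_ge0 (nf i)).
  by apply: eq_eseriesr => k _; case: pickle_inv.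
rewrite int_series; last by move=> k; case: pickle_inv => [i|]//=; exact: nnm_cst.
by apply: eq_eseriesr => k _; case: pickle_inv => [i|]//=; rewrite integral0.
Qed.

Lemma esum_subadd d (T : measurableType d) (rho : (T -> \bar R) -> \bar R) (f : I -> T -> \bar R) :
  (forall i, 0 <= rho (f i)) -> rho (fun _ => 0) = 0 ->
  (forall g : nat -> T -> \bar R, (forall k, nnm (g k)) ->
     rho (fun t => \sum_(k <oo) g k t) <= \sum_(k <oo) rho (g k)) ->
  (forall i, nnm (f i)) ->
  rho (fun t => \esum_(i in [set: I]) f i t) <= \esum_(i in [set: I]) rho (f i).
Proof.
move=> r0 rho0 H nf; rewrite esum_nat//.
pose g k := oapp f (fun _ => 0) (pickle_inv k : option I).
have ng k : nnm (g k) by rewrite /g; case: pickle_inv => [i|]//=; exact: nnm_cst.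
rewrite (_ : \sum_(k <oo) _ = \sum_(k <oo) rho (g k)); last first.
  by apply: eq_eseriesr => k _; rewrite /g; case: pickle_inv.
apply: le_trans (H g ng); rewrite le_eqVlt; apply/orP; left; apply/eqP; congr rho.
apply/funext => t; rewrite esum_nat; last by move=> i; exact: (nnm_ge0 (nf i)).
by apply: eq_eseriesr => k _; rewrite /g; case: pickle_inv.
Qed.

End one_index.

Lemma esum_pair (I J : countType) (a : I * J -> \bar R) : (forall z, 0 <= a z) ->
  \esum_(z in [set: I * J]) a z = \esum_(i in [set: I]) \esum_(j in [set: J]) a (i, j).
Proof.
move=> a0; rewrite (@esum_esum _ _ _ setT (fun=> setT) (fun i j => a (i, j)))//.
rewrite (_ : _ `*`` _ = setT); last by apply/seteqP; split.
by apply: eq_esum => -[i j].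
Qed.

Lemma esum_swap (I J : countType) (a : I -> J -> \bar R) : (forall i j, 0 <= a i j) ->
  \esum_(i in [set: I]) \esum_(j in [set: J]) a i j =
  \esum_(j in [set: J]) \esum_(i in [set: I]) a i j.
Proof.
move=> a0; rewrite -(esum_pair (a := fun z => a z.1 z.2))//.
rewrite -(esum_pair (a := fun z => a z.2 z.1))//.
rewrite (reindex_esum setT setT (fun z : J * I => (z.2, z.1)))//.
split => [//|[j i] [j' i'] _ _ /= [-> ->]//|[i j] _]; by exists (j, i).
Qed.

End countable_sums.

(** * Hoelder's inequality and indicator norms on boxes of equal sides *)

Section box_norms.
Context {R : realType}.
Local Notation T0 := (measurableTypeR R).
Local Notation leb := (@lebesgue_measure R).
Variable l : R.
Hypothesis l0 : (0 < l)%R.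

Let psum n (p : n.-tuple R) : R := (\sum_(i < n) (tnth p i)^-1)%R.

Let psumS n (p : n.+1.-tuple R) : psum p = ((thead p)^-1 + psum [tuple of behead p])%R.
Proof.
rewrite /psum big_ord_recl; congr (_ + _)%R.
by apply: eq_bigr => i _; rewrite tnth_behead; congr ((tnth p _)^-1)%R; apply: val_inj;
  rewrite /= inordK// ltnS.
Qed.

Lemma box_hoelder n (p : n.-tuple R) (A : 'I_n -> set T0) (f : Rn R n -> \bar R) :
  (forall i, 1 < tnth p i)%R -> (forall i, measurable (A i)) ->
  (forall i, leb (A i) = l%:E) -> nnm f ->
  \int[lebesgue_Rn R n]_x (ind (box A) x * f x) <=
  (l `^ psum p)%:E * mixed_norm (ex [tuple of map hconj p]) f.
Proof.
elim: n p A f => [|n IH] p A f p1 mA lA nf.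
  rewrite int_Rn0; last first.
    by apply: nnmM nf; apply: nnm_ind; apply: measurable_box => -[].
  rewrite ind1; last by case.
  by rewrite /psum big_ord0 powRr0 !mul1e /= gee0_abs// (nnm_ge0 nf).
have [h1 h2] := tnth_beheadP (P := fun x => 1 < x)%R p1.
have p0 : (0 < thead p)%R by apply: lt_trans h1.
have c0 : (0 < hconj (thead p))%R by apply: lt_trans (conj_gt1 h1).
have nB : nnm (fun x => ind (box A) x * f x).
  by apply: nnmM nf; apply: nnm_ind; exact: measurable_box.
rewrite int_cons//.
pose g y := Lnorm leb (hconj (thead p))%:E (fun a => f (cons_point (a, y))).
have gE y : g y = (\int[leb]_a f (cons_point (a, y)) `^ hconj (thead p)) `^ (hconj (thead p))^-1.
  rewrite /g unlock; congr (_ `^ _); apply: eq_integral => a _.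
  by rewrite gee0_abs// (nnm_ge0 nf).
have ng : nnm g.
  rewrite (_ : g = fun y => (\int[leb]_a f (cons_point (a, y)) `^ hconj (thead p)) `^ (hconj (thead p))^-1); last first.
    by apply/funext => y; exact: gE.
  apply: nnm_pow; apply: (nnm_int1 leb (f := fun z => f (cons_point z) `^ hconj (thead p))).
  exact: nnm_pow (nnm_cons nf).
have mA' i : measurable (A (lift ord0 i)) by exact: mA.
have nB' := @nnm_ind R _ _ _ (measurable_box mA').
apply: (@le_trans _ _ (\int[lebesgue_Rn R n]_y ((l `^ (thead p)^-1)%:E *
    (ind (box (fun i => A (lift ord0 i))) y * g y)))).
  apply: le_int.
  - exact: (nnm_int1 leb (nnm_cons nB)).
  - by apply: nnmZ; [rewrite lee_fin powR_ge0|exact: nnmM].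
  - move=> y; have nfy := nnm_pair2 y (nnm_cons nf).
    have nA0 := @nnm_ind R _ _ _ (mA ord0).
    under eq_integral do rewrite ind_box_cons muleAC muleC.
    rewrite intZ ?ind_ge0//; last exact: nnmM.
    rewrite muleCA lee_wpmul2l ?ind_ge0//.
    have := hoelder_ge0 leb nA0 nfy p0 c0.
    rewrite conjV// addrC subrK => /(_ erefl).
    rewrite -conjV// -gE (_ : \int[leb]_x _ `^ thead p = l%:E)//.
    rewrite -(lA ord0) -int_ind//; apply: eq_integral => a _.
    have [h|h] := pselect (A ord0 a); first by rewrite ind1// poweR1r.
    by rewrite ind0// poweR0r// gt_eqF.
rewrite intZ ?lee_fin ?powR_ge0//; last exact: nnmM.
rewrite psumS powRD; last by rewrite (gt_eqF l0) implybT.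
rewrite EFinM -muleA lee_wpmul2l ?lee_fin ?powR_ge0//.
apply: le_trans (IH [tuple of behead p] _ g h2 mA' _ ng) _; first by move=> i; exact: lA.
rewrite [in leRHS]/= behead_ex thead_ex.
rewrite (_ : thead [tuple of map hconj p] = hconj (thead p)); last by rewrite /thead tnth_map.
rewrite (_ : [tuple of behead [tuple of map hconj p]] = [tuple of map hconj [tuple of behead p]])//.
by apply: val_inj; case: (p) => -[].
Qed.

(** The indicator of a box is a product, and coordinate i contributes [l] to the power 1/p_i' = 1 -
    1/p_i. *)
Lemma box_norm n (p : n.-tuple R) (A : 'I_n -> set T0) :
  (forall i, 1 < tnth p i)%R -> (forall i, measurable (A i)) ->
  (forall i, leb (A i) = l%:E) ->
  mixed_norm (ex [tuple of map hconj p]) (ind (box A)) = (l `^ (n%:R - psum p))%:E.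
Proof.
elim: n p A => [|n IH] p A p1 mA lA.
  rewrite (_ : mixed_norm _ _ = `|ind (box A) [tuple]|)// ind1; last by case.
  by rewrite gee0_abs// /psum big_ord0 subrr powRr0.
have [h1 h2] := tnth_beheadP (P := fun x => 1 < x)%R p1.
have c0 : (0 < hconj (thead p))%R by apply: lt_trans (conj_gt1 h1).
have mA' i : measurable (A (lift ord0 i)) by exact: mA.
have nB' := @nnm_ind R _ _ _ (measurable_box mA').
rewrite [LHS]/= behead_ex thead_ex.
rewrite (_ : thead [tuple of map hconj p] = hconj (thead p)); last by rewrite /thead tnth_map.
rewrite (_ : [tuple of behead [tuple of map hconj p]] = [tuple of map hconj [tuple of behead p]]); last first.
  by apply: val_inj; case: (p) => -[].
rewrite (_ : (fun y => _) = fun y => (l `^ (hconj (thead p))^-1)%:E *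
    ind (box (fun i => A (lift ord0 i))) y); last first.
  apply/funext => y; rewrite unlock -poweR_EFin.
  have e (z : \bar R) : (z = 0 \/ z = 1) -> `|z| `^ hconj (thead p) = z.
    by case=> ->; rewrite ?abse0 ?poweR0r ?gt_eqF// gee0_abs// poweR1r.
  have i01 T (B : set T) b : ind B b = 0 :> \bar R \/ ind B b = 1 :> \bar R.
    by have [h|h] := pselect (B b); [right; exact: ind1|left; exact: ind0].
  under eq_integral => a _.
    rewrite ind_box_cons e; last first.
      have [->|->] := i01 _ (A ord0) a; first by rewrite mul0e; left.
      by rewrite mul1e; exact: i01.
    rewrite muleC; over.
  rewrite intZ ?ind_ge0//; last exact: nnm_ind.
  rewrite (etrans (int_ind _ (mA ord0)) (lA ord0)) poweRM ?ind_ge0 ?lee_fin ?(ltW l0)// muleC; congr (_ * _).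
  by have [->|->] := i01 _ (box (fun i => A (lift ord0 i))) y;
    rewrite ?poweR1r ?poweR0r// invr_neq0// gt_eqF.
rewrite (niceZ (nice_mixed_norm _)) ?powR_ge0//; last first.
  by move=> i; rewrite tnth_map; exact: conj_gt1.
rewrite IH// -EFinM -powRD; last by rewrite (gt_eqF l0) implybT.
by rewrite conjV// psumS; congr (_ `^ _)%:E; rewrite -natr1; ring.
Qed.

End box_norms.

(** * Ancestors and neighbours of dyadic cubes *)

Section cube_combinatorics.
Context {R : realType} (n : nat).
Local Notation T0 := (measurableTypeR R).
Local Notation mu := (lebesgue_Rn R n).
Implicit Types (x : Rn R n) (Q : dyadic_index n).

Definition vol (g : int) : R := ((2 ^ (- g)) ^+ n)%R.

Lemma vol_gt0 g : (0 < vol g)%R. Proof. by rewrite exprn_gt0// pow2_gt0. Qed.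

Lemma mu_cube Q : mu (dyadic_cube Q) = (vol Q.1)%:E. Proof. exact: vol_dyadic_cube. Qed.

Lemma dcell_nestk (a : bool) (g : int) (k : nat) (x y : T0) :
  dcell a (g + k%:Z) x = dcell a (g + k%:Z) y -> dcell a g x = dcell a g y.
Proof.
elim: k => [|k IH]; first by rewrite addr0.
rewrite -addn1 PoszD addrA => h; apply: IH; exact: dcell_nest.
Qed.

(** A distinguished point of the cube, through which its ancestors are computed. *)
Definition corner Q : Rn R n := [tuple (2 ^ (- Q.1) * (tnth Q.2 i)%:~R)%R | i < n].

Lemma cornerP Q : dyadic_cube Q (corner Q).
Proof.
move=> i; rewrite tnth_mktuple lexx /= ltr_pM2l ?pow2_gt0// ltrDl//.
Qed.

Definition anc (k : nat) Q : dyadic_index n := cube_at (Q.1 - k%:Z) (corner Q).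

Lemma ancE k Q x : dyadic_cube Q x -> cube_at (Q.1 - k%:Z) x = anc k Q.
Proof.
move=> /dyadic_cubeP e; have /dyadic_cubeP e' := cornerP Q.
congr pair; apply: eq_from_tnth => i; rewrite !tnth_mktuple.
apply: (@dcell_nestk _ _ k); rewrite subrK.
have := congr1 (fun t : dyadic_index n => tnth t.2 i) (etrans (esym e) e').
by rewrite !tnth_mktuple.
Qed.

(* The digit [e_i] encodes the translation by [e_i - 1] cells. *)
Definition nb (e : n.-tuple 'I_3) Q : dyadic_index n :=
  (Q.1, [tuple (tnth Q.2 i + (tnth e i : nat)%:Z - 1)%R | i < n]).

Lemma floor_dist (u v : R) : (`|Num.floor u - Num.floor v| <= 1)%R \/ (1 < `|u - v|)%R.
Proof.
have /floor_eqP /andP[u1 u2] := erefl (Num.floor u).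
have /floor_eqP /andP[v1 v2] := erefl (Num.floor v).
have [h|h] := leP `|Num.floor u - Num.floor v|%R 1%R; [by left|right].
have {h} : (2 <= `|(Num.floor u)%:~R - (Num.floor v)%:~R| :> R)%R.
  by rewrite -intrB -intr_norm (_ : 2 = 2%:~R)%R// ler_int.
by rewrite ler_normr => /orP[h|h]; rewrite ltr_normr; apply/orP; [left|right]; lra.
Qed.

Lemma floor_near (u v : R) : (`|u - v| < 1)%R -> (`|Num.floor u - Num.floor v| <= 1)%R.
Proof. by have [//|h] := floor_dist u v; move/(lt_trans h); rewrite ltxx. Qed.

(** Take the least [k] for which [x] lies in a neighbour of the k-th ancestor. If k > 0, failure at
    k-1 separates [x] from [Q] by a full side of the (k-1)-th ancestor in some coordinate. *)
Lemma nb_cover Q x : exists (k : nat) (e : n.-tuple 'I_3),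
  dyadic_cube (nb e (anc k Q)) x /\
  (k = 0%N \/ forall y, (forall i, `|(tnth x i : R) - tnth y i| < 2 ^ (k.-1%:Z - Q.1))%R ->
     ~ dyadic_cube Q y).
Proof.
pose near k := [forall i : 'I_n, (`|dcell false (Q.1 - k%:Z) (tnth x i) -
  dcell false (Q.1 - k%:Z) (tnth (corner Q) i)| <= 1)%R].
have ex : exists k, near k.
  pose M := (\sum_(i < n) `|(tnth x i : R) - tnth (corner Q) i| * 2 ^ Q.1)%R.
  have [k hk] : exists k : nat, (M < 2 ^+ k)%R.
    exists (Num.bound M); apply: lt_trans (archi_boundP _) _.
      by apply: sumr_ge0 => i _; rewrite mulr_ge0// ltW// pow2_gt0.
    by rewrite -natrX ltr_nat ltn_expl.
  (* Here 2^k exceeds the distance from the corner in units of the side of [Q]. *)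
  exists k; apply/forallP => i; rewrite /dcell !shift_false !addr0; apply: floor_near.
  rewrite -mulrBr normrM (gtr0_norm (pow2_gt0 _)).
  rewrite exprzDr ?unitfE// -exprnN mulrAC ltr_pdivrMr ?exprn_gt0// mul1r.
  apply: le_lt_trans hk; rewrite mulrC /M (bigD1 i)//= lerDl.
  by apply: sumr_ge0 => j _; rewrite mulr_ge0// ltW// pow2_gt0.
have := ex_minnP ex => -[k nk mk].
have /forallP nk' := nk.
pose e : n.-tuple 'I_3 := [tuple inord `|(dcell false (Q.1 - k%:Z) (tnth x i) -
  dcell false (Q.1 - k%:Z) (tnth (corner Q) i) + 1)%R|%N | i < n].
exists k, e; split.
  apply/dyadic_cubeP; rewrite /nb /anc /cube_at /=; congr pair; apply: eq_from_tnth => i.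
  rewrite !tnth_mktuple; have := nk' i; rewrite [tnth (corner _) _]tnth_mktuple.
  move: (dcell false _ (tnth x i)) (dcell false _ (2 ^ (- Q.1) * _)%R) => a b.
  rewrite ler_norml => /andP[h1 h2].
  have c0 : (0 <= a - b + 1)%R by lia.
  rewrite inordK; first by rewrite gez0_abs//; lia.
  by rewrite -ltz_nat gez0_abs//; lia.
case: k nk mk nk' e => [|k] nk mk nk' e; first by left.
right => y hy Qy.
have : ~~ near k by apply/negP => /mk; rewrite ltnn.
rewrite negb_forall; move/existsP; case=> i.
have eQ := ancE k Qy.
have -> : dcell false (Q.1 - k%:Z) (tnth (corner Q) i) = dcell false (Q.1 - k%:Z) (tnth y i).
  by have := congr1 (fun t : dyadic_index n => tnth t.2 i) eQ; rewrite !tnth_mktuple.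
rewrite /dcell !shift_false !addr0; apply/negP/negPn; apply: floor_near.
rewrite -mulrBr normrM (gtr0_norm (pow2_gt0 _)).
have := hy i; rewrite /= -(@ltr_pM2l _ (2 ^ (Q.1 - k%:Z))%R) ?pow2_gt0//.
by rewrite -expfzDr// addrA subrK subrr expr0z.
Qed.

Lemma cube_disjoint g (A : dyadic_index n -> bool) (P : dyadic_index n) (x : Rn R n) :
  (forall Q, A Q -> Q.1 = g /\ dyadic_cube Q `<=` (dyadic_cube P : set (Rn R n))) ->
  \esum_(Q in [set: dyadic_index n]) ((A Q)%:R%:E * ind (dyadic_cube Q) x) <=
  ind (dyadic_cube P) x :> \bar R.
Proof.
move=> hA; rewrite (@esum_single _ _ _ (cube_at g x)).
- case: (boolP (A _)) => [/hA[_ h]|_]; last by rewrite mul0e ind_ge0.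
  by rewrite mul1e !ind1//; [apply: h|]; exact: cube_atP.
- by move=> Q; rewrite mule_ge0 ?ind_ge0// lee_fin ler0n.
- move=> Q neQ; case: (boolP (A Q)) => [/hA[e _]|_]; last by rewrite mul0e.
  rewrite ind0 ?mule0// => /dyadic_cubeP h; move/eqP: neQ; apply.
  by rewrite h /= e.
Qed.

(** Cubes of one generation are disjoint, so their volumes add up to at most that of a cube
    containing them. *)
Lemma sum_vol g (A : dyadic_index n -> bool) (P : dyadic_index n) :
  (forall Q, A Q -> Q.1 = g /\ dyadic_cube Q `<=` (dyadic_cube P : set (Rn R n))) ->
  \esum_(Q in [set: dyadic_index n]) ((A Q)%:R%:E * (vol Q.1)%:E) <= (vol P.1)%:E.
Proof.
move=> hA; have mQ := @measurable_dyadic_cube R n.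
rewrite -mu_cube -int_ind//.
have nA Q : nnm (fun x => (A Q)%:R%:E * ind (dyadic_cube Q) x : \bar R).
  by apply: nnmZ; [rewrite lee_fin ler0n|exact: nnm_ind].
apply: (@le_trans _ _ (\int[mu]_x (\esum_(Q in [set: dyadic_index n])
   ((A Q)%:R%:E * ind (dyadic_cube Q) x)))).
  rewrite int_esum//; apply: le_esum => Q _; rewrite intZ ?lee_fin ?ler0n//; last exact: nnm_ind.
  by rewrite (etrans (int_ind _ (mQ Q)) (mu_cube Q)).
apply: le_int; [exact: nnm_esum|exact: nnm_ind|] => x.
exact: cube_disjoint hA.
Qed.

End cube_combinatorics.

Lemma nnm_seq (R : realType) (a : nat -> \bar R) : (forall j, 0 <= a j) -> nnm a.
Proof. by split. Qed.

(** * The maximal function of one vector-valued block *)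

Section single_block.
Context {R : realType} (n : nat) (p : n.-tuple R) (t : R) (u : \bar R).
Local Notation mu := (lebesgue_Rn R n).
Hypotheses (n0 : (0 < n)%N) (p1 : forall i, (1 < tnth p i)%R) (t0 : (0 < t)%R) (u1 : 1 < u).
Implicit Types (x : Rn R n) (Q : dyadic_index n).

Local Notation anc := (@anc R n).
Local Notation N := (mixed_norm (ex [tuple of map hconj p])).

Definition sigma : R := (n%:R^-1 * \sum_(i < n) (tnth p i)^-1)%R.

Definition bb (g : int) : R := (vol n g `^ (t^-1 - sigma))%R.

Lemma bb_gt0 g : (0 < bb g)%R. Proof. by rewrite powR_gt0// vol_gt0. Qed.

Lemma conjp1 i : (1 < tnth [tuple of map hconj p] i)%R.
Proof. by rewrite tnth_map; exact: conj_gt1. Qed.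

Lemma niceN : nice N. Proof. exact: nice_mixed_norm conjp1. Qed.

Lemma block_boundE Q : block_bound p t (dyadic_cube Q : set (Rn R n)) = (bb Q.1)%:E.
Proof. by rewrite /block_bound (mu_cube Q). Qed.

Let psumE : (\sum_(i < n) (tnth p i)^-1 = n%:R * sigma)%R.
Proof. by rewrite /sigma mulrA divff ?mul1r// pnatr_eq0 -lt0n. Qed.

Let powl Q (s : R) : (((2 ^ (- Q.1)) `^ (n%:R * s)) = vol n Q.1 `^ s)%R.
Proof. by rewrite powRrM powR_mulrn// ltW// pow2_gt0. Qed.

Lemma cube_hoelder Q f : nnm f ->
  \int[mu]_x (ind (dyadic_cube Q) x * f x) <= (vol n Q.1 `^ sigma)%:E * N f.
Proof.
move=> nf; rewrite dyadic_cube_box -powl -psumE.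
apply: (box_hoelder (pow2_gt0 _) p1) => // i; [exact: dcell_meas|exact: dcell_vol].
Qed.

Lemma cube_norm Q : N (ind (dyadic_cube Q)) = (vol n Q.1 `^ (1 - sigma))%:E.
Proof.
rewrite dyadic_cube_box -powl mulrBr mulr1 -psumE.
apply: (box_norm (pow2_gt0 _) p1) => // i; [exact: dcell_meas|exact: dcell_vol].
Qed.

Definition theta : R := (2 `^ (- (n%:R / t)))%R.

Lemma theta_gt0 : (0 < theta)%R. Proof. by rewrite powR_gt0. Qed.

Lemma volB (g : int) (k : nat) : (vol n (g - k%:Z) = (2 ^+ k) ^+ n * vol n g :> R)%R.
Proof.
by rewrite /vol opprB addrC exprzDr ?unitfE// -exprnP exprMn mulrC.
Qed.

(** The gain of the decomposition: passing to the k-th ancestor multiplies the volume by 2^(kn), so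
    |Q|^(1/t) is theta^k times the same power for the ancestor. *)
Lemma thetaE (g : int) (k : nat) : (vol n g `^ t^-1 = theta ^+ k * vol n (g - k%:Z) `^ t^-1)%R.
Proof.
rewrite volB powRM ?(ltW (vol_gt0 _ _)) ?exprn_ge0 ?exprn_ge0// mulrA.
rewrite (_ : theta ^+ k * ((2 ^+ k) ^+ n) `^ t^-1 = 1)%R ?mul1r//.
rewrite /theta -powR_mulrn ?powR_ge0// -powRrM -exprM -powR_mulrn// -powRrM -powRD.
  by rewrite natrM (_ : _ + _ = 0)%R ?powRr0//; field; rewrite gt_eqF.
by rewrite pnatr_eq0 implybT.
Qed.

(** The separation given by [nb_cover] is half the side of the k-th ancestor, whence the 2; the n+1
    is that of [hlm_far]. *)
Definition tail_const : R := ((2 * n.+1%:R) ^+ n)%R.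

(* On a neighbour of the [k]-th ancestor of [Q], away from the neighbours of the
   earlier ones, every ball meeting [Q] has volume at least [vol n (Q.1 - k)] up
   to the factor [tail_const]. *)
Definition piece (psi : nat -> Rn R n -> \bar R) Q (k : nat) x : \bar R :=
  if k is _.+1 then (tail_const / vol n (Q.1 - k%:Z))%:E *
    \int[mu]_y lnorm u (fun j => psi j y)
  else lnorm u (fun j => hlm (psi j) x).

Definition pieces psi Q (z : nat * n.-tuple 'I_3) x : \bar R :=
  ind (dyadic_cube (nb z.2 (anc z.1 Q))) x * piece psi Q z.1 x.

Section block.
Variables (psi : nat -> Rn R n -> \bar R) (Q : dyadic_index n).
Hypotheses (npsi : forall j, nnm (psi j))
  (supp : forall j x, ~ dyadic_cube Q x -> psi j x = 0).

Let H : @nice R _ nat (@lnorm R nat u). Proof. by have [] := lnorm_nice_HL u1. Qed.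

Lemma nnm_lnorm (f : nat -> Rn R n -> \bar R) : (forall j, nnm (f j)) ->
  nnm (fun x => lnorm u (fun j => f j x)).
Proof.
by move=> nf; apply: (nice_nnm H (f := fun z : Rn R n * nat => f z.2 z.1)); exact: nnm_swap (nnm_nat nf).
Qed.

Lemma nnm_piece k : nnm (piece psi Q k).
Proof.
case: k => [|k]; first by apply: nnm_lnorm => j; exact: nnm_hlm.
apply: nnm_cst; rewrite mule_ge0//; last by apply: int_ge0; exact: nnm_lnorm.
by rewrite lee_fin divr_ge0// ?(ltW (vol_gt0 _ _))// exprn_ge0// mulr_ge0.
Qed.

Lemma nnm_pieces z : nnm (pieces psi Q z).
Proof.
apply: nnmM; last exact: nnm_piece.
by apply: nnm_ind; exact: measurable_dyadic_cube.
Qed.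

(** At each point one piece suffices, the one chosen by [nb_cover]. Away from [Q], [hlm_far] bounds
    each maximal function by a multiple of an integral, and Minkowski moves the sequence norm inside
    the integral. *)
Lemma hl_le_pieces x :
  lnorm u (fun j => hlm (psi j) x) <=
  \esum_(z in [set: nat * n.-tuple 'I_3]) pieces psi Q z x.
Proof.
have [k [e [xe h]]] := nb_cover Q x.
apply: le_trans (ge_esum (k, e) (fun z => nnm_ge0 (nnm_pieces z) x)).
rewrite /pieces /= ind1// mul1e.
case: k h {xe} => [//|k] [//|h].
rewrite /piece.
set d := (2 ^ (k%:Z - Q.1))%R in h.
have d0 : (0 < d)%R by exact: pow2_gt0.
have -> : (tail_const / vol n (Q.1 - k.+1%:Z) = ((d / n.+1%:R) ^+ n)^-1)%R.
  rewrite /tail_const /vol -[RHS]exprVn -[X in (_ * X)%R]exprVn -exprMn; congr (_ ^+ n)%R.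
  rewrite invf_div (_ : - (Q.1 - k.+1%:Z) = k%:Z - Q.1 + 1)%R; last by lia.
  by rewrite pow2S -/d; field; rewrite gt_eqF.
have c0 : (0 <= ((d / n.+1%:R) ^+ n)^-1)%R.
  by rewrite invr_ge0 exprn_ge0// divr_ge0// ltW.
have nI : nnm (fun j => \int[mu]_y psi j y).
  by apply: nnm_seq => j; exact: int_ge0.
apply: (@le_trans _ _ (lnorm u (fun j => (((d / n.+1%:R) ^+ n)^-1)%:E * \int[mu]_y psi j y))).
  apply: (nice_le H).
  - by apply: nnm_seq => j; exact: hlm_ge0.
  - by apply: nnmZ => //; rewrite lee_fin.
  - move=> j; apply: hlm_far => // y hy; apply: supp; exact: h.
rewrite (niceZ H)// lee_wpmul2l ?lee_fin//.
by apply: (nice_mink H mu (f := fun z : Rn R n * nat => psi z.2 z.1)); exact: nnm_swap (nnm_nat npsi).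
Qed.

(** For k = 0 this is the maximal inequality. Otherwise the integral of the block is at most
    |Q|^sigma |Q|^(1/t - sigma) = |Q|^(1/t); times |R|^(-1) and the norm |R|^(1 - sigma) of the
    indicator of the neighbour R, it becomes theta^k times the block bound of R. *)
Lemma pieces_norm (C : R) z : (tail_const <= C)%R ->
  N (fun x => lnorm u (fun j => hlm (psi j) x)) <=
    C%:E * N (fun x => lnorm u (fun j => psi j x)) ->
  N (fun x => lnorm u (fun j => psi j x)) <= (bb Q.1)%:E ->
  N (pieces psi Q z) <= (C * theta ^+ z.1 * bb (Q.1 - z.1%:Z))%:E.
Proof.
move=> tC hC hb; case: z => k e /=.
have tc0 : (0 < tail_const)%R by rewrite exprn_gt0// mulr_gt0.
have C0 : (0 < C)%R by apply: lt_le_trans tC.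
case: k => [|k].
  rewrite expr0 mulr1 subr0 EFinM.
  apply: (@le_trans _ _ (C%:E * N (fun x => lnorm u (fun j => psi j x)))).
    apply: le_trans hC; apply: (nice_le niceN); [exact: nnm_pieces|exact: (nnm_piece 0)|].
    move=> x; rewrite /pieces -[leRHS]mul1e lee_wpmul2r ?ind_le1//.
    exact: (nnm_ge0 (nnm_piece 0) x).
  by rewrite lee_wpmul2l// lee_fin ltW.
set g : int := (Q.1 - k.+1%:Z)%R; set v := fun x => lnorm u (fun j => psi j x) in hb *.
have nv : nnm v by exact: nnm_lnorm.
have vj := @vol_gt0 R n Q.1; have vg := @vol_gt0 R n g.
have int_v : \int[mu]_y v y <= (vol n Q.1 `^ sigma * bb Q.1)%:E.
  rewrite EFinM; apply: (@le_trans _ _ ((vol n Q.1 `^ sigma)%:E * N v)); last first.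
    by rewrite lee_wpmul2l// lee_fin powR_ge0.
  apply: le_trans (cube_hoelder Q nv); rewrite le_eqVlt; apply/orP; left; apply/eqP.
  apply: eq_integral => y _; have [Qy|Qy] := pselect (dyadic_cube Q y).
    by rewrite ind1// mul1e.
  rewrite ind0// mul0e -[RHS](nice0 H); congr (lnorm u _).
  by apply/funext => j; exact: supp.
have c1 : (0 <= tail_const / vol n g :> R)%R by apply: divr_ge0; apply: ltW.
have nR := @nnm_ind R _ _ _ (@measurable_dyadic_cube R n (nb e (anc k.+1 Q))).
apply: (@le_trans _ _ (N (fun x => (tail_const / vol n g * (vol n Q.1 `^ sigma * bb Q.1))%:E *
    ind (dyadic_cube (nb e (anc k.+1 Q))) x))).
  apply: (nice_le niceN) => [||x]; first exact: nnm_pieces.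
    by apply: nnmZ => //; rewrite lee_fin mulr_ge0// mulr_ge0 ?powR_ge0.
  by rewrite /pieces /piece muleC lee_wpmul2r ?ind_ge0// [leRHS]EFinM -/g lee_wpmul2l ?lee_fin.
rewrite (niceZ niceN)//; last by rewrite mulr_ge0// mulr_ge0 ?powR_ge0.
rewrite cube_norm /= -EFinM lee_fin /bb -/g.
rewrite -[X in (_ * X)%R]mulr1.
have -> : (vol n Q.1 `^ sigma * vol n Q.1 `^ (t^-1 - sigma) = theta ^+ k.+1 * vol n g `^ t^-1)%R.
  rewrite -powRD; last by rewrite (gt_eqF vj) implybT.
  by rewrite addrCA subrr addr0 (thetaE _ k.+1).
have -> : (vol n g `^ (1 - sigma) = vol n g * vol n g `^ (- sigma))%R.
  rewrite powRD; last by rewrite (gt_eqF vg) implybT.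
  by rewrite powRr1// ltW.
have -> : (vol n g `^ (t^-1 - sigma) = vol n g `^ t^-1 * vol n g `^ (- sigma))%R.
  by rewrite powRD// (gt_eqF vg) implybT.
set a := (vol n g `^ t^-1)%R; set b := (vol n g `^ (- sigma))%R; set T := (theta ^+ k.+1)%R.
have -> : (tail_const / vol n g * (T * a) * (vol n g * b * 1) = tail_const * (T * (a * b)))%R.
  by field; rewrite gt_eqF.
by rewrite -[leRHS]mulrA ler_wpM2r// !mulr_ge0 ?powR_ge0// exprn_ge0// ltW// theta_gt0.
Qed.

End block.
End single_block.

(** * The operator on coefficients and its bound in l^r' *)

Section ancestor_operator.
Context {R : realType} (n : nat).
Local Notation D := (dyadic_index n).
Local Notation Z := (nat * n.-tuple 'I_3)%type.
Local Notation anc := (@anc R n).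
Implicit Types (Q P : D) (z : Z) (x : Rn R n).

Lemma anc_sub k Q : dyadic_cube Q `<=` (dyadic_cube (anc k Q) : set (Rn R n)).
Proof. by move=> x Qx; apply/dyadic_cubeP; rewrite -(ancE k Qx). Qed.

Lemma nb_inj (e : n.-tuple 'I_3) : injective (nb e).
Proof.
move=> [g v] [g' v'] [-> h]; congr pair; apply: eq_from_tnth => i.
have := congr1 (fun w : seq int => nth 0%R w i) h.
rewrite -!(tnth_nth 0%R [tuple _ | i < n]) !tnth_mktuple /=.
by move=> /(congr1 (fun w => w + 1)%R); rewrite !subrK => /addIr.
Qed.

Lemma nb_id Q : nb [tuple (inord 1 : 'I_3) | i < n] Q = Q.
Proof.
case: Q => g v; congr pair; apply: eq_from_tnth => i.
by rewrite !tnth_mktuple inordK//= addrK.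
Qed.

Definition tgt Q z : D := nb z.2 (anc z.1 Q).

(** The volume of a dyadic cube relative to its parent. *)
Definition kappa : R := ((2 ^+ n)^-1)%R.

Lemma kappa_gt0 : (0 < kappa)%R. Proof. by rewrite invr_gt0 exprn_gt0. Qed.

(** For a fixed translation, cubes sent to [P] share one k-th ancestor, of the volume of [P]; each
    fills the fraction kappa^k of it and they are disjoint. *)
Lemma sum_tgt P z :
  \esum_(Q in [set: D]) (((tgt Q z == P)%:R * kappa ^+ z.1)%R)%:E <= 1.
Proof.
have vP := @vol_gt0 R n P.1.
have [[Q0 e0]|none] := pselect (exists Q, tgt Q z = P); last first.
  rewrite esum_eq0// => Q; case: eqP => [h|_]; last by rewrite mul0r.
  by case: none; exists Q.
have inj Q : tgt Q z = P -> anc z.1 Q = anc z.1 Q0 by rewrite -e0 => /nb_inj.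
have gE Q : tgt Q z = P -> (Q.1 - z.1%:Z)%R = P.1 by move=> <-.
have hA Q : tgt Q z == P -> Q.1 = (P.1 + z.1%:Z)%R /\
    dyadic_cube Q `<=` (dyadic_cube (anc z.1 Q0) : set (Rn R n)).
  move=> /eqP hQ; split; first by rewrite -(gE Q hQ) subrK.
  by rewrite -(inj Q hQ); exact: anc_sub.
have h := sum_vol hA.
rewrite (_ : (anc z.1 Q0).1 = P.1)// in h; last exact: gE.
have := @lee_wpmul2l R ((vol n P.1)^-1)%:E _ _ _ h.
rewrite lee_fin invr_ge0 (ltW vP) -EFinM mulVf ?gt_eqF// => /(_ isT).
rewrite -esumZ ?invr_ge0 ?(ltW vP)//; last first.
  by move=> Q; rewrite -EFinM lee_fin mulr_ge0// ltW// vol_gt0.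
apply: le_trans; apply: le_esum => Q _; rewrite -!EFinM lee_fin.
case: eqP => [hQ|_]; last by rewrite !mul0r mulr0.
have -> : vol n P.1 = ((2 ^+ z.1) ^+ n * vol n Q.1 :> R)%R by rewrite -(gE Q hQ) volB.
have vQ := @vol_gt0 R n Q.1.
rewrite !mul1r invfM -mulrA mulVf ?gt_eqF// mulr1 /kappa exprVn.
by rewrite -!exprM mulnC.
Qed.

Section bound.
Variables (eta theta rc : R).
Hypotheses (eta0 : (0 < eta)%R) (eta1 : (eta < 1)%R) (rc1 : (1 <= rc)%R)
  (thetaE : (theta = eta * kappa `^ (1 - rc^-1))%R).

Let rc0 : (0 < rc)%R. Proof. exact: lt_le_trans rc1. Qed.

(** Its value is 3^n / (1 - eta): there are 3^n neighbours for each [k]. *)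
Definition geo : \bar R := \esum_(z in [set: Z]) (eta ^+ z.1)%R%:E.

Lemma geometric_lty : \esum_(k in [set: nat]) (eta ^+ k)%:E < +oo.
Proof.
rewrite -nneseries_esumT; last by move=> k; rewrite lee_fin exprn_ge0// ltW.
have h := @cvg_geometric_series R 1 eta.
rewrite gtr0_norm// in h; have {}h := h eta1.
rewrite (_ : \sum_(k <oo) _ = (1 * (1 - eta)^-1)%R%:E) ?ltry//.
have c : (fun k => (series (geometric 1 eta) k)%:E) @ \oo --> (1 * (1 - eta)^-1)%R%:E.
  exact: (cvg_comp _ _ h).
apply/cvg_lim => //.
rewrite (_ : (fun k => _) = fun k => (series (geometric 1 eta) k)%:E)//; apply/funext => k.
by rewrite /series /= -sumEFin; apply: eq_bigr => i _; rewrite /geometric /= mul1r.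
Qed.

Lemma geo_lty : geo < +oo.
Proof.
rewrite /geo esum_pair; last by move=> z; rewrite lee_fin exprn_ge0// ltW.
pose m : \bar R := \esum_(e in [set: n.-tuple 'I_3]) 1.
have moo : m < +oo.
  rewrite /m esum_fset//; [by rewrite fsbig_finite ?sumEFin ?ltry//; exact: finite_finset|exact: finite_finset].
rewrite (_ : \esum_(k in _) _ = \esum_(k in [set: nat]) (m * (eta ^+ k)%:E)); last first.
  apply: eq_esum => k _; rewrite muleC /m -esumZ ?exprn_ge0 ?(ltW eta0)//.
  by apply: eq_esum => e _; rewrite mule1.
have m0 : 0 <= m by apply: esum_ge0.
have -> : m = (fine m)%:E by rewrite fineK// ge0_fin_numE.
rewrite esumZ ?fine_ge0//; last by move=> k; rewrite lee_fin exprn_ge0// ltW.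
by rewrite lte_mul_pinfty ?lee_fin ?fine_ge0// geometric_lty.
Qed.

Lemma geo_ge1 : 1 <= geo.
Proof.
rewrite /geo -(expr0 eta).
apply: (ge_esum ((0%N, [tuple ord0 | i < n]) : Z) (fun z => _)) => z.
by rewrite lee_fin exprn_ge0// ltW.
Qed.

Lemma geoE : geo = (fine geo)%:E.
Proof. by rewrite fineK// ge0_fin_numE ?geo_lty// (le_trans _ geo_ge1). Qed.

Lemma fine_geo_gt0 : (0 < fine geo)%R.
Proof. by rewrite -lte_fin -geoE (lt_le_trans _ geo_ge1). Qed.

(** The coefficient that [P] collects from all pieces landing on it, up to the constant of
    [pieces_norm]. *)
Definition Op (a : D -> R) P : \bar R :=
  \esum_(Q in [set: D]) \esum_(z in [set: Z])
     (((tgt Q z == P)%:R * (a Q * theta ^+ z.1))%R)%:E.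

Definition ell (a : D -> \bar R) : \bar R := (\esum_(Q in [set: D]) a Q `^ rc) `^ rc^-1.

(** Each pair of a cube and a translation has exactly one target. *)
Lemma esum_regroup (w : D -> Z -> \bar R) : (forall Q z, 0 <= w Q z) ->
  \esum_(P in [set: D]) \esum_(Q in [set: D]) \esum_(z in [set: Z])
    ((tgt Q z == P)%:R%:E * w Q z) =
  \esum_(Q in [set: D]) \esum_(z in [set: Z]) w Q z.
Proof.
move=> w0; have p0 P Q z : 0 <= ((tgt Q z == P)%:R : R)%:E * w Q z.
  by rewrite mule_ge0// lee_fin.
rewrite esum_swap; last by move=> P Q; apply: esum_ge0.
apply: eq_esum => Q _; rewrite esum_swap//; apply: eq_esum => z _.
rewrite (@esum_single _ _ _ (tgt Q z)) ?eqxx ?mul1e// => P.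
by rewrite eq_sym => /negPf ->; rewrite mul0e.
Qed.

Lemma esum_regroupr (w : D -> Z -> R) : (forall Q z, 0 <= w Q z)%R ->
  \esum_(P in [set: D]) \esum_(Q in [set: D]) \esum_(z in [set: Z])
    (((tgt Q z == P)%:R * w Q z)%R)%:E =
  \esum_(Q in [set: D]) \esum_(z in [set: Z]) (w Q z)%:E.
Proof. by move=> w0; exact: (esum_regroup (w := fun Q z => (w Q z)%:E)). Qed.

Lemma sum_geo (w : D -> R) : (forall Q, 0 <= w Q)%R ->
  \esum_(Q in [set: D]) \esum_(z in [set: Z]) ((w Q * eta ^+ z.1)%R)%:E =
  geo * \esum_(Q in [set: D]) (w Q)%:E.
Proof.
move=> w0; rewrite geoE -esumZ ?(ltW fine_geo_gt0)//; apply: eq_esum => Q _.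
rewrite -geoE; under eq_esum do rewrite EFinM.
by rewrite esumZ// 1?muleC// => z; rewrite lee_fin exprn_ge0// ltW.
Qed.

Lemma kappa_geo P :
  \esum_(Q in [set: D]) \esum_(z in [set: Z])
    (((tgt Q z == P)%:R * (eta * kappa) ^+ z.1)%R)%:E <= geo.
Proof.
have e0 z : (0 <= eta ^+ z.1)%R by rewrite exprn_ge0// ltW.
have k0 := kappa_gt0.
rewrite esum_swap; last first.
  by move=> Q z; rewrite lee_fin mulr_ge0// exprn_ge0// mulr_ge0// ltW.
apply: le_esum => z _; under eq_esum do rewrite exprMn mulrCA EFinM.
rewrite esumZ//; last by move=> Q; rewrite lee_fin mulr_ge0// exprn_ge0// ltW.
by rewrite -[leRHS]mule1 lee_wpmul2l ?lee_fin//; exact: sum_tgt.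
Qed.

(* Hoelder's inequality after writing theta^k as (eta^k)^(1/rc) times
   ((eta kappa)^k)^(1/rc'): the second factor is summed over the cubes of one
   generation in a fixed cube, which have total volume at most that of the cube. *)
Lemma Op_bound (a : D -> R) : (forall Q, 0 <= a Q)%R ->
  ell (Op a) <= geo * ell (fun Q => (a Q)%:E).
Proof.
move=> a0; have k0 := kappa_gt0.
have th0 : (0 < theta)%R by rewrite thetaE mulr_gt0// powR_gt0.
have s0 := fine_geo_gt0.
(* For [rc = 1] the conjugate exponent is infinite; here [theta = eta], and regrouping gives the
   bound directly. *)
rewrite /ell; case: (eqVneq rc 1%R) => [e1|ne1].
  rewrite e1 invr1 !poweRe1; last 2 first.
  - by apply: esum_ge0 => Q _; exact: poweR_ge0.
  - by apply: esum_ge0 => P _; exact: poweR_ge0.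
  rewrite (_ : \esum_(P in _) Op a P `^ 1 = \esum_(P in [set: D]) Op a P); last first.
    apply: eq_esum => P _; rewrite poweRe1//; apply: esum_ge0 => Q _.
    by apply: esum_ge0 => z _; rewrite lee_fin !mulr_ge0// exprn_ge0// ltW.
  rewrite (_ : \esum_(Q in _) (a Q)%:E `^ 1 = \esum_(Q in [set: D]) (a Q)%:E); last first.
    by apply: eq_esum => Q _; rewrite poweRe1// lee_fin.
  rewrite esum_regroupr; last by move=> Q z; rewrite mulr_ge0// exprn_ge0// ltW.
  by rewrite -sum_geo// thetaE e1 invr1 subrr powRr0 mulr1.
have {ne1} rc1' : (1 < rc)%R by rewrite lt_neqAle eq_sym ne1.
have q1 := conj_gt1 rc1'; set q := hconj rc in q1.
have q0 : (0 < q)%R by apply: lt_trans q1.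
have qV : (q^-1 = 1 - rc^-1)%R by exact: conjV.
have bpow (b : bool) (y s : R) : (0 < s)%R -> ((b%:R * y) `^ s = b%:R * y `^ s)%R.
  by move=> s0'; case: b; rewrite ?mul1r// !mul0r powR0// gt_eqF.
have main P : Op a P `^ rc <=
   ((fine geo) `^ (rc / q))%:E * \esum_(Q in [set: D]) \esum_(z in [set: Z])
     (((tgt Q z == P)%:R * (a Q `^ rc * eta ^+ z.1))%R)%:E.
  pose A (y : D * Z) : \bar R := (((tgt y.1 y.2 == P)%:R * (a y.1 * (eta ^+ y.2.1) `^ rc^-1))%R)%:E.
  pose B (y : D * Z) : \bar R := (((tgt y.1 y.2 == P)%:R * ((eta * kappa) ^+ y.2.1) `^ q^-1)%R)%:E.
  have e0 k : (0 <= eta ^+ k)%R by rewrite exprn_ge0// ltW.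
  have ek0 k : (0 <= (eta * kappa) ^+ k)%R by rewrite exprn_ge0// mulr_ge0// ltW.
  have A0 y : 0 <= A y by rewrite lee_fin !mulr_ge0 ?powR_ge0.
  have B0 y : 0 <= B y by rewrite lee_fin !mulr_ge0 ?powR_ge0.
  have -> : Op a P = \esum_(y in [set: D * Z]) (A y * B y).
    rewrite esum_pair; last by move=> y; rewrite mule_ge0.
    apply: eq_esum => Q _; apply: eq_esum => z _; rewrite /A /B /= -EFinM; congr EFin.
    case: eqP => _; rewrite ?mul0r// !mul1r -mulrA; congr (_ * _)%R.
    rewrite exprMn powRM ?exprn_ge0 ?(ltW k0) ?(ltW eta0)// mulrA -powRD; last first.
      by rewrite (gt_eqF (exprn_gt0 _ eta0)) implybT.
    rewrite qV addrC subrK powRr1// thetaE exprMn; congr (_ * _)%R.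
    by rewrite -!powR_mulrn ?powR_ge0 ?(ltW k0)// -!powRrM mulrC.
  have V := @esum_hoelder _ _ _ _ rc q A0 B0 rc0 q0.
  apply: (@le_trans _ _ (((\esum_(i in [set: D * Z]) A i `^ rc) `^ rc^-1 *
     (\esum_(i in [set: D * Z]) B i `^ q) `^ q^-1) `^ rc)).
    apply: le_pow; [exact: ltW|by apply: esum_ge0 => y _; rewrite mule_ge0|].
    by apply: V; rewrite qV addrC subrK.
  rewrite poweRM ?poweR_ge0// powVK ?gt_eqF//; last by apply: esum_ge0 => y _; exact: poweR_ge0.
  rewrite -poweRrM muleC [(q^-1 * rc)%R]mulrC; apply: lee_pmul.
  - exact: poweR_ge0.
  - by apply: esum_ge0 => y _; exact: poweR_ge0.
  - rewrite -poweR_EFin -geoE; apply: le_pow.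
    + by rewrite mulr_ge0// ?invr_ge0 ltW.
    + by apply: esum_ge0 => y _; exact: poweR_ge0.
    + apply: le_trans (kappa_geo P); rewrite esum_pair; last by move=> y; exact: poweR_ge0.
      apply: le_esum => Q _; apply: le_esum => z _; rewrite /B /= bpow//.
      by rewrite -powRrM mulVf ?gt_eqF// powRr1.
  - rewrite esum_pair; last by move=> y; exact: poweR_ge0.
    apply: le_esum => Q _; apply: le_esum => z _; rewrite /A /= bpow//.
    by rewrite powRM ?powR_ge0// -powRrM mulVf ?gt_eqF// powRr1.
have w0 Q z : (0 <= a Q `^ rc * eta ^+ z.1)%R by rewrite mulr_ge0 ?powR_ge0// exprn_ge0// ltW.
apply: (@le_trans _ _ ((((fine geo) `^ (rc / q))%:E * (geo * \esum_(Q in [set: D]) (a Q `^ rc)%:E)) `^ rc^-1)).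
  apply: le_pow; [by rewrite invr_ge0 ltW|by apply: esum_ge0 => P _; exact: poweR_ge0|].
  rewrite -sum_geo; last by move=> Q; exact: powR_ge0.
  rewrite -esum_regroupr// -esumZ ?powR_ge0//; last first.
    by move=> P; apply: esum_ge0 => Q _; apply: esum_ge0 => z _; rewrite lee_fin mulr_ge0.
  by apply: le_esum => P _; exact: main.
rewrite muleA geoE -EFinM poweRM ?lee_fin ?mulr_ge0 ?powR_ge0 ?(ltW s0)//; last first.
  by apply: esum_ge0 => Q _; rewrite lee_fin powR_ge0.
rewrite poweR_EFin powRM ?powR_ge0 ?(ltW s0)// -powRrM mulrAC mulfV ?gt_eqF// mul1r -powRD; last first.
  by rewrite (gt_eqF s0) implybT.
by rewrite qV subrK powRr1// ltW.
Qed.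

Lemma ell_ge (a : D -> \bar R) P : (forall Q, 0 <= a Q) -> a P <= ell a.
Proof.
move=> a0; apply: (@le_pow_inv _ _ _ rc) => //; first exact: poweR_ge0.
rewrite powVK ?gt_eqF//; last by apply: esum_ge0 => Q _; exact: poweR_ge0.
by apply: (@ge_esum _ _ (fun Q => a Q `^ rc) P) => Q; exact: poweR_ge0.
Qed.

Lemma ell_ge0 a : 0 <= ell a. Proof. exact: poweR_ge0. Qed.

Lemma ellZ (c : R) (a : D -> \bar R) : (0 <= c)%R -> (forall Q, 0 <= a Q) ->
  ell (fun Q => c%:E * a Q) = c%:E * ell a.
Proof.
move=> c0 a0; rewrite /ell.
rewrite (_ : \esum_(Q in _) _ = (c `^ rc)%:E * \esum_(Q in [set: D]) a Q `^ rc).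
  rewrite poweRM ?lee_fin ?powR_ge0//; last by apply: esum_ge0 => Q _; exact: poweR_ge0.
  by rewrite -poweR_EFin powK ?gt_eqF.
rewrite -esumZ ?powR_ge0//; last by move=> Q; exact: poweR_ge0.
by apply: eq_esum => Q _; rewrite poweRM ?poweR_EFin.
Qed.

End bound.
End ancestor_operator.

(** * Sums of complex families along finite sets *)

Section complex_sums.
Context {R : realType}.

Lemma modulus_ge0 (z : R[i]) : 0 <= modulus z.
Proof. by case: z => a b; rewrite /modulus lee_fin sqrtr_ge0. Qed.

Lemma modulus_real (a : R) : modulus (a%:C)%C = `|a|%:E.
Proof. by rewrite /modulus /= expr0n /= addr0 sqrtr_sqr. Qed.

Lemma normC_normc (z : R[i]) : `|z|%R = ((Normc.normc z)%:C)%C.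
Proof. by case: z => a b; rewrite normc_def. Qed.

Lemma normcD (z w : R[i]) : (Normc.normc (z + w) <= Normc.normc z + Normc.normc w)%R.
Proof.
by have := ler_normD z w; rewrite !normC_normc -rmorphD /= lecR.
Qed.

Lemma measurable_modulus d (T : measurableType d) (g : T -> R[i]) :
  measurable_fun setT (fun x => complex.Re (g x)) ->
  measurable_fun setT (fun x => complex.Im (g x)) ->
  nnm (fun x => modulus (g x)).
Proof.
move=> mR mI; split; last by move=> x; exact: modulus_ge0.
rewrite (_ : (fun x => _) = fun x => (Num.sqrt (complex.Re (g x) ^+ 2 + complex.Im (g x) ^+ 2))%:E); last first.
  by apply/funext => x; rewrite /modulus; case: (g x).
apply/measurable_EFinP.
apply: (measurableT_comp (f := @Num.sqrt R)).
  exact: (continuous_measurable_fun (@sqrt_continuous R)).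
by apply: measurable_funD; exact: measurable_funX.
Qed.

Section sums.
Context {I : choiceType}.
Implicit Types (a : I -> R[i]) (c : I -> R).

Lemma partial_sumE (V : zmodType) (a : I -> V) (A : {fset I}) :
  summability.partial_sum a A = (\sum_(i <- A) a i)%R.
Proof. by rewrite /summability.partial_sum big_seq_fsetE. Qed.

Lemma esum_ge_fset c (A : {fset I}) : (forall i, 0 <= c i)%R ->
  (\sum_(i <- A) c i)%R%:E <= \esum_(i in [set: I]) (c i)%:E.
Proof.
move=> c0; apply: esum_ge; exists [set` A]; first by split => //; exact: finite_fset.
by rewrite fsbig_finite ?set_fsetK ?sumEFin//; exact: finite_fset.
Qed.

Lemma sums_to_norm a s : sums_to a s ->
  modulus s <= \esum_(i in [set: I]) modulus (a i).
Proof.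
move=> h; apply/lee_addgt0Pr => e e0.
have e0' : (0 < (e%:C)%C :> R[i])%R by rewrite ltcR.
have hF := @summability.totally_filter I.
have [A hA] := filter_ex (@cvgr_dist_lt _ (R[i])^o _ _ _ (summability.partial_sum a) s h _ e0').
have {}hA : (Normc.normc (s - summability.partial_sum a A) <= e)%R.
  by move: hA; rewrite normC_normc /= ltcR => /ltW.
have n0 z : (0 <= Normc.normc z :> R)%R by have := modulus_ge0 z; rewrite lee_fin.
apply: (@le_trans _ _ ((\sum_(i <- A) Normc.normc (a i))%R%:E + e%:E)); last first.
  by rewrite leeD2r//; exact: (esum_ge_fset (c := fun i => Normc.normc (a i))).
rewrite -EFinD lee_fin -[s](subrK (summability.partial_sum a A)) addrC.
apply: le_trans (normcD _ _) _; rewrite lerD// partial_sumE.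
by elim/big_ind2 : _ => [|x x' y y' h1 h2|//]; [rewrite Normc.normc0|apply: le_trans (normcD _ _) (lerD h1 h2)].
Qed.

(** Some finite partial sum exceeds s - e, and those over larger sets stay between it and [s]. *)
Lemma sums_to_real c (s : R) : (forall i, 0 <= c i)%R ->
  \esum_(i in [set: I]) (c i)%:E = s%:E ->
  sums_to (fun i => ((c i)%:C)%C) (s%:C)%C.
Proof.
move=> c0 h; have hF := @summability.totally_filter I.
apply/(@cvgrPdist_lt _ (R[i])^o) => e e0.
have [er ei] : (0 < complex.Re e)%R /\ complex.Im e = 0%R.
  by move: e0; rewrite ltcE /= => /andP[/eqP -> ->].
have eE : e = ((complex.Re e)%:C)%C by case: e ei {e0 er} => x y /= ->.
have : (s - complex.Re e)%R%:E < s%:E by rewrite lte_fin ltrBlDr ltrDl.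
rewrite -h => /ereal_sup_gt[_ [X [finX _]] <-] hX.
exists (fset_set X) => //= A XA.
rewrite partial_sumE -rmorph_sum -rmorphB normC_normc /= expr0n /= addr0 sqrtr_sqr eE ltcR.
have le1 : (\sum_(i <- A) c i <= s)%R by rewrite -lee_fin -h; exact: esum_ge_fset.
rewrite ger0_norm ?subr_ge0// ltrBlDr -ltrBlDl.
move: hX; rewrite fsbig_finite//= sumEFin lte_fin => /lt_le_trans; apply.
by rewrite [leRHS](big_fsetID _ (mem (fset_set X)))/= (_ : [fset x in A | x \in mem (fset_set X)]%fset = fset_set X) ?lerDl ?sumr_ge0//; apply/fsetP => i; rewrite !inE/=; case: (boolP (i \in fset_set X)); rewrite ?andbF ?andbT// => /(fsubsetP XA) ->.
Qed.

End sums.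
End complex_sums.

(** * Countable almost-everywhere statements and truncated quotients *)

Section misc.
Context {R : realType}.

Lemma ae_count d (T : measurableType d) (mu : {measure set T -> \bar R}) (I : countType)
    (P : I -> T -> Prop) : (forall i, \forall x \ae mu, P i x) ->
  \forall x \ae mu, forall i, P i x.
Proof.
move=> h.
have : \forall x \ae mu, forall k : nat, if pickle_inv k is Some i then P i x else True.
  by apply/ae_foralln => k; case: pickle_inv => [i|]//; exact: aeW.
by apply: filterS => x hx i; have := hx (choice.pickle i); rewrite pickleK_inv.
Qed.

Lemma nnm_fine d (T : measurableType d) (f : T -> \bar R) : nnm f -> nnm (fun x => (fine (f x))%:E).
Proof.
move=> [mf f0]; split; last by move=> x; rewrite lee_fin fine_ge0.
by apply/measurable_EFinP; exact: measurableT_comp.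
Qed.

Lemma le_lnorm (u : \bar R) (a : nat -> \bar R) j : 1 < u -> (forall i, 0 <= a i) ->
  a j <= lnorm u a.
Proof.
move=> u1 a0; have n0 i : 0 <= a i by []; case: u u1 => [s| |]//= s1.
  rewrite lte_fin in s1; have s0 : (0 < s)%R by apply: lt_trans s1.
  apply: (@le_pow_inv _ _ _ s) => //; first exact: poweR_ge0.
  rewrite powVK ?gt_eqF//; last by apply: esum_ge0 => i _; exact: poweR_ge0.
  rewrite -{1}(gee0_abs (a0 j)); apply: (@ge_esum _ _ (fun i => `|a i| `^ s) j) => i; exact: poweR_ge0.
by rewrite -{1}(gee0_abs (a0 j)); apply: ereal_sup_ubound; exists j.
Qed.

(* Outside [0 < y < +oo] the quotient is 0. *)
Definition quot (x y : \bar R) : R := fine (x * y `^ (-1)).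

Lemma quot_ge0 x y : 0 <= x -> (0 <= quot x y)%R.
Proof. by move=> x0; rewrite fine_ge0// mule_ge0// poweR_ge0. Qed.

Lemma quotK x y : 0 <= x -> x <= y -> y < +oo -> (quot x y)%:E * y = x.
Proof.
move=> x0 xy; case: y xy => [y| |]//; last by move=> /(le_trans x0).
case: x x0 => [x| |]// x0 xy _; rewrite !lee_fin in x0 xy.
rewrite /quot /= -EFinM; have [y0|y0] := eqVneq y 0%R.
  by rewrite y0 in xy *; rewrite mulr0; congr EFin; apply/eqP; rewrite eq_le x0 xy.
by rewrite powR_inv1 ?(le_trans x0 xy)// -mulrA mulVf// mulr1.
Qed.


Lemma quot_le1 x y : 0 <= x -> x <= y -> (quot x y <= 1)%R.
Proof.
move=> x0; case: y => [y| |]; last by move=> /(le_trans x0).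
  case: x x0 => [x| |]// x0 xy; rewrite !lee_fin in x0 xy.
  have y0 := le_trans x0 xy; rewrite /quot /= powR_inv1//.
  have [->|yn0] := eqVneq y 0%R; first by rewrite invr0 mulr0.
  by rewrite ler_pdivrMr ?mul1r// lt0r yn0.
move=> _; rewrite /quot poweRyr ?oppr_eq0 ?oner_neq0//=.
by have [->|xn0] := eqVneq x 0; [rewrite mul0e|rewrite gt0_muley ?lt0e ?xn0].
Qed.

Lemma nnm_quot d (T : measurableType d) (f g : T -> \bar R) : nnm f -> nnm g ->
  nnm (fun x => (quot (f x) (g x))%:E).
Proof. by move=> nf ng; apply: nnm_fine; apply: nnmM => //; exact: nnm_pow. Qed.

End misc.

(** * Regrouping the pieces into scalar blocks *)

Section decomposition.
Context {R : realType} (n : nat) (p : n.-tuple R) (t : R) (u : \bar R) (rc eta : R).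
Local Notation mu := (lebesgue_Rn R n).
Local Notation D := (dyadic_index n).
Local Notation Z := (nat * n.-tuple 'I_3)%type.
Local Notation anc := (@anc R n).
Local Notation tgt := (@tgt R n).
Local Notation sigma := (sigma p).
Local Notation bb := (bb p t).
Local Notation theta := (theta n t).
Local Notation N := (mixed_norm (ex [tuple of map hconj p])).
Local Notation ell := (@ell R n rc).
Implicit Types (x : Rn R n) (P Q : D).
Hypotheses (n0 : (0 < n)%N) (p1 : forall i, (1 < tnth p i)%R) (t0 : (0 < t)%R) (u1 : 1 < u).
Hypotheses (eta0 : (0 < eta)%R) (eta1 : (eta < 1)%R) (rc1 : (1 <= rc)%R)
  (thetaE' : (theta = eta * kappa n `^ (1 - rc^-1))%R).
(** Controls the ancestors of a unit cube: either their block bounds decay geometrically, or these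
    are at most 1 and the coefficients are summable. *)
Hypothesis ts : (t^-1 < sigma)%R \/ (t^-1 <= sigma)%R /\ rc = 1%R.

Let nN : nice N. Proof. exact: niceN p1. Qed.
Let term_ge0 (b : bool) (x y : R) : (0 <= x)%R -> (0 <= y)%R -> 0 <= ((b%:R * (x * y))%R)%:E.
Proof. by move=> x0 y0; rewrite lee_fin; case: b; rewrite ?mul0r// mul1r mulr_ge0. Qed.

Let th0 : (0 < theta)%R. Proof. exact: theta_gt0. Qed.
Let thk k : (0 <= theta ^+ k)%R. Proof. exact/exprn_ge0/ltW. Qed.
Let bbg g : (0 <= bb g)%R. Proof. exact/ltW/bb_gt0. Qed.

Lemma niceN_esum (I : countType) (f : I -> Rn R n -> \bar R) : (forall i, nnm (f i)) ->
  N (fun x => \esum_(i in [set: I]) f i x) <= \esum_(i in [set: I]) N (f i).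
Proof.
move=> nf; apply: esum_subadd => //; [by move=> i; exact: (nice_ge0 nN)|exact: (nice0 nN)|exact: nice_series nN].
Qed.

Lemma int_cube Q (f : Rn R n -> \bar R) : nnm f -> (forall x, ~ dyadic_cube Q x -> f x = 0) ->
  \int[mu]_x f x <= (vol n Q.1 `^ sigma)%:E * N f.
Proof.
move=> nf supp; apply: le_trans (cube_hoelder n0 p1 Q nf).
rewrite le_eqVlt; apply/orP; left; apply/eqP; apply: eq_integral => x _.
by have [h|h] := pselect (dyadic_cube Q x); [rewrite ind1// mul1e|rewrite supp// mule0].
Qed.

Section parts.
Variables (C : R) (a : D -> R) (psi : D -> nat -> Rn R n -> \bar R).
Hypotheses (C0 : (0 < C)%R) (a0 : forall Q, (0 <= a Q)%R) (aoo : ell (fun Q => (a Q)%:E) < +oo).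
Hypotheses (npsi : forall Q j, nnm (psi Q j))
  (supp : forall Q j x, ~ dyadic_cube Q x -> psi Q j x = 0)
  (hC : forall Q z, N (pieces u (psi Q) Q z) <= (C * theta ^+ z.1 * bb (Q.1 - z.1%:Z))%:E).

(** The function W_P of the overview. *)
Definition part P x : \bar R :=
  \esum_(Q in [set: D]) \esum_(z in [set: Z])
    ((tgt Q z == P)%:R%:E * ((a Q)%:E * pieces u (psi Q) Q z x)).

Let npc Q z : nnm (pieces u (psi Q) Q z).
Proof. exact: nnm_pieces. Qed.

Let nterm P Q z : nnm (fun x => (tgt Q z == P)%:R%:E * ((a Q)%:E * pieces u (psi Q) Q z x)).
Proof. by apply: nnmZ; [rewrite lee_fin|apply: nnmZ; rewrite ?lee_fin]. Qed.

Lemma nnm_part P : nnm (part P).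
Proof. by apply: nnm_esum => Q; exact: nnm_esum. Qed.

Lemma part_supp P x : ~ dyadic_cube P x -> part P x = 0.
Proof.
move=> Px; apply: esum_eq0 => Q; apply: esum_eq0 => z.
case: eqP => [h|_]; last by rewrite mul0e.
by rewrite /pieces ind0 ?mul0e ?mule0// -/(tgt Q z) h.
Qed.

Lemma esum_part x : \esum_(P in [set: D]) part P x =
  \esum_(Q in [set: D]) (a Q)%:E * \esum_(z in [set: Z]) pieces u (psi Q) Q z x.
Proof.
rewrite /part esum_regroup; last first.
  by move=> Q z; rewrite mule_ge0 ?lee_fin// (nnm_ge0 (npc Q z)).
by apply: eq_esum => Q _; rewrite esumZ// => z; exact: (nnm_ge0 (npc Q z)).
Qed.

Definition pcoef P : R := (C * fine (Op theta a P))%R.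

Lemma Op_ge0 (b : D -> R) P : (forall Q, 0 <= b Q)%R -> 0 <= Op theta b P.
Proof.
move=> b0; apply: esum_ge0 => Q _; apply: esum_ge0 => z _.
by rewrite lee_fin !mulr_ge0// exprn_ge0// ltW.
Qed.

Lemma Op_lty (b : D -> R) P : (forall Q, 0 <= b Q)%R -> ell (fun Q => (b Q)%:E) < +oo ->
  Op theta b P < +oo.
Proof.
move=> b0 boo; apply: (@le_lt_trans _ _ (ell (Op theta b))).
  by apply: (ell_ge rc1) => Q; exact: Op_ge0.
apply: (le_lt_trans (Op_bound eta0 eta1 rc1 thetaE' b0)).
rewrite (geoE n eta0 eta1) lte_mul_pinfty// lee_fin ltW// fine_geo_gt0//.
Qed.

Lemma pcoef_ge0 P : (0 <= pcoef P)%R.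
Proof. by rewrite mulr_ge0 ?(ltW C0)// fine_ge0// Op_ge0. Qed.

Lemma pcoefE P : (pcoef P)%:E = C%:E * Op theta a P.
Proof. by rewrite EFinM fineK// ge0_fin_numE ?Op_lty// Op_ge0. Qed.

Lemma pcoef_ell : ell (fun P => (pcoef P)%:E) <= (C * fine (geo n eta))%:E * ell (fun Q => (a Q)%:E).
Proof.
under [X in ell X]eq_fun do rewrite pcoefE.
rewrite (ellZ rc1) ?(ltW C0)//; last by move=> P; exact: Op_ge0.
rewrite EFinM -muleA -(geoE n eta0 eta1) lee_wpmul2l ?lee_fin ?(ltW C0)//.
exact: (Op_bound eta0 eta1 rc1 thetaE' a0).
Qed.

Lemma part_norm P : N (part P) <= (pcoef P * bb P.1)%:E.
Proof.
have bb0 := bb_gt0 p t P.1.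
rewrite EFinM pcoefE -muleA [Op _ _ _ * _]muleC muleA -EFinM.
rewrite /Op -esumZ ?mulr_ge0 ?(ltW C0) ?(ltW bb0)//; last first.
  move=> Q; apply: esum_ge0 => z _; by rewrite lee_fin !mulr_ge0// exprn_ge0// ltW.
apply: le_trans (niceN_esum _) _; first by move=> Q; exact: nnm_esum.
apply: le_esum => Q _; rewrite -esumZ ?mulr_ge0 ?(ltW C0) ?(ltW bb0)//; last first.
  by move=> z; rewrite lee_fin !mulr_ge0// exprn_ge0// ltW.
apply: le_trans (niceN_esum (nterm P Q)) _; apply: le_esum => z _.
rewrite (niceZ nN)//; last by apply: nnmZ; rewrite ?lee_fin.
rewrite (niceZ nN)// -!EFinM.
case: eqP => [h|_]; last by rewrite mul0e mul0r mulr0.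
rewrite mul1e mul1r; apply: (@le_trans _ _ ((a Q)%:E * (C * theta ^+ z.1 * bb (Q.1 - z.1%:Z))%:E)).
  by rewrite lee_wpmul2l ?lee_fin.
rewrite -EFinM lee_fin (_ : (Q.1 - z.1%:Z)%R = P.1); last by rewrite -h.
rewrite le_eqVlt; apply/orP; left; apply/eqP; ring.
Qed.

(** Hoelder on [P] gives |P|^sigma |P|^(1/t - sigma) = |P|^(1/t), which is theta^k because [P0] has
    volume 1. *)
Lemma int_part_small P0 P k : P0.1 = 0%R -> anc k P = P0 ->
  \int[mu]_x part P x <= (pcoef P * theta ^+ k)%:E.
Proof.
move=> g0 h; apply: le_trans (int_cube (nnm_part P) (@part_supp P)) _.
have vP := @vol_gt0 R n P.1.
apply: (@le_trans _ _ ((vol n P.1 `^ sigma)%:E * (pcoef P * bb P.1)%:E)).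
  by rewrite lee_wpmul2l ?lee_fin ?powR_ge0// part_norm.
rewrite -EFinM lee_fin mulrCA ler_wpM2l ?pcoef_ge0// /bb -powRD; last by rewrite (gt_eqF vP) implybT.
rewrite addrCA subrr addr0 (thetaE _ t0 _ k).
rewrite (_ : (P.1 - k%:Z)%R = 0%R); last by rewrite -g0 -h.
by rewrite /vol oppr0 expr0z expr1n powR1 mulr1.
Qed.

Lemma int_part_large P0 P : P0.1 = 0%R ->
  \int[mu]_x (ind (dyadic_cube P0) x * part P x) <= (pcoef P * bb P.1)%:E.
Proof.
move=> g0; apply: le_trans (part_norm P); apply: le_trans (cube_hoelder n0 p1 P0 (nnm_part P)) _.
by rewrite g0 /vol oppr0 expr0z expr1n powR1 mul1e.
Qed.

(** A cube meeting the unit cube [P0] is either contained in it, and its whole integral is used, or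
    an ancestor of it, and Hoelder is applied on [P0]. The two sums hold these alternatives in a
    form that can be summed over [P]. *)
Lemma int_part P0 P : P0.1 = 0%R ->
  \int[mu]_x (ind (dyadic_cube P0) x * part P x) <=
  \esum_(z in [set: Z]) (((tgt P z == P0)%:R * (pcoef P * theta ^+ z.1))%R)%:E +
  \esum_(k in [set: nat]) (((anc k P0 == P)%:R * (pcoef P * bb (- k%:Z)))%R)%:E.
Proof.
move=> g0; have m0 := pcoef_ge0 P.
have s1 z : 0 <= (((tgt P z == P0)%:R * (pcoef P * theta ^+ z.1))%R)%:E.
  exact: term_ge0.
have s2 k : 0 <= (((anc k P0 == P)%:R * (pcoef P * bb (- k%:Z)))%R)%:E.
  exact: term_ge0.
have e1 := esum_ge0 (fun z (_ : [set: Z] z) => s1 z).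
have e2 := esum_ge0 (fun k (_ : [set: nat] k) => s2 k).
have nI : nnm (fun x => ind (dyadic_cube P0) x * part P x).
  apply: nnmM (nnm_part P); apply: nnm_ind; exact: measurable_dyadic_cube.
have [[x [x0 xP]]|none] := pselect (exists x : Rn R n, dyadic_cube P0 x /\ dyadic_cube P x); last first.
  rewrite integral0_eq ?adde_ge0// => x _.
  have [h|h] := pselect (dyadic_cube P0 x); last by rewrite ind0// mul0e.
  by rewrite part_supp ?mule0// => h'; apply: none; exists x.
have E0 : cube_at 0 x = P0 by move/dyadic_cubeP : x0; rewrite g0.
have EP : cube_at P.1 x = P by move/dyadic_cubeP : xP.
have [g|g] := leP 0%R P.1.
  have h : anc `|P.1|%N P = P0 by rewrite -(ancE _ xP) gez0_abs// subrr.
  apply: (@le_trans _ _ (\int[mu]_x part P x)).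
    apply: le_int => //; first exact: nnm_part.
    move=> y; rewrite -[leRHS]mul1e lee_wpmul2r ?ind_le1//; exact: (nnm_ge0 (nnm_part P)).
  apply: le_trans (int_part_small g0 h) _; rewrite -[leLHS]adde0 leeD//.
  have := @ge_esum _ _ _ (`|P.1|%N, [tuple (inord 1 : 'I_3) | i < n]) s1.
  by rewrite /tgt /= nb_id h eqxx mul1r.
have gE : (- `|P.1|%N%:Z)%R = P.1 by clear -g; lia.
have h : anc `|P.1|%N P0 = P by rewrite -(ancE _ x0) g0 sub0r gE.
apply: le_trans (int_part_large P g0) _; rewrite -[leLHS]add0e leeD//.
have := @ge_esum _ _ _ `|P.1|%N s2; by rewrite h eqxx mul1r gE.
Qed.

Lemma bb_pow k : (bb (- k%:Z) = ((2 ^+ n) `^ (t^-1 - sigma)) ^+ k)%R.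
Proof.
rewrite /bb /vol opprK -exprnP -exprM mulnC exprM.
have y0 : (0 <= 2 ^+ n :> R)%R by exact: exprn_ge0.
by rewrite -(powR_mulrn k y0) -(powR_mulrn k (powR_ge0 _ _)) -!powRrM mulrC.
Qed.

(** If 1/t < sigma, bound every coefficient by the l^r' norm and sum a geometric series over the
    ancestors. If r' = 1, the bounds are at most 1 and the coefficients themselves are summed, each
    ancestor occurring for one [k] only. *)
Lemma sum_large P0 : P0.1 = 0%R -> ell (fun P => (pcoef P)%:E) < +oo ->
  \esum_(P in [set: D]) \esum_(k in [set: nat])
    (((anc k P0 == P)%:R * (pcoef P * bb (- k%:Z)))%R)%:E < +oo.
Proof.
move=> g0 moo.
have s2 P k : 0 <= (((anc k P0 == P)%:R * (pcoef P * bb (- k%:Z)))%R)%:E.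
  by apply: term_ge0 => //; exact: pcoef_ge0.
have n2 : (1 < 2 ^+ n :> R)%R by rewrite exprn_egt1 ?ltr1n// -lt0n.
case: ts => [lt|[le r1]].
  rewrite esum_swap//.
  pose rho : R := ((2 ^+ n) `^ (t^-1 - sigma))%R.
  have rho0 : (0 < rho)%R by rewrite powR_gt0// exprn_gt0.
  have rho1 : (rho < 1)%R.
    have e0 : (0 < sigma - t^-1)%R by rewrite subr_gt0.
    rewrite /rho -opprB powRN invf_lt1 ?powR_gt0 ?exprn_gt0//.
    have := @gt0_ltr_powR _ _ e0 1%R (2 ^+ n)%R.
    by rewrite !nnegrE powR1 exprn_ge0//; apply.
  pose M := fine (ell (fun P => (pcoef P)%:E)).
  have ME : M%:E = ell (fun P => (pcoef P)%:E) by rewrite fineK// ge0_fin_numE// ell_ge0.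
  have M0 : (0 <= M)%R by rewrite fine_ge0// ell_ge0.
  apply: (@le_lt_trans _ _ (\esum_(k in [set: nat]) (M%:E * (rho ^+ k)%:E))); last first.
    rewrite esumZ//; last by move=> k; rewrite lee_fin exprn_ge0// ltW.
    by rewrite lte_mul_pinfty ?lee_fin// geometric_lty.
  apply: le_esum => k _; rewrite (@esum_single _ _ _ (anc k P0))//.
    rewrite eqxx mul1r bb_pow -EFinM lee_fin ler_wpM2r ?exprn_ge0 ?(ltW rho0)//.
    rewrite -lee_fin ME; apply: (@ell_ge _ _ _ rc1 (fun P => (pcoef P)%:E)) => P.
    by rewrite lee_fin pcoef_ge0.
  by move=> P; rewrite eq_sym => /negPf ->; rewrite mul0r.
apply: le_lt_trans moo; rewrite /ell r1 invr1 poweRe1; last first.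
  by apply: esum_ge0 => P _; exact: poweR_ge0.
apply: le_esum => P _; rewrite poweRe1 ?lee_fin ?pcoef_ge0//.
have [[k hk]|none] := pselect (exists k, anc k P0 = P); last first.
  rewrite esum_eq0 ?lee_fin ?pcoef_ge0// => k.
  by case: eqP => [h|_]; [case: none; exists k|rewrite mul0r].
rewrite (@esum_single _ _ _ k)//.
  rewrite lee_fin hk eqxx mul1r -[leRHS]mulr1 ler_wpM2l ?pcoef_ge0// bb_pow.
  have := @ler_powR _ (2 ^+ n)%R (ltW n2) (t^-1 - sigma)%R 0%R.
  by rewrite powRr0 subr_le0 le => /(_ isT) h; rewrite exprn_ile1// powR_ge0.
move=> k' ne; case: eqP => [h|_]; last by rewrite mul0r.
exfalso; move: ne; apply/negP/negPn/eqP.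
by have := congr1 fst (etrans h (esym hk)); rewrite /= g0 !sub0r => /oppr_inj[].

Qed.

(** Countably many unit cubes cover the space, and the integral over each is finite: the sum over
    small cubes is a value of [Op] at the collected coefficients, hence finite by a second use of
    [Op_bound]. *)
Lemma sum_part_lty : \forall x \ae mu, \esum_(P in [set: D]) part P x < +oo.
Proof.
have moo : ell (fun P => (pcoef P)%:E) < +oo.
  apply: le_lt_trans pcoef_ell _; rewrite lte_mul_pinfty// lee_fin mulr_ge0 ?(ltW C0)//.
  by rewrite ltW// fine_geo_gt0.
have nS : nnm (fun x => \esum_(P in [set: D]) part P x) by apply: nnm_esum => P; exact: nnm_part.
have nI P0 := @nnm_ind R _ _ _ (@measurable_dyadic_cube R n P0).
have h (P0 : D) : \forall x \ae mu, P0.1 = 0%R ->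
    ind (dyadic_cube P0) x * (\esum_(P in [set: D]) part P x) < +oo.
  have [g0|g0] := pselect (P0.1 = 0%R); last by apply: aeW => x /g0.
  suff h' : \int[mu]_x (ind (dyadic_cube P0) x * \esum_(P in [set: D]) part P x) < +oo.
    by have := int_fin_ae (nnmM (nI P0) nS) h'; apply: filterS => x hx _.
  rewrite (_ : \int[mu]_x _ = \esum_(P in [set: D]) \int[mu]_x (ind (dyadic_cube P0) x * part P x)); last first.
    rewrite -int_esum; last by move=> P; apply: nnmM => //; exact: nnm_part.
    apply: eq_integral => x _.
    have [hx|hx] := pselect (dyadic_cube P0 x).
      by rewrite ind1// mul1e; apply: eq_esum => P _; rewrite mul1e.
    by rewrite ind0// mul0e esum_eq0// => P; rewrite mul0e.
  have s1 P z : 0 <= (((tgt P z == P0)%:R * (pcoef P * theta ^+ z.1))%R)%:E.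
    by apply: term_ge0 => //; exact: pcoef_ge0.
  have s2 P k : 0 <= (((anc k P0 == P)%:R * (pcoef P * bb (- k%:Z)))%R)%:E.
    by apply: term_ge0 => //; exact: pcoef_ge0.
  apply: le_lt_trans (le_esum (fun P _ => int_part P g0)) _.
  rewrite esumD; last 2 first.
    by move=> P _; apply: esum_ge0.
    by move=> P _; apply: esum_ge0.
  rewrite lte_add_pinfty ?sum_large//; exact: (Op_lty P0 pcoef_ge0 moo).
apply: filterS (ae_count h) => x hx.
have := hx (cube_at 0 x) erefl; rewrite ind1 ?mul1e//; exact: cube_atP.
Qed.

End parts.

Lemma block_decomposition : exists2 K : R, (0 < K)%R &
  forall (a : D -> R) (psi : D -> nat -> Rn R n -> \bar R) (F : Rn R n -> \bar R),
  (forall Q, 0 <= a Q)%R -> ell (fun Q => (a Q)%:E) < +oo ->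
  (forall Q j, nnm (psi Q j)) ->
  (forall Q j x, ~ dyadic_cube Q x -> psi Q j x = 0) ->
  (forall Q, N (fun x => lnorm u (fun j => psi Q j x)) <= (bb Q.1)%:E) ->
  nnm F ->
  (forall x, F x <= \esum_(Q in [set: D]) ((a Q)%:E * lnorm u (fun j => hlm (psi Q j) x))) ->
  exists (m : D -> R) (b : D -> Rn R n -> R),
    [/\ forall P, (0 <= m P)%R,
        ell (fun P => (m P)%:E) <= K%:E * ell (fun Q => (a Q)%:E),
        forall P, [/\ nnm (fun x => (b P x)%:E),
          forall x, ~ dyadic_cube P x -> b P x = 0%R & N (fun x => (b P x)%:E) <= (bb P.1)%:E] &
        \forall x \ae mu, F x < +oo /\
          \esum_(P in [set: D]) ((m P * b P x)%R)%:E = F x].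
Proof.
have [C1 C10 hC1] := mixed_norm_maximal (conjp1 p1) u1.
pose C := Num.max C1 (@tail_const R n).
have C0 : (0 < C)%R by rewrite lt_max C10.
exists (C * fine (geo n eta))%R; first by rewrite mulr_gt0// fine_geo_gt0.
move=> a psi F a0 aoo npsi supp hb nF Fle.
have hC Q z : N (pieces u (psi Q) Q z) <= (C * theta ^+ z.1 * bb (Q.1 - z.1%:Z))%:E.
  apply: (pieces_norm n0 p1 t0 u1 (npsi Q) (supp Q)) => //; first by rewrite le_max lexx orbT.
  apply: le_trans (hC1 _ (npsi Q)) _; rewrite lee_wpmul2r ?(nice_ge0 nN)//.
  by rewrite lee_fin le_max lexx.
pose W := part a psi; pose m := pcoef C a.
pose S x := \esum_(P in [set: D]) W P x.
have nW P : nnm (W P) by exact: nnm_part.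
have nS : nnm S by exact: nnm_esum.
have m0 P : (0 <= m P)%R by exact: pcoef_ge0.
have W0 P x := nnm_ge0 (nW P) x.
have FS x : F x <= S x.
  apply: le_trans (Fle x) _; rewrite /S /W esum_part//; apply: le_esum => Q _.
  by rewrite lee_wpmul2l ?lee_fin//; exact: (hl_le_pieces n0 t0 u1 (npsi Q) (@supp Q)).
(* The quotient is at most 1, so the block bound of W_P / m_P survives; where [m P] is 0 the
   division yields 0. *)
pose b P x := (quot (F x) (S x) * fine (W P x) / m P)%R.
have q0 x : (0 <= quot (F x) (S x))%R by apply: quot_ge0; exact: (nnm_ge0 nF).
have fW0 P x : (0 <= fine (W P x))%R by rewrite fine_ge0.
have b0 P x : (0 <= b P x)%R by rewrite divr_ge0// mulr_ge0.
have nb' P : nnm (fun x => (b P x)%:E).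
  under eq_fun do rewrite /b EFinM muleC.
  apply: nnmZ; first by rewrite lee_fin invr_ge0.
  under eq_fun do rewrite EFinM.
  by apply: nnmM; [exact: nnm_quot|exact: nnm_fine].
exists m, b; split => //.
- exact: pcoef_ell.
- move=> P; split => // [x Px|]; first by rewrite /b /W part_supp// mulr0 mul0r.
  have im0 : (0 <= (m P)^-1)%R by rewrite invr_ge0.
  apply: (@le_trans _ _ (N (fun x => ((m P)^-1)%:E * W P x))).
    apply: (nice_le nN) => //; first by apply: nnmZ; rewrite ?lee_fin.
    move=> x; rewrite /b EFinM muleC lee_wpmul2l ?lee_fin//.
    apply: (@le_trans _ _ (fine (W P x))%:E).
      by rewrite lee_fin -[leRHS]mul1r ler_wpM2r// quot_le1// (nnm_ge0 nF).
    by have := W0 P x; case: (W P x) => // *; rewrite leey.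
  rewrite (niceZ nN)//; apply: (@le_trans _ _ (((m P)^-1)%:E * (m P * bb P.1)%:E)).
    by rewrite lee_wpmul2l ?lee_fin//; exact: part_norm.
  rewrite -EFinM lee_fin mulrA; have [->|mn0] := eqVneq (m P) 0%R.
    by rewrite invr0 !mul0r ltW// bb_gt0.
  by rewrite mulVf// mul1r.
(* A part with zero coefficient has zero norm, hence zero integral, and vanishes almost everywhere,
   so nothing is lost by the division by 0. *)
have z0 : \forall x \ae mu, forall P, m P = 0%R -> W P x = 0.
  apply: ae_count => P; have [mP|mP] := pselect (m P = 0%R); last by apply: aeW => x /mP.
  have : \int[mu]_x W P x = 0.
    apply/eqP; rewrite eq_le int_ge0// andbT.
    apply: le_trans (int_cube (nW P) (@part_supp a psi P)) _.
    apply: (@le_trans _ _ ((vol n P.1 `^ sigma)%:E * (m P * bb P.1)%:E)).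
      by rewrite lee_wpmul2l ?lee_fin ?powR_ge0//; exact: part_norm.
    by rewrite mP mul0r mule0.
  by move/(int0_ae (nW P)); apply: filterS => x ->.
have Soo : \forall x \ae mu, S x < +oo by exact: sum_part_lty hC.
apply: filterS2 Soo z0 => x Sx zx; split; first exact: le_lt_trans (FS x) Sx.
have WS P : W P x <= S x by apply: (@ge_esum _ _ (fun P => W P x) P).
have E P : ((m P * b P x)%R)%:E = (quot (F x) (S x))%:E * W P x.
  rewrite /b; have [mP|mP] := eqVneq (m P) 0%R; first by rewrite mP mul0r zx// mule0.
  have fW : W P x \is a fin_num by rewrite ge0_fin_numE//; exact: le_lt_trans (WS P) Sx.
  by rewrite mulrC mulfVK// EFinM (fineK fW).
under eq_esum do rewrite E.
by rewrite esumZ// quotK// (nnm_ge0 nF).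
Qed.

End decomposition.

(** * From representations of G to representations of F *)

Section transfer.
Context {R : realType} (n : nat).
Local Notation mu := (lebesgue_Rn R n).
Local Notation D := (dyadic_index n).
Implicit Types (x : Rn R n) (P Q : D).

Lemma hlm0 x : hlm (fun _ : Rn R n => 0) x = 0.
Proof.
have n0 : @nnm R _ (Rn R n) (fun=> 0) by exact: nnm_cst.
apply/eqP; rewrite eq_le hlm_ge0// andbT.
apply: hlm_leP => c d d0 _; rewrite integral0 mule0 //.
Qed.

Lemma hlm_esum (f : D -> Rn R n -> \bar R) x : (forall Q, nnm (f Q)) ->
  hlm (fun y => \esum_(Q in [set: D]) f Q y) x <= \esum_(Q in [set: D]) hlm (f Q) x.
Proof.
move=> nf; apply: (esum_subadd (rho := fun g => hlm g x)) => //.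
- by move=> Q; exact: hlm_ge0.
- exact: hlm0.
- by move=> g ng; exact: hlm_series.
Qed.

(** Ensures that multiplication by f_j / G turns a scalar block into a vector-valued one. Where the
    norm is 0 or +oo all quotients are 0. *)
Lemma lnorm_quot (u : \bar R) (a : nat -> \bar R) : 1 < u -> (forall j, 0 <= a j) ->
  lnorm u (fun j => (quot (a j) (lnorm u a))%:E) <= 1.
Proof.
move=> u1 a0; have [H _] := @lnorm_nice_HL R u u1.
set y := lnorm u a.
have ay j : a j <= y by exact: le_lnorm.
have y0 : 0 <= y by exact: (nice_ge0 H).
have q0 j : (0 <= quot (a j) y)%R by exact: quot_ge0.
have zero : (forall j, quot (a j) y = 0%R) -> lnorm u (fun j => (quot (a j) y)%:E) <= 1.
  move=> h; rewrite (_ : (fun j => _) = fun=> 0); first by rewrite (nice0 H).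
  by apply/funext => j; rewrite h.
have [yoo|] := eqVneq y +oo.
  apply: zero => j; rewrite yoo /quot poweRyr ?oppr_eq0 ?oner_neq0//=.
  by have [->|an0] := eqVneq (a j) 0; [rewrite mul0e|rewrite gt0_muley// lt0e an0 a0].
rewrite -ltey => yoo; have [yz|yn0] := eqVneq y 0.
  apply: zero => j; rewrite (_ : a j = 0) /quot ?mul0e//.
  by apply/eqP; rewrite eq_le a0 andbT -yz.
have fy : y \is a fin_num by rewrite ge0_fin_numE.
have gy : (0 < fine y)%R by rewrite fine_gt0// lt0e yn0 y0.
have nq : @nnm R _ nat (fun j => (quot (a j) y)%:E) by split => // j; rewrite lee_fin.
rewrite -(@lee_pmul2l _ y) ?lt0e ?yn0// mule1 -{1}(fineK fy) -(niceZ H) ?(ltW gy)//.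
rewrite le_eqVlt; apply/orP; left; apply/eqP; congr (lnorm u _); apply/funext => j.
by rewrite fineK// muleC quotK.
Qed.

Context (p : n.-tuple R) (t : R) (r u : \bar R) (rc eta : R).
Hypotheses (n0 : (0 < n)%N) (p1 : forall i, (1 < tnth p i)%R) (t0 : (0 < t)%R) (u1 : 1 < u).
Hypotheses (eta0 : (0 < eta)%R) (eta1 : (eta < 1)%R) (rc1 : (1 <= rc)%R)
  (rE : hoelder_conjugate r = rc%:E)
  (thetaE' : (theta n t = eta * kappa n `^ (1 - rc^-1))%R).
Hypothesis ts : (t^-1 < sigma p)%R \/ (t^-1 <= sigma p)%R /\ rc = 1%R.

Lemma coeff_norm_ell (lam : D -> R[i]) :
  coeff_norm r lam = ell rc (fun Q => (Normc.normc (lam Q))%:E).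
Proof.
rewrite /coeff_norm rE /lnorm /ell; congr (_ `^ _); apply: eq_esum => Q _.
by rewrite gee0_abs// modulus_ge0.
Qed.

(** A block is only Lebesgue measurable. Its modulus is replaced by a Borel version, cut off by the
    indicator of the cube so that the support condition holds everywhere. *)
Lemma block_majorant (b : Rn R n -> R[i]) Q : is_block p t (dyadic_cube Q) b ->
  exists beta : Rn R n -> \bar R, [/\ nnm beta, forall x, beta x \is a fin_num,
    forall x, ~ dyadic_cube Q x -> beta x = 0,
    mixed_norm (ex [tuple of map hconj p]) beta <= (bb p t Q.1)%:E &
    \forall x \ae mu, modulus (b x) = beta x].
Proof.
move=> [[b' [mR mI hb]] supp hN].
have nb' := measurable_modulus mR mI.
have nI := @nnm_ind R _ _ _ (@measurable_dyadic_cube R n Q).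
pose beta x := ind (dyadic_cube Q) x * modulus (b' x).
have nbeta : nnm beta by exact: nnmM.
have ae : \forall x \ae mu, modulus (b x) = beta x.
  apply: filterS hb => x hx; rewrite /beta -hx.
  have [Qx|Qx] := pselect (dyadic_cube Q x); first by rewrite ind1// mul1e.
  by rewrite ind0// mul0e supp// /modulus Normc.normc0.
have fbeta x : beta x \is a fin_num.
  rewrite /beta; have [Qx|Qx] := pselect (dyadic_cube Q x).
    by rewrite ind1// mul1e.
  by rewrite ind0// mul0e.
have sbeta x : ~ dyadic_cube Q x -> beta x = 0 by move=> Qx; rewrite /beta ind0// mul0e.
exists beta; split => //.
move: hN; rewrite (conj_exponentsE p1) block_boundE (mixed_norm_ae (H := beta))// => [x|].
  exact: modulus_ge0.
exact: conjp1.
Qed.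

Lemma is_block_real (b : Rn R n -> R) P : nnm (fun x => (b x)%:E) ->
  (forall x, ~ dyadic_cube P x -> b x = 0%R) ->
  mixed_norm (ex [tuple of map hconj p]) (fun x => (b x)%:E) <= (bb p t P.1)%:E ->
  is_block p t (dyadic_cube P) (fun x => ((b x)%:C)%C).
Proof.
move=> [mb b0] supp hN; split.
- exists (fun x => ((b x)%:C)%C); split => /=; [exact/measurable_EFinP|exact: measurable_cst|exact: aeW].
- by move=> x /supp ->.
- rewrite (conj_exponentsE p1) block_boundE.
  rewrite (_ : (fun x => _) = fun x => (b x)%:E)//; apply/funext => x.
  by rewrite modulus_real ger0_norm// -lee_fin b0.
Qed.

(** Formulated for each coefficient family separately, with one constant, so that the infima
    defining the norms can be compared without being attained. *)
Lemma maximal_coeffs : exists2 K : R, (0 < K)%R &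
  forall f : nat -> Rn R n -> R[i], (forall m, lebesgue_measurable (f m)) ->
  let G x := lnorm u (fun j => modulus (f j x)) in
  let F x := lnorm u (fun j => hl_maximal (f j) x) in
  (\forall x \ae mu, G x \is a fin_num) ->
  forall lam, block_coeffs p t r (fun x => ((fine (G x))%:C)%C) lam ->
  (\forall x \ae mu, F x \is a fin_num) /\
  exists lam', block_coeffs p t r (fun x => ((fine (F x))%:C)%C) lam' /\
    coeff_norm r lam' <= K%:E * coeff_norm r lam.
Proof.
have [H _] := @lnorm_nice_HL R u u1.
have nN := @niceN R n p p1.
have [K K0 hK] := block_decomposition n0 p1 t0 u1 eta0 eta1 rc1 thetaE' ts.
exists K => // f mf G F Gfin lam [_ lamoo [b [hb hsum]]].
(* Borel representatives; the maximal functions remain the same at every point, since they depend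
   only on integrals. *)
have [g hg] := choice mf.
pose phi j x := modulus (g j x).
have nphi j : nnm (phi j) by have [mR mI _] := hg j; exact: measurable_modulus.
have fphi j : \forall x \ae mu, modulus (f j x) = phi j x.
  by have [_ _] := hg j; apply: filterS => x; rewrite /phi => ->.
have FE : F = fun x => lnorm u (fun j => hlm (phi j) x).
  apply/funext => x; congr (lnorm u _); apply/funext => j.
  by rewrite hl_maximalE (hlm_ae _ (nphi j) (fphi j))// => y; exact: modulus_ge0.
pose G' x := lnorm u (fun j => phi j x).
have GG' : \forall x \ae mu, G x = G' x.
  apply: filterS (ae_count fphi) => x hx; congr (lnorm u _).
  by apply/funext => j; rewrite hx.
have [beta hbeta] := choice (fun Q => block_majorant (hb Q)).
have nbeta Q : nnm (beta Q) by case: (hbeta Q).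
have fbeta Q x : beta Q x \is a fin_num by case: (hbeta Q).
have beta_ae := ae_count (fun Q => let: And5 _ _ _ _ h := hbeta Q in h).
have [a [a0 aE]] : exists a : D -> R, (forall Q, 0 <= a Q)%R /\
    forall Q, a Q = Normc.normc (lam Q).
  exists (fun Q => Normc.normc (lam Q)); split => [Q|//].
  by have := modulus_ge0 (lam Q); rewrite lee_fin.
have ellE : coeff_norm r lam = ell rc (fun Q => (a Q)%:E).
  by rewrite coeff_norm_ell; congr ell; apply/funext => Q; rewrite aE.
have nG' : nnm G' by exact: nnm_lnorm.
(* Splitting f_j as the sum of a_Q (f_j / G) beta_Q turns the scalar blocks of G into
   l^u-valued ones. *)
pose psi Q j x := (quot (phi j x) (G' x))%:E * beta Q x.
have nq j : nnm (fun x => (quot (phi j x) (G' x))%:E) by exact: nnm_quot.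
have npsi Q j : nnm (psi Q j) by exact: nnmM.
(* The only use of convergence of the given representation: it yields a nonnegative majorant of
   G. *)
have sum_le : \forall x \ae mu, G' x < +oo /\
    G' x <= \esum_(Q in [set: D]) ((a Q)%:E * beta Q x).
  apply: filterS2 (filterI Gfin GG') (filterI hsum beta_ae) => x [fx gx] [sx bx].
  split; first by rewrite -gx ltey; move: fx; rewrite fin_numE => /andP[].
  have G0 : 0 <= G x by rewrite gx; exact: (nnm_ge0 nG').
  have h := sums_to_norm sx; rewrite modulus_real (ger0_norm (fine_ge0 G0)) (fineK fx) gx in h.
  apply: le_trans h _; apply: le_esum => Q _.
  by rewrite -bx /modulus Normc.normcM EFinM aE.
have phi_le j : \forall x \ae mu, phi j x <= \esum_(Q in [set: D]) ((a Q)%:E * psi Q j x).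
  apply: filterS sum_le => x [Goo h].
  have p0 := nnm_ge0 (nphi j) x.
  have pG : phi j x <= G' x.
    apply: (@le_lnorm R u (fun j => phi j x) j u1) => i; exact: (nnm_ge0 (nphi i)).
  rewrite -[leLHS](quotK p0 pG Goo).
  have qG := quot_ge0 (G' x) p0.
  have aQ Q : 0 <= (a Q)%:E * beta Q x.
    by apply: mule_ge0; [rewrite lee_fin|exact: (nnm_ge0 (nbeta Q))].
  apply: (@le_trans _ _ ((quot (phi j x) (G' x))%:E * \esum_(Q in [set: D]) ((a Q)%:E * beta Q x))).
    by apply: lee_wpmul2l h; rewrite lee_fin.
  rewrite -(esumZ qG aQ); apply: le_esum => Q _.
  by rewrite muleCA.
have nap Q j : nnm (fun x => (a Q)%:E * psi Q j x) by apply: nnmZ; rewrite ?lee_fin.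
have nh Q j := nnm_hlm (npsi Q j).
have Fle x : lnorm u (fun j => hlm (phi j) x) <=
    \esum_(Q in [set: D]) ((a Q)%:E * lnorm u (fun j => hlm (psi Q j) x)).
  have nr Q : nnm (fun j => (a Q)%:E * hlm (psi Q j) x).
    by apply: nnm_seq => j; apply: mule_ge0; [rewrite lee_fin|exact: (nnm_ge0 (nh Q j))].
  apply: (@le_trans _ _ (lnorm u (fun j => \esum_(Q in [set: D]) ((a Q)%:E * hlm (psi Q j) x)))).
    apply: (nice_le H).
    - by apply: nnm_seq => j; exact: hlm_ge0.
    - exact: nnm_esum.
    - move=> j; apply: le_trans (le_hlm_ae x (nphi j) (nnm_esum (fun Q => nap Q j)) (phi_le j)) _.
      apply: le_trans (hlm_esum x (fun Q => nap Q j)) _.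
      by apply: le_esum => Q _; exact: hlmZ.
  apply: le_trans (esum_subadd (rho := lnorm u) _ _ _ nr) _.
  - by move=> Q; exact: (nice_ge0 H).
  - exact: (nice0 H).
  - exact: (nice_series H).
  apply: le_esum => Q _; rewrite (niceZ H (a0 Q)).
    exact: lexx.
  by apply: nnm_seq => j; exact: (nnm_ge0 (nh Q j)).
have psiN Q : mixed_norm (ex [tuple of map hconj p]) (fun x => lnorm u (fun j => psi Q j x))
    <= (bb p t Q.1)%:E.
  have [_ _ _ hN _] := hbeta Q; apply: le_trans hN.
  apply: (nice_le nN) => [||x]; [exact: nnm_lnorm|exact: nbeta|].
  rewrite /psi -(fineK (fbeta Q x)); under [X in lnorm u X]eq_fun do rewrite muleC.
  have b0 := fine_ge0 (nnm_ge0 (nbeta Q) x).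
  have nqx : @nnm R _ nat (fun j => (quot (phi j x) (G' x))%:E).
    by apply: nnm_seq => j; rewrite lee_fin; apply: quot_ge0; exact: (nnm_ge0 (nphi j)).
  rewrite (niceZ H b0 nqx) -[leRHS]mule1; apply: lee_wpmul2l; first by rewrite lee_fin.
  exact: (lnorm_quot u1 (fun j => nnm_ge0 (nphi j) x)).
have psi0 Q j x : ~ dyadic_cube Q x -> psi Q j x = 0.
  have [_ _ hs _ _] := hbeta Q => Qx.
  rewrite /psi (hs x Qx); exact: mule0.
have nF : nnm F by rewrite FE; apply: (nnm_lnorm u1) => j; exact: nnm_hlm.
have Fle' x : F x <= \esum_(Q in [set: D]) ((a Q)%:E * lnorm u (fun j => hlm (psi Q j) x)).
  by rewrite FE.
have aoo : ell rc (fun Q => (a Q)%:E) < +oo by rewrite -ellE.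
have [m [c [m0 hm hc hF]]] := hK a psi F a0 aoo npsi psi0 psiN nF Fle'.
have mE : coeff_norm r (fun P => ((m P)%:C)%C) = ell rc (fun P => (m P)%:E).
  rewrite coeff_norm_ell; congr ell; apply/funext => P.
  by rewrite -/(modulus _) modulus_real ger0_norm.
have Ffin : \forall x \ae mu, F x \is a fin_num.
  by apply: filterS hF => x [h _]; rewrite (ge0_fin_numE (nnm_ge0 nF x)).
split; first exact: Ffin.
exists (fun P => ((m P)%:C)%C); split; last by rewrite mE ellE.
split.
- exists (fun x => ((fine (F x))%:C)%C); split => /=; [|exact: measurable_cst|exact: aeW].
  by apply/measurable_EFinP; exact: (nnm_m (nnm_fine nF)).
- rewrite mE; apply: le_lt_trans hm _; rewrite lte_mul_pinfty ?lee_fin ?(ltW K0)//.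
- exists (fun P x => ((c P x)%:C)%C); split.
    by move=> P; have [h1 h2 h3] := hc P; exact: is_block_real.
  apply: filterS2 Ffin hF => x fx [_ hx].
  have cP P : (0 <= c P x)%R by have [h1 _ _] := hc P; have := nnm_ge0 h1 x; rewrite lee_fin.
  have mc P : (0 <= m P * c P x)%R by exact: mulr_ge0.
  have := sums_to_real mc (etrans hx (esym (fineK fx))).
  by under eq_fun do rewrite rmorphM.
Qed.

End transfer.

(** * Choice of exponents and conclusion *)

Lemma powR2_lt1 (R : realType) (e : R) : (0 < e)%R -> (0 < (2 : R) `^ (- e) < 1)%R.
Proof.
move=> e0; rewrite powR_gt0//= powRN invf_lt1 ?powR_gt0//.
have := @gt0_ltr_powR R e e0 1%R 2%R; rewrite !nnegrE powR1; apply => //.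
exact: ltr1n.
Qed.

(** Here sigma = 1/s, and n = 0 is excluded because then s = 0. *)
Lemma exponents (R : realType) (n : nat) (p : n.-tuple R) (t : R) (r : \bar R) :
  (forall i, 1 < tnth p i)%R ->
  (let s := (n%:R / \sum_(i < n) (tnth p i)^-1)%R in
       [/\ (1 < s)%R, (s < t)%R, t%:E < r & r < +oo] \/
       [/\ (1 < s)%R, (s <= t)%R & r = +oo]) ->
  [/\ (0 < n)%N, (0 < t)%R & exists rc eta : R,
    [/\ hoelder_conjugate r = rc%:E, (0 < eta < 1)%R, (1 <= rc)%R,
      (theta n t = eta * kappa n `^ (1 - rc^-1))%R &
      (t^-1 < sigma p)%R \/ (t^-1 <= sigma p)%R /\ rc = 1%R]].
Proof.
move=> p1; set s := (n%:R / _)%R; cbv zeta.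
have sV : (sigma p = s^-1)%R by rewrite /sigma /s invf_div mulrC.
have n0 : (1 < s)%R -> (0 < n)%N.
  rewrite lt0n; apply: contraL => /eqP e.
  by rewrite /s (_ : n%:R = 0%R) ?mul0r -?leNgt// e.
have nR : (0 < n)%N -> (0 < n%:R :> R)%R by rewrite ltr0n.
case=> [[s1 st tr roo]|[s1 st ->]].
  have s0 : (0 < s)%R by apply: lt_trans s1.
  have t0 : (0 < t)%R by apply: lt_trans st.
  have t1 : (1 < t)%R by apply: lt_trans st.
  split; [exact: n0|exact: t0|].
  case: r tr roo => [r| |]// tr _; rewrite lte_fin in tr.
  have r1 : (1 < r)%R by apply: lt_trans tr.
  have r0 : (0 < r)%R by apply: lt_trans r1.
  (* As 1 - 1/r' = 1/r, this eta is the quotient of 2^(-n/t) by kappa^(1/r); it is below 1 because t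
     < r. *)
  exists (hconj r), (2 `^ (- (n%:R * (t^-1 - r^-1))))%R; split.
  - exact: hoelder_conjugateE.
  - by apply: powR2_lt1; rewrite mulr_gt0 ?nR ?n0// subr_gt0 ltf_pV2.
  - exact/ltW/conj_gt1.
  - rewrite (conjV r1) subKr /theta /kappa -powR_mulrn// -powRN -powRrM -powRD; last first.
      by rewrite pnatr_eq0 implybT.
    by congr (_ `^ _)%R; ring.
  - by left; rewrite sV ltf_pV2.
have s0 : (0 < s)%R by apply: lt_trans s1.
have t0 : (0 < t)%R by apply: lt_le_trans st.
split; [exact: n0|exact: t0|].
exists 1%R, (2 `^ (- (n%:R / t)))%R; split.
- by rewrite /hoelder_conjugate.
- by apply: powR2_lt1; rewrite divr_gt0 ?nR ?n0.
- exact: lexx.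
- by rewrite invr1 subrr powRr0 mulr1.
- by right; split => //; rewrite sV lef_pV2.
Qed.

Theorem theorem6p15 (R : realType) (n : nat) (p : n.-tuple R) (u' : \bar R)
    (t : R) (r : \bar R)
    (hp : forall i : 'I_n, (1 < tnth p i)%R)
    (hu : 1 < u')
    (htr : let s := (n%:R / \sum_(i < n) (tnth p i)^-1)%R in
       [/\ (1 < s)%R, (s < t)%R, t%:E < r & r < +oo] \/
       [/\ (1 < s)%R, (s <= t)%R & r = +oo]) :
  exists C : R, (0 < C)%R /\
    forall f : nat -> Rn R n -> R[i], vblock_space p t r u' f ->
      eblock_norm p t r (fun x => lnorm u' (fun j => hl_maximal (f j) x)) <=
      C%:E * eblock_norm p t r (fun x => lnorm u' (fun j => modulus (f j x))).
Proof.
have [n0 t0 [rc [eta [rE /andP[eta0 eta1] rc1 thE ts]]]] := exponents hp htr.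
have [K K0 hK] := maximal_coeffs n0 hp t0 hu eta0 eta1 rc1 rE thE ts.
exists K; split => // f [mf _]; have {}hK := hK f mf.
(* If G is not finite almost everywhere, the right-hand side is +oo. *)
rewrite {2}/eblock_norm; case: asboolP => Gfin; last first.
  by rewrite gt0_muley ?lte_fin// leey.
rewrite -lee_pdivrMl//; apply: le_ereal_inf_tmp => _ [lam hlam <-].
have [Ffin [lam' [h1 h2]]] := hK Gfin lam hlam.
rewrite lee_pdivrMl//; apply: le_trans h2.
rewrite /eblock_norm asboolT//; apply: ereal_inf_lbound; by exists lam'.
Qed.
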